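(* Let $(A,u)$ be a smooth YMH field on $B^*_{2R_0}\subset\mathbb{R}^n$. Then for any $\delta>0$ there exists a constant $C(n,\delta)>0$ such that: (1) the section $u$ satisfies $$|\nabla_A\nabla_Au|^2\ge\left(\frac{n}{n-1}-\delta\right)\big|\nabla|\nabla_Au|\big|^2-C(n,\delta)(1+|F_A|^2);$$ (2) the curvature $F_A$ of $A$ satisfies $$|\nabla_A F_A|^2\ge\frac32\big|\nabla|F_A|\big|^2-|u^*\nabla_Au|^2\quad\text{if } n=3,$$ $$|\nabla_A F_A|^2\ge\left(\frac{n-1}{n-2}-\delta\right)\big|\nabla|F_A|\big|^2-C(n,\delta)|u^*\nabla_Au|^2\quad\text{if } n\ge4 .$$
   Context: Fixed data: $G$ is a compact connected Lie group with a bi-invariant metric and Lie algebra $\mathfrak g$; $(N,h)$ is a compact Riemannian manifold with a smooth left action of $G$ by isometries; $V:N\to\mathbb{R}$ is a smooth $G$-invariant function. Constants may depend on this fixed data. $B_\rho\subset\mathbb{R}^n$ is the Euclidean ball centred at $0$, $B^*_\rho=B_\rho\setminus\{0\}$. The fiber bundle with fiber $N$ and structure group $G$ is trivial, so over an open set $U$ a smooth connection is a smooth $\mathfrak g$-valued 1-form $A$ and a smooth section is a smooth map $u:U\to N$. Notation: for $c\in\mathfrak g$, $y\in N$, $c\cdot y=X_c(y)=\frac{d}{ds}|_{s=0}\exp(sc)y$, and $c\cdot Y=\nabla_Y X_c$ for tangent vectors $Y$. $F_A=dA+\frac12[A,A]$ with components $F_{ij}$, $\nabla_{A_k}F_{ij}=\partial_kF_{ij}+[A_k,F_{ij}]$.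 $\nabla_A u=\nabla u+A\cdot u$, with components $\nabla_{A_i}u=\partial_i u+A_i\cdot u\in T_uN$; $\nabla_A$ also denotes the induced connection on sections $Y$ of $u^*TN$, $\nabla_{A_i}Y=\nabla_iY+A_i\cdot Y$. $(D_A^*F_A)_j=-\sum_i\nabla_{A_i}F_{ij}$, $\nabla_A^*\nabla_Au=-\sum_i\nabla_{A_i}\nabla_{A_i}u$. $u^*\nabla_Au$ is the $\mathfrak g$-valued 1-form determined by $\langle u^*\nabla_Au,B\rangle=\langle\nabla_Au,B\cdot u\rangle$ for all $\mathfrak g$-valued 1-forms $B$. Norms: $|\nabla_Au|^2=\sum_i|\nabla_{A_i}u|^2$, $|\nabla_A\nabla_Au|^2=\sum_{i,j}|\nabla_{A_i}\nabla_{A_j}u|^2$, $|F_A|^2=\sum_{i<j}|F_{ij}|^2$, $|\nabla_AF_A|^2=\sum_k\sum_{i<j}|\nabla_{A_k}F_{ij}|^2$. The inequalities are pointwise, where $|\nabla_Au|$, respectively $|F_A|$, is differentiable (e.g. where it is nonzero). A smooth YMH (Yang-Mills-Higgs) field on $U$ is a smooth pair $(A,u)$ on $U$ satisfying $$D_A^*F_A=-u^*\nabla_Au,\qquad \nabla_A^*\nabla_Au=-\nabla V(u).$$ Here $n\ge2$ in (1). *)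

(* Defs.v *)
From HB Require Import structures.
From mathcomp Require Import all_boot all_order all_algebra.
From mathcomp Require Import all_classical all_reals all_analysis.
Import Order.TTheory GRing.Theory Num.Theory.
Import numFieldNormedType.Exports.

Set Implicit Arguments.
Unset Strict Implicit.
Unset Printing Implicit Defensive.

Local Open Scope classical_set_scope.
Local Open Scope ring_scope.

Definition basis_vec (R : realType) (n : nat) (i : 'I_n) : 'rV[R]_n :=
  delta_mx 0 i.

Definition pderiv (R : realType) (n : nat) (W : normedModType R) (i : 'I_n)
  (f : 'rV[R]_n -> W) : 'rV[R]_n -> W := fun x => 'D_(basis_vec R i) f x.

(* [U] is always open below, so that only the values of [f] on [U] matter. *)
Fixpoint Cr_on (R : realType) (n r : nat) (U : set 'rV[R]_n)
    (f : 'rV[R]_n -> R) : Prop :=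
  (forall x, U x -> {for x, continuous f}) /\
  (if r is r'.+1 then
     forall i : 'I_n, (forall x, U x -> derivable f x (basis_vec R i)) /\
                      Cr_on r' U (pderiv i f)
   else True).

Definition smooth_on (R : realType) (n p q : nat) (U : set 'rV[R]_n)
    (F : 'rV[R]_n -> 'M[R]_(p, q)) : Prop :=
  forall a b r, Cr_on r U (fun x => F x a b).

(* The norm of the library on ['rV_n] is the sup norm. *)
Definition enorm (R : realType) (n : nat) (x : 'rV[R]_n) : R :=
  Num.sqrt (\sum_(i < n) x 0 i ^+ 2).

Definition punctured_ball (R : realType) (n : nat) (r : R) : set 'rV[R]_n :=
  [set x | 0 < enorm x < r].

Definition grad_normsq (R : realType) (n : nat) (f : 'rV[R]_n -> R)
    (x : 'rV[R]_n) : R :=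
  \sum_(k < n) (pderiv k f x) ^+ 2.

Definition ip (R : realType) (m : nat) (g : 'M[R]_m) (v w : 'rV[R]_m) : R :=
  (v *m g *m w^T) 0 0.

Definition posdef (R : realType) (m : nat) (g : 'M[R]_m) : Prop :=
  g^T = g /\ forall v : 'rV[R]_m, v != 0 -> 0 < ip g v v.

(* The vector representing a linear functional; see [riesz_spec] and
   [riesz_unique]. *)
Definition riesz (R : realType) (m : nat) (g : 'M[R]_m)
    (l : 'rV[R]_m -> R) : 'rV[R]_m :=
  (\row_k l (basis_vec R k)) *m invmx g.

Lemma posdef_unit (R : realType) (m : nat) (g : 'M[R]_m) :
  posdef g -> g \in unitmx.
Proof.
move=> [_ g0]; rewrite -row_free_unit; apply: contraT => gN.
have : kermx g != 0 by rewrite kermx_eq0.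
case/rowV0Pn => v /sub_kermxP vg v0.
by have := g0 v v0; rewrite /ip vg mul0mx mxE ltxx.
Qed.

Lemma riesz_spec (R : realType) (m : nat) (g : 'M[R]_m)
    (l : {scalar 'rV[R]_m}) (w : 'rV[R]_m) :
  posdef g -> ip g (riesz g l) w = l w.
Proof.
move=> /posdef_unit gu; rewrite /ip /riesz mulmxKV // mxE.
rewrite [in RHS](row_sum_delta w) linear_sum.
by apply: eq_bigr => k _; rewrite linearZ !mxE mulrC.
Qed.

Lemma riesz_unique (R : realType) (m : nat) (g : 'M[R]_m)
    (l : {scalar 'rV[R]_m}) (v : 'rV[R]_m) :
  posdef g -> (forall w, ip g v w = l w) -> v = riesz g l.
Proof.
move=> gp vl; have gu := posdef_unit gp.
apply: (can_inj (mulmxK gu)); rewrite /riesz mulmxKV //.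
apply/rowP => k; rewrite [in RHS]mxE -vl /ip /basis_vec trmx_delta.
by rewrite -colE !mxE.
Qed.

(* A smooth structure is given by an atlas (not required to be maximal).
   [ch_inv i] is a total function, relevant only on the image of the chart. *)
Record manifold (R : realType) (m : nat) := Manifold {
  pt :> topologicalType;
  pt_hausdorff : hausdorff_space pt;
  pt_countable : @second_countable pt;
  ch_idx : Type;
  ch_dom : ch_idx -> set pt;
  ch_map : ch_idx -> pt -> 'rV[R]_m;
  ch_inv : ch_idx -> 'rV[R]_m -> pt;
  ch_cover : forall y, exists i, ch_dom i y;
  ch_dom_open : forall i, open (ch_dom i);
  ch_img_open : forall i, open (ch_map i @` ch_dom i);
  ch_mapK : forall i y, ch_dom i y -> ch_inv i (ch_map i y) = y;
  ch_map_cont : forall i y, ch_dom i y -> {for y, continuous (ch_map i)};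
  ch_inv_cont : forall i x, (ch_map i @` ch_dom i) x ->
    {for x, continuous (ch_inv i)};
  ch_transition : forall i j,
    smooth_on (ch_map i @` (ch_dom i `&` ch_dom j))
      (fun x => ch_map j (ch_inv i x))
}.

Definition ch_img (R : realType) (m : nat) (M : manifold R m) (i : ch_idx M) :
  set 'rV[R]_m := ch_map i @` ch_dom i.

Definition in_charts (R : realType) (m m' : nat) (M : manifold R m)
    (M' : manifold R m') (f : M -> M') (i : ch_idx M) (j : ch_idx M')
    (x : 'rV[R]_m) : 'rV[R]_m' :=
  ch_map j (f (ch_inv i x)).

Definition smooth_map (R : realType) (m m' : nat) (M : manifold R m)
    (M' : manifold R m') (f : M -> M') : Prop :=
  continuous f /\
  forall i j, smooth_on (ch_map i @` (ch_dom i `&` f @^-1` ch_dom j))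
    (in_charts f i j).

(* Smoothness of a map on a product manifold, in the product charts. *)
Definition smooth_map2 (R : realType) (m1 m2 m3 : nat) (M1 : manifold R m1)
    (M2 : manifold R m2) (M3 : manifold R m3) (f : M1 -> M2 -> M3) : Prop :=
  continuous (fun p : M1 * M2 => f p.1 p.2) /\
  forall i j k, smooth_on
    [set z : 'rV[R]_(m1 + m2) |
       ch_img i (lsubmx z) /\ ch_img j (rsubmx z) /\
       ch_dom k (f (ch_inv i (lsubmx z)) (ch_inv j (rsubmx z)))]
    (fun z => ch_map k (f (ch_inv i (lsubmx z)) (ch_inv j (rsubmx z)))).

Definition smooth_fun (R : realType) (m : nat) (M : manifold R m)
    (f : M -> R) : Prop :=
  forall i r, Cr_on r (ch_img i) (fun x => f (ch_inv i x)).

Definition smooth_section (R : realType) (n m : nat) (M : manifold R m)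
    (U : set 'rV[R]_n) (u : 'rV[R]_n -> M) : Prop :=
  (forall x, U x -> {for x, continuous u}) /\
  forall i, smooth_on (U `&` u @^-1` ch_dom i) (fun x => ch_map i (u x)).

Definition metric (R : realType) (m : nat) (M : manifold R m) :=
  ch_idx M -> 'rV[R]_m -> 'M[R]_m.

Definition isometric (R : realType) (m : nat) (M : manifold R m)
    (g : metric M) (f : M -> M) : Prop :=
  forall i j y, ch_dom i y -> ch_dom j (f y) ->
  forall v w : 'rV[R]_m,
    ip (g j (ch_map j (f y))) ('D_v (in_charts f i j) (ch_map i y))
                              ('D_w (in_charts f i j) (ch_map i y))
    = ip (g i (ch_map i y)) v w.

(* The last clause says that the local expressions of the metric agree on
   overlaps of charts. *)
Definition riemannian (R : realType) (m : nat) (M : manifold R m)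
    (g : metric M) : Prop :=
  [/\ forall i x, ch_img i x -> posdef (g i x),
      forall i, smooth_on (ch_img i) (g i)
    & isometric g (fun y => y)].

(* Koszul formula for coordinate vector fields: the Levi-Civita connection is
   D_v Y + christoffel g i x v Y in the chart i. *)
Definition christoffel (R : realType) (m : nat) (M : manifold R m)
    (g : metric M) (i : ch_idx M) (x v w : 'rV[R]_m) : 'rV[R]_m :=
  riesz (g i x) (fun z =>
    (ip ('D_v (g i) x) w z + ip ('D_w (g i) x) v z - ip ('D_z (g i) x) v w) / 2).

Definition grad (R : realType) (m : nat) (M : manifold R m) (g : metric M)
    (f : M -> R) (i : ch_idx M) (x : 'rV[R]_m) : 'rV[R]_m :=
  riesz (g i x) (fun z => 'D_z (fun x' => f (ch_inv i x')) x).

(* The Lie algebra is the tangent space at the unit, identified with R^d by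
   means of the chart [lg_chart] around the unit. *)
Record lie_group (R : realType) (d : nat) := LieGroup {
  lg_pt :> manifold R d;
  lg_mul : lg_pt -> lg_pt -> lg_pt;
  lg_one : lg_pt;
  lg_inv : lg_pt -> lg_pt;
  lg_mulA : forall a b c, lg_mul a (lg_mul b c) = lg_mul (lg_mul a b) c;
  lg_mul1 : forall a, lg_mul lg_one a = a;
  lg_mulV : forall a, lg_mul (lg_inv a) a = lg_one;
  lg_mul_smooth : smooth_map2 lg_mul;
  lg_inv_smooth : smooth_map lg_inv;
  lg_chart : ch_idx lg_pt;
  lg_chart1 : ch_dom lg_chart lg_one
}.

(* For each c, s |-> E (s c) is the one-parameter subgroup with velocity c at
   s = 0. This determines E, since a continuous homomorphism from R to a Lie
   group is smooth. *)
Definition is_lie_exp (R : realType) (d : nat) (G : lie_group R d)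
    (E : 'rV[R]_d -> G) : Prop :=
  forall c : 'rV[R]_d,
  [/\ continuous (fun s : R => E (s *: c)),
      forall s t : R, E ((s + t) *: c) = lg_mul (E (s *: c)) (E (t *: c))
    & is_derive (0 : R) 1 (fun s : R => ch_map (lg_chart G) (E (s *: c))) c].

Record ymh_data (R : realType) (d m : nat) := YMHData {
  ymh_G : lie_group R d;
  ymh_G_compact : compact [set: ymh_G];
  ymh_G_connected : connected [set: ymh_G];
  ymh_gG : metric ymh_G;
  ymh_gG_riemannian : riemannian ymh_gG;
  ymh_gG_left : forall a, isometric ymh_gG (lg_mul a);
  ymh_gG_right : forall a, isometric ymh_gG (fun b => lg_mul b a);
  ymh_exp : 'rV[R]_d -> ymh_G;
  ymh_expP : is_lie_exp ymh_exp;
  ymh_N : manifold R m;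
  ymh_N_compact : compact [set: ymh_N];
  ymh_h : metric ymh_N;
  ymh_h_riemannian : riemannian ymh_h;
  ymh_act : ymh_G -> ymh_N -> ymh_N;
  ymh_act1 : forall y, ymh_act (lg_one ymh_G) y = y;
  ymh_actM : forall a b y, ymh_act (lg_mul a b) y = ymh_act a (ymh_act b y);
  ymh_act_smooth : smooth_map2 ymh_act;
  ymh_act_isometric : forall a, isometric ymh_h (ymh_act a);
  ymh_V : ymh_N -> R;
  ymh_V_smooth : smooth_fun ymh_V;
  ymh_V_invariant : forall a y, ymh_V (ymh_act a y) = ymh_V y
}.

Arguments ymh_gG {R d m} S _ _ : rename.
Arguments ymh_h {R d m} S _ _ : rename.
Arguments ymh_exp {R d m} S _ : rename.
Arguments ymh_act {R d m} S _ _ : rename.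
Arguments ymh_V {R d m} S _ : rename.

(* Gram matrix of the inner product on the Lie algebra. *)
Definition gram (R : realType) (d m : nat) (S : ymh_data R d m) : 'M[R]_d :=
  ymh_gG S (lg_chart (ymh_G S)) (ch_map (lg_chart (ymh_G S)) (lg_one (ymh_G S))).

Definition Ad (R : realType) (d m : nat) (S : ymh_data R d m) (a : ymh_G S)
    (c : 'rV[R]_d) : 'rV[R]_d :=
  derive1 (fun t : R => ch_map (lg_chart (ymh_G S))
     (lg_mul (lg_mul a (ymh_exp S (t *: c))) (lg_inv a))) 0.

Definition bracket (R : realType) (d m : nat) (S : ymh_data R d m)
    (c c' : 'rV[R]_d) : 'rV[R]_d :=
  derive1 (fun s : R => Ad (ymh_exp S (s *: c)) c') 0.

(* In what follows [p] is a chart of N, and points of N and tangent vectors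
   to N are given by their coordinates in this chart. The quantities along a
   section u are meaningful at the x with u x in the domain of [p]; there the
   inner products do not depend on [p]. *)

(* c . y = X_c(y) *)
Definition infact (R : realType) (d m : nat) (S : ymh_data R d m)
    (p : ch_idx (ymh_N S)) (c : 'rV[R]_d) (y : 'rV[R]_m) : 'rV[R]_m :=
  derive1 (fun s : R => ch_map p (ymh_act S (ymh_exp S (s *: c)) (ch_inv p y))) 0.

(* c . Y = nabla_Y X_c *)
Definition infact_vec (R : realType) (d m : nat) (S : ymh_data R d m)
    (p : ch_idx (ymh_N S)) (c : 'rV[R]_d) (y Y : 'rV[R]_m) : 'rV[R]_m :=
  'D_Y (infact p c) y + christoffel (ymh_h S) p y Y (infact p c y).

(* The components A_1, ..., A_n of a Lie algebra valued 1-form on R^n. *)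
Definition form1 (R : realType) (n d : nat) := 'I_n -> 'rV[R]_n -> 'rV[R]_d.

Definition curv (R : realType) (d m n : nat) (S : ymh_data R d m)
    (A : form1 R n d) (i j : 'I_n) (x : 'rV[R]_n) : 'rV[R]_d :=
  pderiv i (A j) x - pderiv j (A i) x + bracket S (A i x) (A j x).

(* nabla_{A_k} F_{ij} *)
Definition dcurv (R : realType) (d m n : nat) (S : ymh_data R d m)
    (A : form1 R n d) (k i j : 'I_n) (x : 'rV[R]_n) : 'rV[R]_d :=
  pderiv k (curv S A i j) x + bracket S (A k x) (curv S A i j x).

(* (D_A^* F_A)_j *)
Definition div_curv (R : realType) (d m n : nat) (S : ymh_data R d m)
    (A : form1 R n d) (j : 'I_n) (x : 'rV[R]_n) : 'rV[R]_d :=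
  - \sum_(i < n) dcurv S A i i j x.

Definition curv_normsq (R : realType) (d m n : nat) (S : ymh_data R d m)
    (A : form1 R n d) (x : 'rV[R]_n) : R :=
  \sum_(i < n) \sum_(j < n | (i < j)%N)
    ip (gram S) (curv S A i j x) (curv S A i j x).

Definition curv_norm (R : realType) (d m n : nat) (S : ymh_data R d m)
    (A : form1 R n d) (x : 'rV[R]_n) : R :=
  Num.sqrt (curv_normsq S A x).

Definition dcurv_normsq (R : realType) (d m n : nat) (S : ymh_data R d m)
    (A : form1 R n d) (x : 'rV[R]_n) : R :=
  \sum_(k < n) \sum_(i < n) \sum_(j < n | (i < j)%N)
    ip (gram S) (dcurv S A k i j x) (dcurv S A k i j x).

Definition usec (R : realType) (d m n : nat) (S : ymh_data R d m)
    (p : ch_idx (ymh_N S)) (u : 'rV[R]_n -> ymh_N S) (x : 'rV[R]_n) : 'rV[R]_m :=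
  ch_map p (u x).

(* nabla_{A_i} u *)
Definition du (R : realType) (d m n : nat) (S : ymh_data R d m)
    (p : ch_idx (ymh_N S)) (A : form1 R n d) (u : 'rV[R]_n -> ymh_N S) (i : 'I_n)
    (x : 'rV[R]_n) : 'rV[R]_m :=
  pderiv i (usec p u) x + infact p (A i x) (usec p u x).

(* nabla_{A_i} Y for a section Y of u^* TN, where nabla is the pull-back of
   the Levi-Civita connection. *)
Definition cov (R : realType) (d m n : nat) (S : ymh_data R d m)
    (p : ch_idx (ymh_N S)) (A : form1 R n d) (u : 'rV[R]_n -> ymh_N S) (i : 'I_n)
    (Y : 'rV[R]_n -> 'rV[R]_m) (x : 'rV[R]_n) : 'rV[R]_m :=
  pderiv i Y x
  + christoffel (ymh_h S) p (usec p u x) (pderiv i (usec p u) x) (Y x)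
  + infact_vec p (A i x) (usec p u x) (Y x).

(* nabla_{A_i} nabla_{A_j} u *)
Definition ddu (R : realType) (d m n : nat) (S : ymh_data R d m)
    (p : ch_idx (ymh_N S)) (A : form1 R n d) (u : 'rV[R]_n -> ymh_N S) (i j : 'I_n) :
    'rV[R]_n -> 'rV[R]_m :=
  cov p A u i (du p A u j).

(* nabla_A^* nabla_A u *)
Definition rough_lap (R : realType) (d m n : nat) (S : ymh_data R d m)
    (p : ch_idx (ymh_N S)) (A : form1 R n d) (u : 'rV[R]_n -> ymh_N S)
    (x : 'rV[R]_n) : 'rV[R]_m :=
  - \sum_(i < n) ddu p A u i i x.

(* (u^* nabla_A u)_j *)
Definition upull (R : realType) (d m n : nat) (S : ymh_data R d m)
    (p : ch_idx (ymh_N S)) (A : form1 R n d) (u : 'rV[R]_n -> ymh_N S) (j : 'I_n)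
    (x : 'rV[R]_n) : 'rV[R]_d :=
  riesz (gram S) (fun b =>
    ip (ymh_h S p (usec p u x)) (du p A u j x) (infact p b (usec p u x))).

Definition du_normsq (R : realType) (d m n : nat) (S : ymh_data R d m)
    (p : ch_idx (ymh_N S)) (A : form1 R n d) (u : 'rV[R]_n -> ymh_N S)
    (x : 'rV[R]_n) : R :=
  \sum_(i < n) ip (ymh_h S p (usec p u x)) (du p A u i x) (du p A u i x).

Definition du_norm (R : realType) (d m n : nat) (S : ymh_data R d m)
    (p : ch_idx (ymh_N S)) (A : form1 R n d) (u : 'rV[R]_n -> ymh_N S)
    (x : 'rV[R]_n) : R :=
  Num.sqrt (du_normsq p A u x).

Definition ddu_normsq (R : realType) (d m n : nat) (S : ymh_data R d m)
    (p : ch_idx (ymh_N S)) (A : form1 R n d) (u : 'rV[R]_n -> ymh_N S)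
    (x : 'rV[R]_n) : R :=
  \sum_(i < n) \sum_(j < n)
    ip (ymh_h S p (usec p u x)) (ddu p A u i j x) (ddu p A u i j x).

Definition upull_normsq (R : realType) (d m n : nat) (S : ymh_data R d m)
    (p : ch_idx (ymh_N S)) (A : form1 R n d) (u : 'rV[R]_n -> ymh_N S)
    (x : 'rV[R]_n) : R :=
  \sum_(j < n) ip (gram S) (upull p A u j x) (upull p A u j x).

Definition ymh_field (R : realType) (d m n : nat) (S : ymh_data R d m)
    (U : set 'rV[R]_n) (A : form1 R n d) (u : 'rV[R]_n -> ymh_N S) : Prop :=
  [/\ forall i, smooth_on U (A i),
      smooth_section U u,
      forall x p, U x -> ch_dom p (u x) ->
        forall j, div_curv S A j x = - upull p A u j x
    & forall x p, U x -> ch_dom p (u x) ->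
        rough_lap p A u x = - grad (ymh_h S) (ymh_V S) p (usec p u x)].

(* Main.v *)
(* Where |nabla_A u| is nonzero, put w_i = nabla_{A_i} u / |nabla_A u| and
   W_{ki} = nabla_{A_k} nabla_{A_i} u, so that f_k = d_k |nabla_A u| is the inner
   product of W_{k.} and w. The antisymmetric part of W is F_{ki} . u and its
   trace is grad V(u); both are bounded by compactness of N, up to |F_A|. The
   constant n / (n - 1) comes from expanding
   0 <= |W - t (symmetric traceless part of f (x) w)|^2 with t = n / (n - 1);
   Young's inequality, at the price of delta, absorbs the terms in which the
   antisymmetric part and the trace of W are paired with f (x) w.
   For the curvature, T_{kij} = nabla_{A_k} F_{ij} has vanishing cyclic sums
   (Bianchi) and contraction given by the Yang-Mills equation. With
   w = F_A / |F_A|, one subtracts from T the part of t f (x) w without cyclic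
   sums and with the matching contraction.
   At zeros the norms have a minimum, so their gradients vanish. The commutation
   rule for F_{ki} . u and the Bianchi identity come from differentiating the
   associativity law of the action twice. *)
Require Import Defs.
From HB Require Import structures.
From mathcomp Require Import all_boot all_order all_algebra.
From mathcomp Require Import all_classical all_reals all_analysis.
From mathcomp Require Import ring lra.
Import Order.TTheory GRing.Theory Num.Theory.
Import numFieldNormedType.Exports.
Set Implicit Arguments.
Unset Strict Implicit.
Unset Printing Implicit Defensive.
Local Open Scope classical_set_scope.
Local Open Scope ring_scope.

(** * Derivatives along vectors *)

(** The vectors c . y and [a, c] are defined by derivatives along exponential curves, from which not
    even linearity in c can be read off. They are rewritten as derivatives at the unit of the action
    and of the product in charts: only the velocity of the exponential curve survives, c . y is a
    first partial derivative of the action, and [a, c] is the antisymmetrised mixed second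
    derivative [dmul2] of the product. Linearity, the Jacobi identity, the Killing equation and
    Ad-invariance then follow by differentiating group laws and isometry identities. The chart [p]
    in the theorem is arbitrary, while C must not depend on it. Bounds on N are therefore found near
    each point in one chosen chart and carried to every other chart by the transitions, which are
    isometries. The loss of delta has a definite source. In (1), and in (2) for n at least 4, the
    chosen t makes the main terms sharp in the worst case, so the cross terms can only be paid for
    with delta F. For n = 3 and t = 3/2 a positive multiple of |sigma|^2 is left over, where sigma
    is the contraction of f (x) w; this is just what Young's inequality consumes, hence explicit
    constants without delta. *)

Section Directional.
Context {R : realType} {V W : normedModType R}.
Implicit Types (f : V -> W) (x v : V).

(** Passage to one real variable, where the mean value theorem is available. *)
Lemma derive_line f x v (t : R) :
  'D_1 (fun h : R => f (h *: v + x)) t = 'D_v f (t *: v + x).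
Proof.
rewrite /derive; set g1 := (X in lim (X @ _) = _).
set g2 := (X in _ = lim (X @ _)).
suff -> : g1 = g2 by []; apply/funext => h; rewrite /g1 /g2 /=.
by rewrite /shift/= [h%:A]mulr1 scalerDl addrA.
Qed.

Lemma derivable_line f x v (t : R) :
  derivable f (t *: v + x) v -> derivable (fun h : R => f (h *: v + x)) t 1.
Proof.
rewrite /derivable; set g1 := (X in cvg (X @ _) -> _).
set g2 := (X in _ -> cvg (X @ _)).
suff -> : g1 = g2 by []; apply/funext => h; rewrite /g1 /g2 /=.
by rewrite /shift/= [h%:A]mulr1 scalerDl addrA.
Qed.

Lemma derive_chain (U : normedModType R) (g : U -> V) f (x v : U) :
  differentiable g x -> differentiable f (g x) ->
  'D_v (f \o g) x = 'D_('D_v g x) f (g x).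
Proof.
move=> dg df; have dfg := differentiable_comp dg df.
by rewrite !deriveE // diff_comp.
Qed.

Lemma deriveDdir f x v w : differentiable f x ->
  'D_(v + w) f x = 'D_v f x + 'D_w f x.
Proof. by move=> df; rewrite !deriveE // linearD. Qed.

Lemma deriveZdir f x v (c : R) : differentiable f x ->
  'D_(c *: v) f x = c *: 'D_v f x.
Proof. by move=> df; rewrite !deriveE // linearZ. Qed.

Lemma deriveNdir f x v : differentiable f x -> 'D_(- v) f x = - 'D_v f x.
Proof. by move=> df; rewrite !deriveE // linearN. Qed.

Lemma deriveBdir f x v w : differentiable f x ->
  'D_(v - w) f x = 'D_v f x - 'D_w f x.
Proof. by move=> df; rewrite deriveDdir // deriveNdir. Qed.

Lemma derive_sumdir (I : Type) (r : seq I) (v : I -> V) f x :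
  differentiable f x ->
  'D_(\sum_(i <- r) v i) f x = \sum_(i <- r) 'D_(v i) f x.
Proof.
move=> df; rewrite !deriveE // linear_sum.
by apply: eq_bigr => i _; rewrite deriveE.
Qed.

(** Chart formulas hold only near a point, so differentiability must pass between functions that
    agree there. The differential of [f] also approximates [g] to first order, and [diff_unique]
    identifies it with the differential of [g]. *)
Lemma near_eq_differentiable f g x :
  (\forall y \near x, f y = g y) -> differentiable f x -> differentiable g x.
Proof.
move=> fg df; have fgx := nbhs_singleton fg.
have gE : g \o shift x = cst (g x) + 'd f x +o_ 0 id.
  apply/eqaddoP => e e0.
  have /eqaddoP/(_ e e0) := diff_locally df.
  move=> H; near=> h.
  have : `|(f \o shift x - (cst (f x) + 'd f x)) h| <= e * `|(id : V -> V) h| by near: h.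
  rewrite /= -!fctE /= !fctE /=.
  suff -> : f (h + x) = g (h + x) by rewrite fgx.
  near: h.
  have := fg; rewrite (near_shift 0 x) /=.
  by apply: filterS => h; rewrite /= subr0.
have E := diff_unique (diff_continuous df) gE.
by apply/diff_locallyP; rewrite E; split=> //; exact: diff_continuous.
Unshelve. all: by end_near. Qed.

(** The case of differential zero, to be applied once the candidate linear part has been
    subtracted. *)
Lemma littleo_differentiable f x :
  (forall e : R, 0 < e -> \forall h \near 0, `|f (h + x) - f x| <= e * `|h|) ->
  differentiable f x.
Proof.
move=> H.
have fE : f \o shift x = cst (f x) + (\0 : {linear V -> W}) +o_ 0 id.
  apply/eqaddoP => e e0; apply: filterS (H e e0) => h /=.
  by rewrite -!fctE /= !fctE /= addr0.
have c0 : continuous (\0 : {linear V -> W}) by move=> y; exact: cst_continuous.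
have E := diff_unique c0 fE.
by apply/diff_locallyP; rewrite E.
Qed.

End Directional.

Section MeanValue.
Context {R : realType} {V : normedModType R}.

Lemma MVT_dir (f : V -> R) (a v : V) (t : R) :
  (forall s : R, `|s| <= `|t| -> derivable f (s *: v + a) v) ->
  exists2 s : R, `|s| <= `|t| &
    f (t *: v + a) - f a = t * 'D_v f (s *: v + a).
Proof.
move=> fd; pose g (h : R) := f (h *: v + a).
have gd (s : R) : `|s| <= `|t| -> is_derive s 1 g ('D_v f (s *: v + a)).
  move=> st; apply: DeriveDef; first exact/derivable_line/fd.
  exact: derive_line.
have gc (b c : R) : (forall s, s \in `[b, c] -> `|s| <= `|t|) ->
    {within `[b, c], continuous g}.
  move=> bc; apply: derivable_within_continuous => s /bc st.
  by have [] := gd _ st.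
have g0 : g 0 = f a by rewrite /g scale0r add0r.
have [t0|t0] := leP 0 t.
  have I (s : R) : s \in `[0, t] -> `|s| <= `|t|.
    by rewrite in_itv/= => /andP[s0 st]; rewrite !ger0_norm.
  have I' (s : R) : s \in `]0, t[ -> is_derive s 1 g ('D_v f (s *: v + a)).
    by move=> st; apply/gd/I; move: st; exact: subset_itv_oo_cc.
  have [s st E] := MVT_segment t0 I' (gc _ _ I).
  by exists s; [exact: I|rewrite -g0 -[f _]/(g t) E subr0 mulrC].
have I (s : R) : s \in `[t, 0] -> `|s| <= `|t|.
  by rewrite in_itv/= => /andP[ts s0]; rewrite !ler0_norm ?lerN2 // ltW.
have I' (s : R) : s \in `]t, 0[ -> is_derive s 1 g ('D_v f (s *: v + a)).
  by move=> st; apply/gd/I; move: st; exact: subset_itv_oo_cc.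
have [s st E] := MVT_segment (ltW t0) I' (gc _ _ I).
exists s; first exact: I.
by rewrite -g0 -[f _]/(g t) -opprB E sub0r mulrN opprK mulrC.
Qed.

End MeanValue.

Lemma differentiable_bigsum (R : realType) (V W : normedModType R) (I : Type)
    (r : seq I) (F : I -> V -> W) (x : V) :
  (forall i, differentiable (F i) x) ->
  differentiable (fun y => \sum_(i <- r) F i y) x.
Proof.
move=> dF; elim: r => [|i r IH].
  rewrite (_ : (fun _ => _) = cst 0); first exact: differentiable_cst.
  by apply/funext => y; rewrite big_nil.
rewrite (_ : (fun _ => _) = F i + (fun y => \sum_(j <- r) F j y)).
  exact: differentiableD.
by apply/funext => y; rewrite big_cons.
Qed.

Section MatrixValued.
Context {R : realType} {V : normedModType R} {p q : nat}.
Implicit Types (F : V -> 'M[R]_(p, q)) (x v : V).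

Lemma differentiable_entry F x i j :
  differentiable F x -> differentiable (fun y => F y i j) x.
Proof.
move=> dF.
exact: (differentiable_comp (g := fun N : 'M[R]_(p, q) => N i j : R) dF
  (differentiable_coord _ _ _)).
Qed.

Lemma differentiable_mxP F x :
  differentiable F x <-> forall i j, differentiable (fun y => F y i j) x.
Proof.
split=> [dF i j|dF]; first exact: differentiable_entry.
have -> : F = \sum_(i < p) \sum_(j < q) (fun y => F y i j *: delta_mx i j).
  apply/funext => y; rewrite fct_sumE [LHS]matrix_sum_delta.
  by apply: eq_bigr => i _; rewrite fct_sumE.
apply: differentiable_sum => i; apply: differentiable_sum => j.
exact: differentiableZl.
Qed.

Lemma derive_entry F x v i j : derivable F x v ->
  ('D_v F x) i j = 'D_v (fun y => F y i j) x.
Proof. by move=> dF; rewrite derive_mx // mxE. Qed.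

End MatrixValued.

Lemma mx_entry_le_norm (R : realType) p q (M : 'M[R]_(p, q)) i j :
  `|M i j| <= `|M|.
Proof.
rewrite [leRHS]/Num.Def.normr/= mx_normrE.
exact: (le_bigmax _ (fun ij : 'I_p * 'I_q => `|M ij.1 ij.2|) (i, j)).
Qed.

(** After subtraction of the candidate differential [L], the increment is telescoped by changing one
    coordinate at a time; the mean value theorem bounds each step by the oscillation of one partial
    derivative. *)
Lemma C1_differentiable (R : realType) n (f : 'rV[R]_n -> R) x :
  (\forall y \near x, forall i, derivable f y (basis_vec R i)) ->
  (forall i, {for x, continuous (pderiv i f)}) ->
  differentiable f x.
Proof.
move=> fd fc.
pose L (y : 'rV[R]_n) := \sum_(i < n) y 0 i * pderiv i f x.
have dL : differentiable L x.
  apply: (@differentiable_bigsum _ _ R) => i.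
  exact: (differentiableZl (pderiv i f x) (differentiable_coord _ _ _)).
suff dg : differentiable (f - L) x.
  by rewrite -[f](subrK L); exact: differentiableD.
apply: littleo_differentiable => e e0.
(* The share of the error allotted to each of the [n] coordinate steps; [n.+1] avoids a division by
   zero for n = 0. *)
have en0 : 0 < e / n.+1%:R by rewrite divr_gt0.
have : \forall y \near x, (forall i, derivable f y (basis_vec R i)) /\
    (forall i, `|pderiv i f x - pderiv i f y| <= e / n.+1%:R).
  apply: filterI; [exact: fd|].
  have H i : \forall y \near x, `|pderiv i f x - pderiv i f y| <= e / n.+1%:R.
    exact: ((cvgrPdist_le _ _).1 (fc i) _ en0).
  exact: (filter_forall _ H).
move=> /nbhs_ballP[d /= d0 dP]; near=> h.
have hd : `|h| < d by near: h; exact: cvgr0_norm_lt.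
pose hk (k : nat) : 'rV[R]_n := \row_j (if (j < k)%N then h 0 j else 0).
have hkS (k : 'I_n) : hk k.+1 = h 0 k *: basis_vec R k + hk k.
  apply/rowP => j; rewrite !mxE eqxx /= ltnS leq_eqVlt.
  have [jk|jk] := eqVneq (j : nat) k; last by rewrite (negbTE (_ : j != k)) // mulr0 add0r.
  by rewrite -(val_inj jk) eqxx ltnn mulr1 addr0.
have step (k : 'I_n) :
    `|(f - L) (hk k.+1 + x) - (f - L) (hk k + x)| <= e / n.+1%:R * `|h|.
  (* Intermediate points stay in the ball because, for the sup norm, truncating or shrinking
     coordinates does not increase the norm. *)
  have near_x (s : R) : `|s| <= `|h 0 k| ->
      ball x d (s *: basis_vec R k + (hk k + x)).
    move=> sh; rewrite -ball_normE /= addrA opprD addrCA subrr addr0 normrN.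
    apply: le_lt_trans hd; rewrite [leLHS]/Num.Def.normr/= mx_normrE.
    apply: bigmax_le => // -[i j] _ /=; rewrite !mxE ord1 eqxx /=.
    have [->|jk] := eqVneq j k.
      by rewrite ltnn mulr1 addr0 (le_trans sh) // mx_entry_le_norm.
    rewrite mulr0 add0r; case: ifP => _; rewrite ?normr0 //.
    exact: mx_entry_le_norm.
  have [s sh E] := MVT_dir (f := f) (a := hk k + x) (v := basis_vec R k)
    (t := h 0 k) (fun s sh => (dP _ (near_x s sh)).1 k).
  have -> : (f - L) (hk k.+1 + x) - (f - L) (hk k + x) =
      h 0 k * (pderiv k f (s *: basis_vec R k + (hk k + x)) - pderiv k f x).
    have LD : L (hk k.+1 + x) = L (hk k + x) + h 0 k * pderiv k f x.
      apply/eqP; rewrite -subr_eq0 opprD addrA subr_eq0; apply/eqP.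
      rewrite /L -sumrN -big_split /= (bigD1 k) //= big1 => [|j jk].
        by rewrite hkS !mxE !eqxx /= mulr1 addr0; ring.
      by rewrite hkS !mxE eqxx (negbTE jk) mulr0 add0r subrr.
    have gE y : (f - L) y = f y - L y by [].
    by rewrite !gE LD mulrBr {2}/pderiv -E hkS -!addrA; ring.
  rewrite normrM mulrC ler_pM // ?mx_entry_le_norm // distrC.
  exact: (dP _ (near_x s sh)).2.
have tele (k : nat) : (k <= n)%N ->
    `|(f - L) (hk k + x) - (f - L) x| <= k%:R * (e / n.+1%:R * `|h|).
  elim: k => [_|k IH kn].
    have -> : hk 0 = 0 by apply/rowP => j; rewrite !mxE.
    by rewrite add0r subrr normr0 mul0r.
  rewrite -(subrKA ((f - L) (hk k + x))) (le_trans (ler_normD _ _)) //.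
  rewrite -natr1 mulrDl mul1r addrC lerD ?IH // ?(ltnW kn) //.
  exact: (step (Ordinal kn)).
have hn : hk n = h by apply/rowP => j; rewrite mxE ltn_ord.
have := tele n (leqnn n); rewrite hn => /le_trans; apply.
rewrite mulrA ler_wpM2r // mulrCA ler_piMr // ?(ltW e0) //.
by rewrite ler_pdivrMr // mul1r ler_nat.
Unshelve. all: by end_near. Qed.

(** * Symmetry of mixed second derivatives *)

Section SecondDerivatives.
Context {R : realType} {V : normedModType R}.
Implicit Types (f : V -> R) (x v w : V).

Lemma littleo_diff (W : normedModType R) (g : V -> W) x : differentiable g x ->
  forall e : R, 0 < e ->
  \forall h \near 0, `|g (h + x) - g x - 'D_h g x| <= e * `|h|.
Proof.
move=> dg e e0; have /eqaddoP/(_ e e0) := diff_locally dg.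
apply: filterS => h /=.
by rewrite -!fctE /= !fctE /= deriveE // opprD addrA.
Qed.

(** The mean value theorem along v, applied to y |-> f (s w + y) - f y, turns the second difference
    into s times an increment of D_v f, which is then expanded to first order at x. *)
Lemma second_difference f x v w :
  (\forall y \near x, derivable f y v) -> differentiable ('D_v f) x ->
  forall e : R, 0 < e -> \forall s \near (0 : R),
   `|f (s *: v + (s *: w + x)) - f (s *: w + x) - (f (s *: v + x) - f x)
      - s ^+ 2 * 'D_w ('D_v f) x| <= e * s ^+ 2.
Proof.
move=> fv dfv e e0.
(* D_v f is expanded at two displacements, each of norm at most |s| (|v| + |w| + 1): hence the 2.
   The 1 covers v = w = 0. *)
have N0 : 0 < 2 * (`|v| + `|w| + 1) by rewrite mulr_gt0 // ltr_wpDl // addr_ge0.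
have e'0 : 0 < e / (2 * (`|v| + `|w| + 1)) by rewrite divr_gt0.
have := littleo_diff dfv e'0.
move=> /nbhs_ballP[d1 /= d10 d1P].
move: fv => /nbhs_ballP[d2 /= d20 d2P].
have dN : 0 < Num.min d1 d2 / (`|v| + `|w| + 1).
  by rewrite divr_gt0 ?lt_min ?d10 ?d20 // ltr_wpDl // addr_ge0.
near=> s.
have sd : `|s| * (`|v| + `|w| + 1) < Num.min d1 d2.
  rewrite -ltr_pdivlMr ?ltr_wpDl // ?addr_ge0 //.
have bnd (r q : R) : `|r| <= `|s| -> `|q| <= `|s| ->
    `|r *: v + q *: w| <= `|s| * (`|v| + `|w| + 1).
  move=> rs qs; rewrite (le_trans (ler_normD _ _)) // !normrZ.
  rewrite 2!mulrDr mulr1 ler_wpDr // lerD // ler_wpM2r //.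
have small (r q : R) : `|r| <= `|s| -> `|q| <= `|s| ->
    `|r *: v + q *: w| < Num.min d1 d2.
  by move=> rs qs; exact: le_lt_trans (bnd _ _ rs qs) sd.
pose g y := f (s *: w + y) - f y.
have shiftE (r : R) y : s *: w + (r *: v + y) = r *: v + (s *: w + y).
  by rewrite addrCA.
have gd (r : R) : `|r| <= `|s| -> is_derive (r *: v + x) v g
    ('D_v f (r *: v + (s *: w + x)) - 'D_v f (r *: v + x)).
  move=> rs.
  have d0 (q : R) : `|q| <= `|s| -> derivable f (r *: v + (q *: w + x)) v.
    move=> qs; apply: d2P; rewrite -ball_normE /= addrA opprD addrCA subrr addr0.
    by rewrite normrN; have := small _ _ rs qs; rewrite lt_min => /andP[].
  have D1 := derivableP (d0 _ (lexx _)).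
  have D0 : is_derive (r *: v + x) v f ('D_v f (r *: v + x)).
    by apply: derivableP; have := d0 0; rewrite normr0 scale0r add0r; apply.
  apply: is_deriveB; last exact: D0.
  split.
    have := @ex_derive _ _ _ _ _ _ _ D1.
    rewrite /derivable; set g1 := (X in cvg (X @ _) -> _).
    set g2 := (X in _ -> cvg (X @ _)).
    suff -> : g1 = g2 by []; apply/funext => h; rewrite /g1 /g2 /=.
    by rewrite /shift /= shiftE [s *: w + (_ + _)]addrCA shiftE.
  rewrite /derive; set g1 := (X in lim (X @ _) = _).
  set g2 := (X in _ = lim (X @ _)).
  suff -> : g1 = g2 by []; apply/funext => h; rewrite /g1 /g2 /=.
  by rewrite /shift /= shiftE [s *: w + (_ + _)]addrCA shiftE.
have [r rs E] := MVT_dir (f := g) (a := x) (v := v) (t := s)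
  (fun r rs => @ex_derive _ _ _ _ _ _ _ (gd r rs)).
have Dr := gd r rs; move: E; rewrite derive_val /g.
rewrite [s *: w + (s *: v + x)]shiftE => E.
have -> : f (s *: v + (s *: w + x)) - f (s *: w + x) - (f (s *: v + x) - f x) =
   f (s *: v + (s *: w + x)) - f (s *: v + x) - (f (s *: w + x) - f x) by ring.
rewrite E.
have in1 (q : R) : `|q| <= `|s| -> ball 0 d1 (r *: v + q *: w).
  move=> qs; rewrite -ball_normE /= sub0r normrN.
  by have := small _ _ rs qs; rewrite lt_min => /andP[].
have := d1P _ (in1 s (lexx _)).
have := d1P _ (in1 0 _); rewrite normr0 scale0r addr0 => /(_ (normr_ge0 _)).
rewrite deriveDdir // !deriveZdir // -[r *: v + s *: w + x]addrA.
set a := 'D_v f _; set b := 'D_v f _; set c := 'D_v f _.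
set p := r *: _; set q := s *: _ => H1 H2.
have -> : s * (c - a) - s ^+ 2 * 'D_w ('D_v f) x =
    s * ((c - b - (p + q)) - (a - b - p)).
  have ringE (s' a' b' c' p' D : R) : s' * (c' - a') - s' ^+ 2 * D =
    s' * ((c' - b' - (p' + s' * D)) - (a' - b' - p')) by ring.
  exact: ringE.
rewrite normrM -(real_normK (num_real s)) expr2 mulrCA ler_wpM2l //.
rewrite (le_trans (ler_normB _ _)) // (le_trans (lerD H2 H1)) //.
rewrite -mulrDr -mulrA ler_pM2l //.
have K := bnd r s rs (lexx _); have K' := bnd r 0 rs _.
move: K'; rewrite normr0 scale0r addr0 => /(_ (normr_ge0 _)) K'.
rewrite ler_pdivrMl // (le_trans (lerD K K')) //.
by rewrite le_eqVlt; apply/orP; left; apply/eqP; ring.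
Unshelve. all: by end_near. Qed.

(** The second difference is symmetric in v and w, and both mixed derivatives times s^2 approximate
    it up to e s^2 / 2. A single small s suffices for each e. *)
Lemma derive_symmetric f x v w :
  (\forall y \near x, derivable f y v) -> differentiable ('D_v f) x ->
  (\forall y \near x, derivable f y w) -> differentiable ('D_w f) x ->
  'D_w ('D_v f) x = 'D_v ('D_w f) x.
Proof.
move=> fv dv fw dw.
apply/eqP; rewrite -subr_eq0 -normr_le0; apply/ler_addgt0Pl => e e0.
rewrite addr0.
have e20 : 0 < e / 2 by rewrite divr_gt0.
have H1 := second_difference w fv dv e20.
have H2 := second_difference v fw dw e20.
have [d /= d0 dP] := (nbhs_ballP _ _).1 (filterI H1 H2).
pose s : R := d / 2.
have [K1 K2] : `|f (s *: v + (s *: w + x)) - f (s *: w + x) - (f (s *: v + x) - f x)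
      - s ^+ 2 * 'D_w ('D_v f) x| <= e / 2 * s ^+ 2 /\
    `|f (s *: w + (s *: v + x)) - f (s *: v + x) - (f (s *: w + x) - f x)
      - s ^+ 2 * 'D_v ('D_w f) x| <= e / 2 * s ^+ 2.
  apply: dP; rewrite -ball_normE /= sub0r normrN gtr0_norm ?divr_gt0 //.
  by rewrite ltr_pdivrMr // ltr_pMr // ltr1n.
have s0 : 0 < s ^+ 2 by rewrite exprn_gt0 // divr_gt0.
rewrite -(ler_pM2r s0). rewrite -[X in `|_| * X]gtr0_norm // -normrM.
move: K2; rewrite [s *: w + (s *: v + x)]addrCA => K2.
have := le_trans (ler_normB _ _) (lerD K2 K1).
rewrite -mulrDl -splitr; apply: le_trans.
have normE (a b c d' t P Q : R) : `|(P - Q) * t| =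
    `|(a - b - (c - d') - t * Q) - (a - c - (b - d') - t * P)|.
  by congr (`|_|); ring.
by rewrite -normE.
Qed.

End SecondDerivatives.

Section Products.
Context {R : realType} {V : normedModType R}.
Implicit Types x v : V.

Lemma derive_bigsum (W : normedModType R) (I : Type) (r : seq I)
    (F : I -> V -> W) x v : (forall i, differentiable (F i) x) ->
  'D_v (fun y => \sum_(i <- r) F i y) x = \sum_(i <- r) 'D_v (F i) x.
Proof.
move=> dF; elim: r => [|i r IH].
  rewrite big_nil (_ : (fun _ => _) = cst 0) ?derive_cst //.
  by apply/funext => y; rewrite big_nil.
rewrite big_cons -IH (_ : (fun _ => _) = F i + (fun y => \sum_(j <- r) F j y)).
  by rewrite deriveD //; apply: diff_derivable => //; exact: differentiable_bigsum.
by apply/funext => y; rewrite big_cons.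
Qed.

Lemma differentiable_mulmx p q s (A : V -> 'M[R]_(p, q)) (B : V -> 'M[R]_(q, s)) x :
  differentiable A x -> differentiable B x ->
  differentiable (fun y => A y *m B y) x.
Proof.
move=> dA dB; apply/differentiable_mxP => i j.
rewrite (_ : (fun _ => _) = fun y => \sum_k A y i k * B y k j); last first.
  by apply/funext => y; rewrite mxE.
apply: (@differentiable_bigsum _ _ R) => k.
exact: (differentiableM (differentiable_entry i k dA) (differentiable_entry k j dB)).
Qed.

Lemma derive_mulmx p q s (A : V -> 'M[R]_(p, q)) (B : V -> 'M[R]_(q, s)) x v :
  differentiable A x -> differentiable B x ->
  'D_v (fun y => A y *m B y) x = 'D_v A x *m B x + A x *m 'D_v B x.
Proof.
move=> dA dB; apply/matrixP => i j.
rewrite derive_entry; last exact/diff_derivable/differentiable_mulmx.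
rewrite (_ : (fun _ => _) = fun y => \sum_k A y i k * B y k j); last first.
  by apply/funext => y; rewrite mxE.
have dAk k := differentiable_entry i k dA.
have dBk k := differentiable_entry k j dB.
rewrite (@derive_bigsum R) => [|k]; last exact: (differentiableM (dAk k) (dBk k)).
rewrite !mxE -big_split /=; apply: eq_bigr => k _.
rewrite (deriveM (diff_derivable (dAk k)) (diff_derivable (dBk k))).
rewrite (derive_entry i k (diff_derivable dA)) (derive_entry k j (diff_derivable dB)).
by rewrite [LHS]addrC; congr (_ + _); exact: mulrC.
Qed.

Lemma differentiable_scale p q (k : V -> R) (B : V -> 'M[R]_(p, q)) x :
  differentiable k x -> differentiable B x ->
  differentiable (fun y => k y *: B y) x.
Proof.
move=> dk dB; apply/differentiable_mxP => i j.
rewrite (_ : (fun _ => _) = fun y => k y * B y i j); last first.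
  by apply/funext => y; rewrite mxE.
exact: (differentiableM dk (differentiable_entry i j dB)).
Qed.

Lemma derive_scale p q (k : V -> R) (B : V -> 'M[R]_(p, q)) x v :
  differentiable k x -> differentiable B x ->
  'D_v (fun y => k y *: B y) x = 'D_v k x *: B x + k x *: 'D_v B x.
Proof.
move=> dk dB; apply/matrixP => i j.
rewrite derive_entry; last exact/diff_derivable/differentiable_scale.
rewrite (_ : (fun _ => _) = fun y => k y * B y i j); last first.
  by apply/funext => y; rewrite mxE.
have dBij := differentiable_entry i j dB.
rewrite (deriveM (diff_derivable dk) (diff_derivable dBij)).
rewrite !mxE (derive_entry i j (diff_derivable dB)).
by rewrite [LHS]addrC; congr (_ + _); exact: mulrC.
Qed.

Lemma differentiable_trmx p q (A : V -> 'M[R]_(p, q)) x :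
  differentiable A x -> differentiable (fun y => (A y)^T) x.
Proof.
move=> dA; apply/differentiable_mxP => i j.
rewrite (_ : (fun _ => _) = fun y => A y j i); first exact: differentiable_entry.
by apply/funext => y; rewrite mxE.
Qed.

Lemma derive_trmx p q (A : V -> 'M[R]_(p, q)) x v :
  differentiable A x -> 'D_v (fun y => (A y)^T) x = ('D_v A x)^T.
Proof.
move=> dA; apply/matrixP => i j.
rewrite derive_entry; last exact/diff_derivable/differentiable_trmx.
rewrite mxE derive_entry; last exact: diff_derivable.
by congr ('D_v _ x); apply/funext => y; rewrite mxE.
Qed.

Lemma differentiable_ip m (g : V -> 'M[R]_m) (a b : V -> 'rV[R]_m) x :
  differentiable g x -> differentiable a x -> differentiable b x ->
  differentiable (fun y => ip (g y) (a y) (b y)) x.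
Proof.
move=> dg da db; apply: differentiable_entry.
exact: differentiable_mulmx (differentiable_mulmx da dg) (differentiable_trmx db).
Qed.

Lemma derive_ip m (g : V -> 'M[R]_m) (a b : V -> 'rV[R]_m) x v :
  differentiable g x -> differentiable a x -> differentiable b x ->
  'D_v (fun y => ip (g y) (a y) (b y)) x =
  ip ('D_v g x) (a x) (b x) + ip (g x) ('D_v a x) (b x)
  + ip (g x) (a x) ('D_v b x).
Proof.
move=> dg da db; have dag := differentiable_mulmx da dg.
have dbT := differentiable_trmx db.
rewrite /ip -derive_entry; last exact/diff_derivable/differentiable_mulmx.
rewrite derive_mulmx // derive_mulmx // derive_trmx // mulmxDl !mxE.
by congr (_ + _); exact: addrC.
Qed.

(** The Leibniz rule with values and derivatives as parameters, so that they can be computed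
    separately and supplied as equations. *)
Lemma derive_ip_eq m (g : V -> 'M[R]_m) (a b : V -> 'rV[R]_m) x v
    (G G' : 'M[R]_m) (A A' B B' : 'rV[R]_m) :
  differentiable g x -> differentiable a x -> differentiable b x ->
  g x = G -> a x = A -> b x = B ->
  'D_v g x = G' -> 'D_v a x = A' -> 'D_v b x = B' ->
  'D_v (fun y => ip (g y) (a y) (b y)) x = ip G' A B + ip G A' B + ip G A B'.
Proof. by move=> dg da db <- <- <- <- <- <-; exact: derive_ip. Qed.

End Products.

(** * Smooth functions on open sets *)

Section CrOn.
Context {R : realType} {n : nat}.
Implicit Types (U : set 'rV[R]_n) (f g : 'rV[R]_n -> R).

Lemma open_near U x : open U -> U x -> \forall y \near x, U y.
Proof. by move=> Uo Ux; exact: open_nbhs_nbhs. Qed.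

Lemma near_eq_continuous (T : topologicalType) (f g : T -> R) x :
  (\forall y \near x, f y = g y) -> {for x, continuous f} -> {for x, continuous g}.
Proof.
move=> fg fc; rewrite /prop_for /continuous_at -(nbhs_singleton fg).
exact: cvg_trans (near_eq_cvg fg) fc.
Qed.

Lemma Cr_on_eq U r f g : open U -> (forall x, U x -> f x = g x) ->
  Cr_on r U f -> Cr_on r U g.
Proof.
move=> Uo; elim: r f g => [|r IH] f g fg [fc fr]; (split=> [x Ux|]; first by
    apply: near_eq_continuous (fc x Ux); apply: filterS (open_near Uo Ux)) => //.
move=> i.
have near_fg x : U x -> \forall y \near x, f y = g y.
  by move=> Ux; apply: filterS (open_near Uo Ux); exact: fg.
have [fd fC] := fr i; split=> [x Ux|].
  by apply: near_eq_derivable (fd x Ux); exact: near_fg.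
apply: IH fC => x Ux; exact/near_eq_derive/near_fg.
Qed.

Lemma Cr_onD U r f g : open U ->
  Cr_on r U f -> Cr_on r U g -> Cr_on r U (fun x => f x + g x).
Proof.
move=> Uo; elim: r f g => [|r IH] f g [fc fr] [gc gr].
  by split=> // x Ux; apply: continuousD; [exact: fc|exact: gc].
split=> [x Ux|i]; first by apply: continuousD; [exact: fc|exact: gc].
have [fd fC] := fr i; have [gd gC] := gr i; split=> [x Ux|].
  by apply: derivableD; [exact: fd|exact: gd].
apply: Cr_on_eq (IH _ _ fC gC) => // x Ux.
by rewrite /pderiv -(deriveD (fd x Ux) (gd x Ux)).
Qed.

Lemma Cr_onZ U r (k : R) f : open U -> Cr_on r U f ->
  Cr_on r U (fun x => k * f x).
Proof.
move=> Uo; elim: r f => [|r IH] f [fc fr].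
  by split=> // x Ux; apply: continuousM; [exact: cst_continuous|exact: fc].
split=> [x Ux|i]; first by apply: continuousM; [exact: cst_continuous|exact: fc].
have [fd fC] := fr i; split=> [x Ux|].
  exact: (derivableM (derivable_cst k _ _) (fd x Ux)).
apply: Cr_on_eq (IH _ fC) => // x Ux.
by rewrite /pderiv (deriveMl _ (fd x Ux)).
Qed.

Lemma Cr_on0 U r : Cr_on r U (fun=> 0).
Proof.
suff H c : Cr_on r U (fun=> c) by [].
elim: r c => [|r IH] c; first by split=> // x _; exact: cst_continuous.
split=> [x _|i]; first exact: cst_continuous.
split=> [x _|]; first exact: derivable_cst.
rewrite (_ : pderiv i _ = fun=> 0) //; apply/funext => x.
exact: derive_cst.
Qed.

Lemma Cr_on_sum U r (I : Type) (s : seq I) (F : I -> 'rV[R]_n -> R) : open U ->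
  (forall i, Cr_on r U (F i)) -> Cr_on r U (fun x => \sum_(i <- s) F i x).
Proof.
move=> Uo CF; elim: s => [|i s IH].
  apply: Cr_on_eq (Cr_on0 U r) => // x _; by rewrite big_nil.
apply: Cr_on_eq (Cr_onD Uo (CF i) IH) => // x _; by rewrite big_cons.
Qed.

Lemma C1_on_differentiable U f x : open U -> U x -> Cr_on 1 U f ->
  differentiable f x.
Proof.
move=> Uo Ux [_ fd]; apply: C1_differentiable => [|i].
  by apply: filterS (open_near Uo Ux) => y Uy i; exact: (fd i).1.
exact: ((fd i).2.1 x Ux).
Qed.

End CrOn.

Section SmoothOn.
Context {R : realType} {n p q : nat}.
Variables (U : set 'rV[R]_n) (F : 'rV[R]_n -> 'M[R]_(p, q)).
Hypotheses (Uo : open U) (Fs : smooth_on U F).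

Lemma smooth_differentiable x : U x -> differentiable F x.
Proof.
move=> Ux; apply/differentiable_mxP => a b.
exact: C1_on_differentiable Uo Ux (Fs a b 1).
Qed.

(** On U, D_v F is a combination of partial derivatives with constant coefficients; order r of the
    result uses order r + 1 of F. *)
Lemma smooth_derive v : smooth_on U ('D_v F).
Proof.
move=> a b r.
have H := Cr_on_sum (index_enum 'I_n) Uo
  (fun i => Cr_onZ (v 0 i) Uo ((Fs a b r.+1).2 i).2).
apply: Cr_on_eq H => // x Ux; have dF := smooth_differentiable Ux.
rewrite derive_entry; last exact: diff_derivable.
rewrite [in RHS](row_sum_delta v) derive_sumdir; last exact: differentiable_entry.
apply: eq_bigr => i _.
by rewrite deriveZdir; [|exact: differentiable_entry].
Qed.

End SmoothOn.

Section SmoothOn2.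
Context {R : realType} {n p q : nat}.
Variables (U : set 'rV[R]_n) (F : 'rV[R]_n -> 'M[R]_(p, q)).
Hypotheses (Uo : open U) (Fs : smooth_on U F).

Lemma smooth_derive_sym v w x : U x -> 'D_w ('D_v F) x = 'D_v ('D_w F) x.
Proof.
move=> Ux; apply/matrixP => a b.
have dD u : differentiable ('D_u F) x := smooth_differentiable Uo (smooth_derive Uo Fs u) Ux.
have E u u' : ('D_u' ('D_u F) x) a b = 'D_u' (fun y => 'D_u F y a b) x.
  exact: (derive_entry a b (diff_derivable (v := u') (dD u))).
apply: etrans (E v w) _; apply: etrans _ (esym (E w v)).
have nE u : \forall y \near x, ('D_u F y) a b = 'D_u (fun z => F z a b) y.
  apply: filterS (open_near Uo Ux) => y Uy.
  by rewrite derive_entry //; exact/diff_derivable/(smooth_differentiable Uo Fs).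
rewrite (near_eq_derive _ (nE v)) (near_eq_derive _ (nE w)).
have dn u : \forall y \near x, derivable (fun z => F z a b) y u.
  apply: filterS (open_near Uo Ux) => y Uy.
  exact/diff_derivable/differentiable_entry/(smooth_differentiable Uo Fs).
have dd u : differentiable ('D_u (fun z => F z a b)) x.
  exact: near_eq_differentiable (nE u) (differentiable_entry a b (dD u)).
exact: derive_symmetric.
Qed.

Section Along.
Context {V : normedModType R}.
Variables (g w : V -> 'rV[R]_n) (x : V).
Hypotheses (Ugx : U (g x)) (dg : differentiable g x) (dw : differentiable w x).

(** Expanding the moving direction in the basis leaves scalar coefficients times derivatives along
    fixed directions, to which product and chain rules apply. *)
Let near_along : \forall y \near x,
  \sum_i w y 0 i *: 'D_(delta_mx 0 i) F (g y) = 'D_(w y) F (g y).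
Proof.
have gc := differentiable_continuous dg.
have : \forall y \near x, U (g y) by apply: gc; exact: open_near.
apply: filterS => y Ugy; have dF := smooth_differentiable Uo Fs Ugy.
rewrite [in RHS](row_sum_delta (w y)) derive_sumdir //.
by apply: eq_bigr => i _; rewrite deriveZdir.
Qed.

Let dterm i : differentiable (fun y => 'D_(delta_mx 0 i) F (g y)) x.
Proof.
apply: (differentiable_comp (g := 'D_(delta_mx 0 i) F) dg).
exact: (smooth_differentiable Uo (smooth_derive Uo Fs (delta_mx 0 i)) Ugx).
Qed.

Lemma differentiable_along : differentiable (fun y => 'D_(w y) F (g y)) x.
Proof.
apply: near_eq_differentiable near_along _.
apply: differentiable_bigsum => i; apply: differentiable_scale => //.
exact: differentiable_entry.
Qed.

(** The first term comes from the motion of the direction, the second from the motion of the base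
    point with the direction frozen. All second derivatives of actions and products below are
    instances. *)
Lemma derive_along c : 'D_c (fun y => 'D_(w y) F (g y)) x =
  'D_('D_c w x) F (g x) + 'D_('D_c g x) ('D_(w x) F) (g x).
Proof.
have dF := smooth_differentiable Uo Fs Ugx.
have dDF i := smooth_differentiable Uo (smooth_derive Uo Fs (delta_mx 0 i)) Ugx.
have E2 : 'D_('D_c g x) ('D_(w x) F) (g x) =
    \sum_i w x 0 i *: 'D_('D_c g x) ('D_(delta_mx 0 i) F) (g x).
  have nE : \forall y \near g x, \sum_i w x 0 i *: 'D_(delta_mx 0 i) F y = 'D_(w x) F y.
    apply: filterS (open_near Uo Ugx) => y Uy.
    have dFy := smooth_differentiable Uo Fs Uy.
    rewrite [in RHS](row_sum_delta (w x)) derive_sumdir //.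
    by apply: eq_bigr => i _; rewrite deriveZdir.
  apply: etrans (esym (near_eq_derive _ nE)) _.
  rewrite derive_bigsum => [|i]; last exact: differentiableZ.
  apply: eq_bigr => i _; exact: (deriveZ _ (diff_derivable (dDF i))).
have E1 : 'D_('D_c w x) F (g x) =
    \sum_i ('D_c w x) 0 i *: 'D_(delta_mx 0 i) F (g x).
  rewrite [in LHS](row_sum_delta ('D_c w x)) derive_sumdir //.
  by apply: eq_bigr => i _; rewrite deriveZdir.
rewrite E1 E2 -big_split /=.
apply: etrans (esym (near_eq_derive c near_along)) _.
rewrite derive_bigsum => [|i]; last first.
  by apply: differentiable_scale => //; exact: differentiable_entry.
apply: eq_bigr => i _.
apply: etrans (derive_scale c (differentiable_entry 0 i dw) (dterm i)) _.
have C : 'D_c (fun y => 'D_(delta_mx 0 i) F (g y)) x =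
    'D_('D_c g x) ('D_(delta_mx 0 i) F) (g x).
  exact: (derive_chain (f := 'D_(delta_mx 0 i) F) c dg (dDF i)).
rewrite -(derive_entry 0 i (diff_derivable (v := c) dw)).
by rewrite [X in _ + _ *: X = _]C.
Qed.

End Along.
End SmoothOn2.

(** * Inner products *)

Section InnerProduct.
Context {R : realType} {m : nat}.
Implicit Types (g : 'M[R]_m) (u v w : 'rV[R]_m).

Lemma ipDl g u v w : ip g (u + v) w = ip g u w + ip g v w.
Proof. by rewrite /ip !mulmxDl !mxE. Qed.

Lemma ipDr g u v w : ip g w (u + v) = ip g w u + ip g w v.
Proof. by rewrite /ip [(u + v)^T]linearD /= mulmxDr !mxE. Qed.

Lemma ipZl g k v w : ip g (k *: v) w = k * ip g v w.
Proof. by rewrite /ip -!scalemxAl !mxE. Qed.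

Lemma ipZr g k v w : ip g w (k *: v) = k * ip g w v.
Proof. by rewrite /ip [(k *: v)^T]linearZ /= -scalemxAr !mxE. Qed.

Lemma ip0l g w : ip g 0 w = 0. Proof. by rewrite /ip !mul0mx mxE. Qed.

Lemma ip0r g w : ip g w 0 = 0. Proof. by rewrite /ip trmx0 mulmx0 mxE. Qed.

Lemma ipNl g v w : ip g (- v) w = - ip g v w.
Proof. by rewrite -scaleN1r ipZl mulN1r. Qed.

Lemma ipNr g v w : ip g w (- v) = - ip g w v.
Proof. by rewrite -scaleN1r ipZr mulN1r. Qed.

Lemma ipBl g u v w : ip g (u - v) w = ip g u w - ip g v w.
Proof. by rewrite ipDl ipNl. Qed.

Lemma ipBr g u v w : ip g w (u - v) = ip g w u - ip g w v.
Proof. by rewrite ipDr ipNr. Qed.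

Lemma ip_suml g (I : Type) (r : seq I) (P : pred I) (F : I -> 'rV[R]_m) w :
  ip g (\sum_(i <- r | P i) F i) w = \sum_(i <- r | P i) ip g (F i) w.
Proof.
by apply: (big_morph (fun v => ip g v w)) => [u v|]; [exact: ipDl|exact: ip0l].
Qed.

Lemma ip_sumr g (I : Type) (r : seq I) (P : pred I) (F : I -> 'rV[R]_m) w :
  ip g w (\sum_(i <- r | P i) F i) = \sum_(i <- r | P i) ip g w (F i).
Proof.
by apply: (big_morph (fun v => ip g w v)) => [u v|]; [exact: ipDr|exact: ip0r].
Qed.

Lemma ip_coordE g v w : ip g v w = \sum_i \sum_j (v 0 i * w 0 j) * g i j.
Proof.
rewrite /ip mxE exchange_big /=; apply: eq_bigr => j _; rewrite !mxE mulr_suml.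
by apply: eq_bigr => i _; rewrite mulrAC.
Qed.

Lemma ip_tr g v w : ip g v w = ip g^T w v.
Proof.
have -> : ip g v w = ((v *m g *m w^T)^T) 0 0 by rewrite mxE.
by rewrite !trmx_mul trmxK mulmxA.
Qed.

Lemma ipC g v w : posdef g -> ip g v w = ip g w v.
Proof. by move=> [gT _]; rewrite ip_tr gT. Qed.

Lemma ip_ge0 g v : posdef g -> 0 <= ip g v v.
Proof.
move=> [_ g0]; have [->|v0] := eqVneq v 0; first by rewrite ip0l.
exact/ltW/g0.
Qed.

Lemma ipDg g g' v w : ip (g + g') v w = ip g v w + ip g' v w.
Proof. by rewrite /ip mulmxDr mulmxDl mxE. Qed.

Lemma ipZg k g v w : ip (k *: g) v w = k * ip g v w.
Proof. by rewrite /ip -scalemxAr -scalemxAl mxE. Qed.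

(** A form of [riesz_spec] for functionals whose linearity is proved by hand, such as the Koszul
    expression. *)
Lemma riesz_linear g (l : 'rV[R]_m -> R) w : posdef g ->
  (forall k u v, l (k *: u + v) = k * l u + l v) -> ip g (riesz g l) w = l w.
Proof.
move=> gp lin.
pose lM := GRing.isLinear.Build _ _ _ _ l lin.
pose L : {scalar 'rV[R]_m} := HB.pack l lM.
exact: (riesz_spec L w gp).
Qed.

Lemma rieszD g (l l' : 'rV[R]_m -> R) :
  riesz g (fun z => l z + l' z) = riesz g l + riesz g l'.
Proof.
rewrite /riesz -mulmxDl; congr (_ *m _).
by apply/rowP => k; rewrite !mxE.
Qed.

Lemma ip_linr g w k u v : ip g w (k *: u + v) = k * ip g w u + ip g w v.
Proof. by rewrite ipDr ipZr. Qed.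

Lemma ip_linm k g g' v w : ip (k *: g + g') v w = k * ip g v w + ip g' v w.
Proof. by rewrite ipDg ipZg. Qed.

End InnerProduct.

(** * Manifolds and Lie groups *)

#[local] Opaque derive.

Section RowMx.
Context {R : realType} {V : normedModType R} {m n : nat}.
Variables (f : V -> 'rV[R]_m) (g : V -> 'rV[R]_n) (x : V).
Hypotheses (df : differentiable f x) (dg : differentiable g x).

Lemma differentiable_row_mx : differentiable (fun y => row_mx (f y) (g y)) x.
Proof.
apply/differentiable_mxP => i j.
case: (split_ordP j) => k ->.
  rewrite (_ : (fun _ => _) = fun y => f y i k); first exact: differentiable_entry.
  by apply/funext => y; rewrite row_mxEl.
rewrite (_ : (fun _ => _) = fun y => g y i k); first exact: differentiable_entry.
by apply/funext => y; rewrite row_mxEr.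
Qed.

Lemma derive_row_mx v :
  'D_v (fun y => row_mx (f y) (g y)) x = row_mx ('D_v f x) ('D_v g x).
Proof.
apply/matrixP => i j.
rewrite derive_entry; last exact/diff_derivable/differentiable_row_mx.
case: (split_ordP j) => k ->.
  rewrite row_mxEl derive_entry; last exact: diff_derivable.
  by congr ('D_v _ x); apply/funext => y; rewrite row_mxEl.
rewrite row_mxEr derive_entry; last exact: diff_derivable.
by congr ('D_v _ x); apply/funext => y; rewrite row_mxEr.
Qed.

End RowMx.

Section Partial.
Context {R : realType} {m n p q : nat}.
Variables (F : 'rV[R]_(m + n) -> 'M[R]_(p, q)) (x : 'rV[R]_m) (y : 'rV[R]_n).
Hypothesis dF : differentiable F (row_mx x y).

Let dl : differentiable (fun x' => row_mx x' y) x.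
Proof. by apply: differentiable_row_mx => //; exact: differentiable_cst. Qed.

Let dr : differentiable (fun y' => row_mx x y') y.
Proof. by apply: differentiable_row_mx => //; exact: differentiable_cst. Qed.

Lemma differentiable_partial_l : differentiable (fun x' => F (row_mx x' y)) x.
Proof. exact: (differentiable_comp dl dF). Qed.

Lemma differentiable_partial_r : differentiable (fun y' => F (row_mx x y')) y.
Proof. exact: (differentiable_comp dr dF). Qed.

Lemma derive_partial_l v :
  'D_v (fun x' => F (row_mx x' y)) x = 'D_(row_mx v 0) F (row_mx x y).
Proof.
have -> : row_mx v 0 = 'D_v (fun x' => row_mx x' y) x.
  by rewrite derive_row_mx // ?derive_id ?derive_cst //; exact: differentiable_cst.
exact: (derive_chain v dl dF).
Qed.

Lemma derive_partial_r v :
  'D_v (fun y' => F (row_mx x y')) y = 'D_(row_mx 0 v) F (row_mx x y).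
Proof.
have -> : row_mx 0 v = 'D_v (fun y' => row_mx x y') y.
  by rewrite derive_row_mx // ?derive_id ?derive_cst //; exact: differentiable_cst.
exact: (derive_chain v dr dF).
Qed.

End Partial.

Section Charts.
Context {R : realType} {m : nat} {M : manifold R m}.
Implicit Types (i j : ch_idx M) (y : M) (x : 'rV[R]_m).

Lemma ch_img_map i y : ch_dom i y -> ch_img i (ch_map i y).
Proof. by move=> iy; exists y. Qed.

Lemma ch_dom_inv i x : ch_img i x -> ch_dom i (ch_inv i x).
Proof. by move=> [y iy <-]; rewrite ch_mapK. Qed.

Lemma ch_invK i x : ch_img i x -> ch_map i (ch_inv i x) = x.
Proof. by move=> [y iy <-]; rewrite ch_mapK. Qed.

Lemma open_ch_img i : open (@ch_img R m M i).
Proof. exact: ch_img_open. Qed.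

Arguments open_ch_img : clear implicits.

Lemma open_ch_map i (W : set M) : open W -> open (ch_map i @` (ch_dom i `&` W)).
Proof.
move=> Wo; rewrite openE => _ [y [iy Wy] <-].
have ix := ch_img_map iy.
have H1 := open_near (open_ch_img _) ix.
have H2 : \forall x \near ch_map i y, W (ch_inv i x).
  by apply: (ch_inv_cont ix); rewrite ch_mapK //; exact: open_nbhs_nbhs.
apply: filterS2 H1 H2 => x xi Wx; exists (ch_inv i x); last exact: ch_invK.
by split=> //; exact: ch_dom_inv.
Qed.

Lemma near_ch_dom i (T : topologicalType) (f : T -> M) t :
  {for t, continuous f} -> ch_dom i (f t) -> \forall s \near t, ch_dom i (f s).
Proof. by move=> fc it; apply: fc; apply: open_nbhs_nbhs; split=> //; exact: ch_dom_open. Qed.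

End Charts.
Arguments open_ch_img {R m M} i.

Section SmoothMap2.
Context {R : realType} {m1 m2 m3 : nat}.
Context {M1 : manifold R m1} {M2 : manifold R m2} {M3 : manifold R m3}.
Variables (f : M1 -> M2 -> M3) (i : ch_idx M1) (j : ch_idx M2) (k : ch_idx M3).

(** Both arguments are packed into one row vector: partial derivatives become derivatives along
    [row_mx v 0] and [row_mx 0 w], and their commutation is ordinary symmetry of second
    derivatives. *)
Definition chart2 (z : 'rV[R]_(m1 + m2)) : 'rV[R]_m3 :=
  ch_map k (f (ch_inv i (lsubmx z)) (ch_inv j (rsubmx z))).

Definition chart2_dom : set 'rV[R]_(m1 + m2) :=
  [set z | ch_img i (lsubmx z) /\ ch_img j (rsubmx z) /\
           ch_dom k (f (ch_inv i (lsubmx z)) (ch_inv j (rsubmx z)))].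

Hypothesis fs : smooth_map2 f.

Lemma open_chart2_dom : open chart2_dom.
Proof.
rewrite openE => z [iz [jz kz]].
have H1 : \forall t \near z, ch_img i (lsubmx t).
  exact: (continuous_lsubmx (open_near (open_ch_img i) iz)).
have H2 : \forall t \near z, ch_img j (rsubmx t).
  exact: (continuous_rsubmx (open_near (open_ch_img j) jz)).
have H3 : \forall t \near z, ch_dom k (f (ch_inv i (lsubmx t)) (ch_inv j (rsubmx t))).
  apply: (@near_ch_dom _ _ M3 k _ (fun t => f (ch_inv i (lsubmx t)) (ch_inv j (rsubmx t)))) => //.
  pose h t := (ch_inv i (lsubmx t), ch_inv j (rsubmx t)).
  apply: (@continuous_comp _ _ _ h (fun q => f q.1 q.2)); last exact: fs.1.
  have C1 : ch_inv i (lsubmx t) @[t --> z] --> ch_inv i (lsubmx z).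
    exact: (cvg_comp _ _ (@continuous_lsubmx R 1 m1 m2 z) (@ch_inv_cont _ _ _ _ _ iz)).
  have C2 : ch_inv j (rsubmx t) @[t --> z] --> ch_inv j (rsubmx z).
    exact: (cvg_comp _ _ (@continuous_rsubmx R 1 m1 m2 z) (@ch_inv_cont _ _ _ _ _ jz)).
  exact: (cvg_pair C1 C2).
by near=> t; split; [|split]; near: t.
Unshelve. all: by end_near. Qed.

Lemma smooth_chart2 : smooth_on chart2_dom chart2.
Proof. exact: fs.2. Qed.

Lemma chart2_domP x y : ch_img i x -> ch_img j y ->
  ch_dom k (f (ch_inv i x) (ch_inv j y)) -> chart2_dom (row_mx x y).
Proof. by move=> ix jy kxy; rewrite /chart2_dom /= row_mxKl row_mxKr. Qed.

Lemma chart2E x y :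
  chart2 (row_mx x y) = ch_map k (f (ch_inv i x) (ch_inv j y)).
Proof. by rewrite /chart2 row_mxKl row_mxKr. Qed.

Lemma chart2_dom_row_mx x y : chart2_dom (row_mx x y) ->
  [/\ ch_img i x, ch_img j y & ch_dom k (f (ch_inv i x) (ch_inv j y))].
Proof. by move=> [/= ix [jy kxy]]; move: ix jy kxy; rewrite row_mxKl row_mxKr. Qed.

End SmoothMap2.

Section NearRowMx.
Context {R : realType} {m n : nat}.
Variables (U : set 'rV[R]_(m + n)) (x : 'rV[R]_m) (y : 'rV[R]_n).
Hypotheses (Uo : open U) (Uxy : U (row_mx x y)).

Lemma near_row_mx_l : \forall x' \near x, U (row_mx x' y).
Proof.
have dl : differentiable (fun x' => row_mx x' y) x.
  by apply: differentiable_row_mx => //; exact: differentiable_cst.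
exact: (differentiable_continuous dl (open_near Uo Uxy)).
Qed.

Lemma near_row_mx_r : \forall y' \near y, U (row_mx x y').
Proof.
have dr : differentiable (fun y' => row_mx x y') y.
  by apply: differentiable_row_mx => //; exact: differentiable_cst.
exact: (differentiable_continuous dr (open_near Uo Uxy)).
Qed.

End NearRowMx.

Section LieGroup.
Context {R : realType} {d : nat} (G : lie_group R d).
Implicit Types a b : G.

Definition lg_origin : 'rV[R]_d := ch_map (lg_chart G) (lg_one G).

Lemma lg_mulr_inv a : lg_mul a (lg_inv a) = lg_one G.
Proof.
rewrite -[LHS]lg_mul1 -{1}(lg_mulV (lg_inv a)) -lg_mulA.
by rewrite [lg_mul (lg_inv a) _]lg_mulA lg_mulV lg_mul1 lg_mulV.
Qed.

Lemma lg_mulr1 a : lg_mul a (lg_one G) = a.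
Proof. by rewrite -(lg_mulV a) lg_mulA lg_mulr_inv lg_mul1. Qed.

Lemma lg_idem a : lg_mul a a = a -> a = lg_one G.
Proof. by move=> aa; rewrite -(lg_mulV a) -{3}aa lg_mulA lg_mulV lg_mul1. Qed.

Lemma lg_inv1 : lg_inv (lg_one G) = lg_one G.
Proof. by rewrite -[LHS]lg_mulr1 lg_mulV. Qed.

Lemma lg_origin_img : ch_img (lg_chart G) lg_origin.
Proof. exact: ch_img_map (lg_chart1 G). Qed.

Lemma lg_inv_origin : ch_inv (lg_chart G) lg_origin = lg_one G.
Proof. exact: ch_mapK (lg_chart1 G). Qed.

Section Exponential.
Variable E : 'rV[R]_d -> G.
Hypothesis EP : is_lie_exp E.

Lemma lie_exp0 : E 0 = lg_one G.
Proof.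
apply: lg_idem; have [_ EM _] := EP 0.
by have := EM 0 0; rewrite !scaler0.
Qed.

Lemma near_lie_exp c : \forall s \near (0 : R), ch_dom (lg_chart G) (E (s *: c)).
Proof.
have [Ec _ _] := EP c.
apply: (near_ch_dom (f := fun s : R => E (s *: c)) (Ec 0)).
by rewrite scale0r lie_exp0; exact: lg_chart1.
Qed.

Definition exp_curve c (s : R) : 'rV[R]_d := ch_map (lg_chart G) (E (s *: c)).

Lemma exp_curve0 c : exp_curve c 0 = lg_origin.
Proof. by rewrite /exp_curve scale0r lie_exp0. Qed.

(** By the chain rule the exponential curve enters only through its velocity c, so it can be
    replaced by a straight line in the chart. *)
Lemma derive1_exp_curve (W : normedModType R) (H : 'rV[R]_d -> W) c :
  differentiable H lg_origin ->
  derive1 (H \o exp_curve c) 0 = 'D_c H lg_origin.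
Proof.
move=> dH; have [_ _ [dE DE]] := EP c.
have dE' : differentiable (exp_curve c) (0 : R) by exact/derivable1_diffP.
have dH' : differentiable H (exp_curve c 0) by rewrite exp_curve0.
by rewrite derive1E (derive_chain _ dE' dH') exp_curve0 [X in 'D_X H _]DE.
Qed.

End Exponential.
End LieGroup.

Lemma near_eq_derive1 (R : realType) (W : normedModType R) (f g : R -> W) (t : R) :
  (\forall s \near t, f s = g s) -> derive1 f t = derive1 g t.
Proof. by move=> fg; rewrite !derive1E; exact: near_eq_derive. Qed.

(** * The vector fields of a smooth action *)

Section Action.
Context {R : realType} {d m : nat} {G : lie_group R d} {M : manifold R m}.
Variable act : G -> M -> M.
Hypotheses (act1 : forall y, act (lg_one G) y = y)
  (actM : forall a b y, act (lg_mul a b) y = act a (act b y))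
  (acts : smooth_map2 act).
Variable p : ch_idx M.

Local Notation e := (lg_origin G).
Local Notation lg := (lg_chart G).
Local Notation phi := (chart2 act lg p p).
Local Notation dom := (chart2_dom act lg p p).

(** The fundamental vector field of a, written as a partial derivative at the unit; in this form
    linearity in a and smoothness in y are immediate. *)
Definition act_field (a : 'rV[R]_d) (y : 'rV[R]_m) : 'rV[R]_m :=
  'D_(row_mx a 0) phi (row_mx e y).

Lemma act_dom1 y : ch_img p y -> dom (row_mx e y).
Proof.
move=> py; apply: chart2_domP => //; first exact: lg_origin_img.
by rewrite lg_inv_origin act1; exact: ch_dom_inv.
Qed.

Lemma act_chart1 y : ch_img p y -> phi (row_mx e y) = y.
Proof. by move=> py; rewrite chart2E lg_inv_origin act1 ch_invK. Qed.

Lemma differentiable_act z : dom z -> differentiable phi z.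
Proof.
exact: (smooth_differentiable (open_chart2_dom acts) (@smooth_chart2 _ _ _ _ _ _ _ _ lg p p acts)).
Qed.

Lemma differentiable_dact v z : dom z -> differentiable ('D_v phi) z.
Proof.
have so := open_chart2_dom (i:=lg) (j:=p) (k:=p) acts.
have ss := smooth_derive so (@smooth_chart2 _ _ _ _ _ _ _ _ lg p p acts) v.
exact: (smooth_differentiable so ss).
Qed.

Lemma dact_sym v w z : dom z -> 'D_w ('D_v phi) z = 'D_v ('D_w phi) z.
Proof.
exact: (smooth_derive_sym (open_chart2_dom acts) (@smooth_chart2 _ _ _ _ _ _ _ _ lg p p acts)).
Qed.

(** The unit acts as the identity on a whole neighbourhood of y. *)
Lemma derive_act_r y v : ch_img p y -> 'D_(row_mx 0 v) phi (row_mx e y) = v.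
Proof.
move=> py; rewrite -derive_partial_r; last exact/differentiable_act/act_dom1.
have nE : \forall y' \near y, phi (row_mx e y') = id y'.
  by apply: filterS (open_near (open_ch_img p) py) => y'; exact: act_chart1.
by rewrite (near_eq_derive _ nE) derive_id.
Qed.

Lemma act_fieldD a b y : ch_img p y ->
  act_field (a + b) y = act_field a y + act_field b y.
Proof.
move=> py; have dphi := differentiable_act (act_dom1 py).
have rowE : row_mx (a + b) 0 = row_mx a 0 + row_mx b (0 : 'rV_m).
  by rewrite add_row_mx addr0.
rewrite /act_field rowE; exact: deriveDdir.
Qed.

Lemma act_fieldZ k a y : ch_img p y -> act_field (k *: a) y = k *: act_field a y.
Proof.
move=> py; have dphi := differentiable_act (act_dom1 py).
have rowE : row_mx (k *: a) 0 = k *: row_mx a (0 : 'rV_m).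
  by rewrite scale_row_mx scaler0.
rewrite /act_field rowE; exact: deriveZdir.
Qed.

Lemma act_fieldB a b y : ch_img p y ->
  act_field (a - b) y = act_field a y - act_field b y.
Proof. by move=> py; rewrite act_fieldD // -scaleN1r act_fieldZ // scaleN1r. Qed.

Lemma differentiable_act_field a y : ch_img p y -> differentiable (act_field a) y.
Proof.
move=> py; apply: (differentiable_partial_r (F := 'D_(row_mx a 0) phi)).
exact/differentiable_dact/act_dom1.
Qed.

Lemma derive_act_field a v y : ch_img p y ->
  'D_v (act_field a) y = 'D_(row_mx 0 v) ('D_(row_mx a 0) phi) (row_mx e y).
Proof.
move=> py; apply: (derive_partial_r (F := 'D_(row_mx a 0) phi)).
exact/differentiable_dact/act_dom1.
Qed.

Lemma derive1_exp_act (E : 'rV[R]_d -> G) c y : is_lie_exp E -> ch_img p y ->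
  derive1 (fun s : R => ch_map p (act (E (s *: c)) (ch_inv p y))) 0
  = act_field c y.
Proof.
move=> EP py; pose H x := phi (row_mx x y).
have dphi := differentiable_act (act_dom1 py).
have nE : \forall s \near (0 : R), ch_map p (act (E (s *: c)) (ch_inv p y)) =
    (H \o exp_curve E c) s.
  apply: filterS (near_lie_exp EP c) => s Es.
  by rewrite /H /= chart2E /exp_curve ch_mapK.
rewrite (near_eq_derive1 nE) (derive1_exp_curve EP); last exact: differentiable_partial_l.
exact: derive_partial_l.
Qed.

Lemma act_isometry (g : metric M) x y (v w : 'rV[R]_m) :
  (forall a, isometric g (act a)) -> dom (row_mx x y) ->
  ip (g p (phi (row_mx x y))) ('D_(row_mx 0 v) phi (row_mx x y))
    ('D_(row_mx 0 w) phi (row_mx x y)) = ip (g p y) v w.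
Proof.
move=> giso oxy; have [lx py pxy] := chart2_dom_row_mx oxy.
have dphi := differentiable_act oxy.
have := giso (ch_inv lg x) p p (ch_inv p y) (ch_dom_inv py) pxy v w.
rewrite (ch_invK py).
have cE y' : ch_map p (act (ch_inv lg x) (ch_inv p y')) = phi (row_mx x y').
  by rewrite chart2E.
rewrite cE.
have -> : in_charts (act (ch_inv lg x)) p p = fun y' => phi (row_mx x y').
  by apply/funext => y'; exact: cE.
by rewrite (derive_partial_r dphi v) (derive_partial_r dphi w).
Qed.

(** The Killing equation: the isometry identity is differentiated at the unit in the group variable.
    Interchanging the two derivatives of [phi] turns the derivative of D_v [phi] along c into D_v of
    the field of c. *)
Lemma derive_isometry (g : metric M) y (v w : 'rV[R]_m) c :
  (forall i, smooth_on (ch_img i) (g i)) ->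
  (forall a, isometric g (act a)) -> ch_img p y ->
  ip ('D_(act_field c y) (g p) y) v w
  + ip (g p y) ('D_v (act_field c) y) w
  + ip (g p y) v ('D_w (act_field c) y) = 0.
Proof.
move=> gs giso py; have oy := act_dom1 py; have dphi := differentiable_act oy.
have near_iso : \forall x \near e,
    ip (g p (phi (row_mx x y))) ('D_(row_mx 0 v) phi (row_mx x y))
      ('D_(row_mx 0 w) phi (row_mx x y)) = cst (ip (g p y) v w) x.
  apply: filterS (near_row_mx_l (open_chart2_dom acts) oy) => x.
  exact: act_isometry.
have dphil := differentiable_partial_l dphi.
have dgp : differentiable (g p) (phi (row_mx e y)).
  by rewrite act_chart1 //; exact: smooth_differentiable (open_ch_img p) (gs p) _ py.
have dg := differentiable_comp dphil dgp.
have dD u : differentiable (fun x => 'D_(row_mx 0 u) phi (row_mx x y)) e.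
  exact: (differentiable_partial_l (F := 'D_(row_mx 0 u) phi) (differentiable_dact _ oy)).
have DD u : 'D_c (fun x => 'D_(row_mx 0 u) phi (row_mx x y)) e = 'D_u (act_field c) y.
  apply: etrans (derive_partial_l (F := 'D_(row_mx 0 u) phi) (differentiable_dact _ oy) c) _.
  apply: etrans _ (esym (derive_act_field c u py)); exact: dact_sym.
have Dg : 'D_c (fun x => g p (phi (row_mx x y))) e = 'D_(act_field c y) (g p) y.
  apply: etrans (derive_chain c dphil dgp) _.
  by rewrite [X in 'D_X _ _](derive_partial_l dphi c) (act_chart1 py).
have H0 := near_eq_derive c near_iso; rewrite derive_cst in H0.
have gE : (g p \o (fun x => phi (row_mx x y))) e = g p y by rewrite /comp (act_chart1 py).
exact: etrans (esym (derive_ip_eq dg (dD v) (dD w) gE (derive_act_r v py)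
  (derive_act_r w py) Dg (DD v) (DD w))) H0.
Qed.

End Action.

Section GroupAction.
Context {R : realType} {d m : nat} {G : lie_group R d} {M : manifold R m}.
Variable act : G -> M -> M.
Hypotheses (act1 : forall y, act (lg_one G) y = y)
  (actM : forall a b y, act (lg_mul a b) y = act a (act b y))
  (acts : smooth_map2 act).
Variable p : ch_idx M.

Local Notation e := (lg_origin G).
Local Notation lg := (lg_chart G).
Local Notation phi := (chart2 act lg p p).
Local Notation dom := (chart2_dom act lg p p).
Local Notation mu := (chart2 (@lg_mul R d G) lg lg lg).
Local Notation gdom := (chart2_dom (@lg_mul R d G) lg lg lg).
Local Notation field := (act_field act p).
Local Notation gfield := (act_field (@lg_mul R d G) lg).

Lemma mul_chart1r x : ch_img lg x -> mu (row_mx x e) = x.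
Proof. by move=> lx; rewrite chart2E lg_inv_origin lg_mulr1 ch_invK. Qed.

Lemma gdom_r x : ch_img lg x -> gdom (row_mx x e).
Proof.
move=> lx; apply: chart2_domP => //; first exact: lg_origin_img.
by rewrite lg_inv_origin lg_mulr1; exact: ch_dom_inv.
Qed.

Lemma differentiable_mul z : gdom z -> differentiable mu z.
Proof. exact: (differentiable_act (@lg_mul_smooth _ _ G)). Qed.

Lemma differentiable_dmul v z : gdom z -> differentiable ('D_v mu) z.
Proof. exact: (differentiable_dact (@lg_mul_smooth _ _ G)). Qed.

Lemma derive_mul_l x v : ch_img lg x -> 'D_(row_mx v 0) mu (row_mx x e) = v.
Proof.
move=> lx; rewrite -derive_partial_l; last exact/differentiable_mul/gdom_r.
have nE : \forall x' \near x, mu (row_mx x' e) = id x'.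
  by apply: filterS (open_near (open_ch_img lg) lx) => x'; exact: mul_chart1r.
by rewrite (near_eq_derive _ nE) derive_id.
Qed.

Lemma gfield_origin a : gfield a e = a.
Proof. exact/derive_mul_l/lg_origin_img. Qed.

(* The mixed second derivative of the product at the unit; the Lie bracket is
   its antisymmetrisation. *)
Definition dmul2 (a c : 'rV[R]_d) : 'rV[R]_d := 'D_c (gfield a) e.

(* The derivative of (x z) y = x (z y) in x at the unit; differentiating once
   more in z gives the commutator of two vector fields of the action. *)
Lemma act_field_act a z y : dom (row_mx z y) ->
  'D_(row_mx (gfield a z) 0) phi (row_mx z y) = field a (phi (row_mx z y)).
Proof.
move=> ozy; have [lz py pzy] := chart2_dom_row_mx ozy.
have phizy : ch_img p (phi (row_mx z y)) by rewrite chart2E; exact: ch_img_map.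
have og : gdom (row_mx e z) := act_dom1 (@lg_mul1 _ _ G) lz.
have dmu := differentiable_partial_l (differentiable_mul og).
have muz : mu (row_mx e z) = z := act_chart1 (@lg_mul1 _ _ G) lz.
have dphi : differentiable (fun x => phi (row_mx x y)) (mu (row_mx e z)).
  by rewrite muz; exact/differentiable_partial_l/differentiable_act.
have assoc : \forall x \near e,
    phi (row_mx (mu (row_mx x z)) y) = phi (row_mx x (phi (row_mx z y))).
  apply: filterS (near_row_mx_l (open_chart2_dom (@lg_mul_smooth _ _ G)) og) => x oxz.
  have [lx _ lxz] := chart2_dom_row_mx oxz.
  by rewrite !chart2E !ch_mapK // actM.
have := near_eq_derive a assoc.
have -> : 'D_a (fun x => phi (row_mx (mu (row_mx x z)) y)) e =
    'D_(row_mx (gfield a z) 0) phi (row_mx z y).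
  apply: etrans (derive_chain a dmu dphi) _.
  rewrite [X in 'D_X _ _](derive_partial_l (differentiable_mul og) a) muz.
  exact: (derive_partial_l (differentiable_act acts ozy)).
move=> ->.
exact: (derive_partial_l (differentiable_act acts (act_dom1 act1 phizy))).
Qed.

(** On the left side of [act_field_act] both direction and base point depend on z: the direction
    contributes [dmul2 a c], the base point a second derivative of [phi] in the group variable. *)
Lemma derive_act_field2 a c y : ch_img p y ->
  'D_(field c y) (field a) y =
  field (dmul2 a c) y + 'D_(row_mx c 0) ('D_(row_mx a 0) phi) (row_mx e y).
Proof.
move=> py; have oy := act_dom1 act1 py; have dphi := differentiable_act acts oy.
have lge := lg_origin_img G.
have invar : \forall z \near e,
    'D_(row_mx (gfield a z) 0) phi (row_mx z y) = field a (phi (row_mx z y)).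
  apply: filterS (near_row_mx_l (open_chart2_dom acts) oy) => z.
  exact: act_field_act.
have dgf : differentiable (gfield a) e.
  exact: (differentiable_act_field (@lg_mul1 _ _ G) (@lg_mul_smooth _ _ G) a lge).
have d0 : differentiable (cst (0 : 'rV[R]_m)) e by exact: differentiable_cst.
have dy : differentiable (cst (y : 'rV[R]_m)) e by exact: differentiable_cst.
have did : differentiable (id : 'rV[R]_d -> _) e by [].
have := near_eq_derive c invar.
have -> : 'D_c (fun z => 'D_(row_mx (gfield a z) 0) phi (row_mx z y)) e =
    field (dmul2 a c) y + 'D_(row_mx c 0) ('D_(row_mx a 0) phi) (row_mx e y).
  apply: etrans (derive_along (open_chart2_dom acts)
    (@smooth_chart2 _ _ _ _ _ _ _ _ lg p p acts) (g := fun z => row_mx z y)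
    (w := fun z => row_mx (gfield a z) 0) oy (differentiable_row_mx did dy)
    (differentiable_row_mx dgf d0) c) _.
  rewrite (derive_row_mx did dy) (derive_row_mx dgf d0) !derive_cst derive_id.
  by rewrite gfield_origin.
move=> ->.
have dphil := differentiable_partial_l dphi.
have df : differentiable (field a) (phi (row_mx e y)).
  by rewrite (act_chart1 act1 py); exact: differentiable_act_field.
apply: esym; apply: etrans (derive_chain c dphil df) _.
by rewrite [X in 'D_X _ _](derive_partial_l dphi c) (act_chart1 act1 py).
Qed.

(** The second derivative of [phi] is symmetric in a and c and cancels. In terms of commutators,
    [X_c, X_a] = X_[a,c]: for a left action, c |-> X_c reverses brackets. *)
Lemma act_field_lie a c y : ch_img p y ->
  'D_(field c y) (field a) y - 'D_(field a y) (field c) y =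
  field (dmul2 a c - dmul2 c a) y.
Proof.
move=> py; have oy := act_dom1 act1 py.
have abel (u v w : 'rV[R]_m) : u + w - (v + w) = u - v.
  by rewrite opprD addrACA subrr addr0.
apply: etrans (congr2 (fun u v => u - v) (derive_act_field2 a c py)
  (derive_act_field2 c a py)) _.
rewrite (act_fieldB act1 acts _ _ py) [X in _ - (_ + X)](dact_sym acts _ _ oy).
exact: abel.
Qed.

End GroupAction.

(** * The Lie bracket *)

Section SecondDerivativeOfProduct.
Context {R : realType} {d : nat} {G : lie_group R d}.

Local Notation e := (lg_origin G).
Local Notation lg := (lg_chart G).
Local Notation mu := (chart2 (@lg_mul R d G) lg lg lg).
Local Notation gdom := (chart2_dom (@lg_mul R d G) lg lg lg).
Local Notation gfield := (act_field (@lg_mul R d G) lg).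
Local Notation dmul2 := (@dmul2 R d G).

Let lge : ch_img lg e := lg_origin_img G.
Let oee : gdom (row_mx e e) := gdom_r lge.
Let gs := @lg_mul_smooth _ _ G.
Let g1 := @lg_mul1 _ _ G.

Lemma dmul2E a c :
  dmul2 a c = 'D_(row_mx 0 c) ('D_(row_mx a 0) mu) (row_mx e e).
Proof. exact: (derive_act_field g1 gs a c lge). Qed.

(** In this order of differentiation the expression is visibly linear in a, in the other order in
    c. *)
Lemma dmul2_sym a c :
  dmul2 a c = 'D_(row_mx a 0) ('D_(row_mx 0 c) mu) (row_mx e e).
Proof. by apply: etrans (dmul2E a c) _; exact: (dact_sym gs _ _ oee). Qed.

Lemma dmul2Dr a c c' : dmul2 a (c + c') = dmul2 a c + dmul2 a c'.
Proof. exact: (deriveDdir _ _ (differentiable_act_field g1 gs a lge)). Qed.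

Lemma dmul2Zr a k c : dmul2 a (k *: c) = k *: dmul2 a c.
Proof. exact: (deriveZdir _ _ (differentiable_act_field g1 gs a lge)). Qed.

Lemma dmul2Dl a a' c : dmul2 (a + a') c = dmul2 a c + dmul2 a' c.
Proof.
rewrite !dmul2_sym.
have rowE : row_mx (a + a') 0 = row_mx a 0 + row_mx a' (0 : 'rV[R]_d).
  by rewrite add_row_mx addr0.
rewrite rowE; exact: (deriveDdir _ _ (differentiable_dmul _ oee)).
Qed.

Lemma dmul2Zl a k c : dmul2 (k *: a) c = k *: dmul2 a c.
Proof.
rewrite !dmul2_sym.
have rowE : row_mx (k *: a) 0 = k *: row_mx a (0 : 'rV[R]_d).
  by rewrite scale_row_mx scaler0.
rewrite rowE; exact: (deriveZdir _ _ (differentiable_dmul _ oee)).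
Qed.

Lemma derive_mul_origin a b : 'D_(row_mx a b) mu (row_mx e e) = a + b.
Proof.
have rowE : row_mx a b = row_mx a 0 + row_mx 0 b by rewrite add_row_mx addr0 add0r.
rewrite rowE; apply: etrans (deriveDdir _ _ (differentiable_mul oee)) _.
by congr (_ + _); [exact: derive_mul_l|exact: (derive_act_r g1 gs)].
Qed.

(** Since x e = x, the first derivative in the left factor is constant along right factor e. *)
Lemma derive2_mul_l a c :
  'D_(row_mx a 0) ('D_(row_mx c 0) mu) (row_mx e e) = 0.
Proof.
apply: etrans (esym (derive_partial_l (F := 'D_(row_mx c 0) mu) (differentiable_dmul _ oee) a)) _.
have nE : \forall x \near e, 'D_(row_mx c 0) mu (row_mx x e) = cst c x.
  by apply: filterS (open_near (open_ch_img lg) lge) => x lx; exact: derive_mul_l.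
by apply: etrans (near_eq_derive _ nE) _; exact: derive_cst.
Qed.

Local Notation iota := (in_charts (@lg_inv R d G) lg lg).

Let idom : set 'rV[R]_d := ch_map lg @` (ch_dom lg `&` @lg_inv R d G @^-1` ch_dom lg).

Let idom_open : open idom.
Proof.
apply: open_ch_map; apply: open_comp; last exact: ch_dom_open.
by move=> y _; exact: (@lg_inv_smooth R d G).1.
Qed.

Let idom_e : idom e.
Proof. by exists (lg_one G) => //; split; rewrite /= ?lg_inv1; exact: lg_chart1. Qed.

Lemma inv_origin : iota e = e.
Proof. by rewrite /in_charts lg_inv_origin lg_inv1. Qed.

Lemma differentiable_inv : differentiable iota e.
Proof. exact: (smooth_differentiable idom_open ((@lg_inv_smooth R d G).2 lg lg)). Qed.

Lemma idomP x : idom x -> [/\ ch_img lg x, ch_dom lg (lg_inv (ch_inv lg x)) &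
  gdom (row_mx x (iota x))].
Proof.
move=> [y [ly liy] <-]; have lx := ch_img_map ly.
split=> //; first by rewrite ch_mapK.
apply: chart2_domP => //; first by rewrite /in_charts ch_mapK //; exact: ch_img_map.
by rewrite /in_charts !ch_mapK // lg_mulr_inv; exact: lg_chart1.
Qed.

Lemma mul_inv x : idom x -> mu (row_mx x (iota x)) = e.
Proof.
move=> ix; have [lx lix _] := idomP ix.
by rewrite chart2E /in_charts ch_mapK // lg_mulr_inv.
Qed.

Let dpair : differentiable (fun x => row_mx x (iota x)) e.
Proof. by apply: differentiable_row_mx => //; exact: differentiable_inv. Qed.

Let Dpair a : 'D_a (fun x => row_mx x (iota x)) e = row_mx a ('D_a iota e).
Proof. by rewrite (derive_row_mx _ differentiable_inv) // derive_id. Qed.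

(** Differentiate x x^-1 = e at the unit, where the product has derivative a + b. *)
Lemma derive_inv a : 'D_a iota e = - a.
Proof.
have dm : differentiable mu (row_mx e (iota e)) by rewrite inv_origin; exact: differentiable_mul.
have nE : \forall x \near e, (mu \o (fun x => row_mx x (iota x))) x = cst e x.
  by apply: filterS (open_near idom_open idom_e) => x; exact: mul_inv.
have := etrans (esym (derive_chain a dpair dm)) (near_eq_derive a nE).
rewrite Dpair derive_cst inv_origin derive_mul_origin => /eqP.
by rewrite addrC addr_eq0 => /eqP.
Qed.

Section AdjointAction.
Variable E : 'rV[R]_d -> G.
Hypothesis EP : is_lie_exp E.

(** The left-invariant vector field with value c at the unit. *)
Let dr (c x : 'rV[R]_d) : 'rV[R]_d := 'D_(row_mx 0 c) mu (row_mx x e).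

(** Ad_x c is c translated from the left to x and then from the right by x^-1; the exponential drops
    out by [derive1_exp_curve]. *)
Let AdE c x : idom x ->
  derive1 (fun t : R => ch_map lg (lg_mul (lg_mul (ch_inv lg x) (E (t *: c)))
     (lg_inv (ch_inv lg x)))) 0 = 'D_(row_mx (dr c x) 0) mu (row_mx x (iota x)).
Proof.
move=> ix; have [lx lix oxi] := idomP ix; have oxe := gdom_r lx.
pose H z := mu (row_mx (mu (row_mx x z)) (iota x)).
have nE : \forall t \near (0 : R),
   ch_map lg (lg_mul (lg_mul (ch_inv lg x) (E (t *: c))) (lg_inv (ch_inv lg x)))
   = (H \o exp_curve E c) t.
  have dE : differentiable (exp_curve E c) (0 : R).
    by have [_ _ [dE _]] := EP c; exact/derivable1_diffP.
  have nx : \forall t \near (0 : R), gdom (row_mx x (exp_curve E c t)).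
    have nz : \forall z \near exp_curve E c 0, gdom (row_mx x z).
      by rewrite (exp_curve0 EP); exact: (near_row_mx_r (open_chart2_dom gs) oxe).
    exact: (differentiable_continuous dE nz).
  apply: filterS2 (near_lie_exp EP c) nx => t lEt /chart2_dom_row_mx[_ _].
  rewrite /H /= /exp_curve /in_charts ch_mapK // => lxE.
  by rewrite !chart2E !ch_mapK.
have d1 := differentiable_partial_r (differentiable_mul oxe).
have d2 : differentiable (fun y => mu (row_mx y (iota x))) (mu (row_mx x e)).
  by rewrite mul_chart1r //; exact/differentiable_partial_l/differentiable_mul.
apply: etrans (near_eq_derive1 nE) _.
apply: etrans (derive1_exp_curve EP c (differentiable_comp d1 d2)) _.
apply: etrans (derive_chain c d1 d2) _.
rewrite [X in 'D_X _ _](derive_partial_r (differentiable_mul oxe) c) (mul_chart1r lx).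
exact: (derive_partial_l (differentiable_mul oxi)).
Qed.

(** Along x, the vector [dr c x] moves and contributes [dmul2 a c], while the base point (x, x^-1)
    moves in direction (a, -a). The a half vanishes by [derive2_mul_l], the -a half gives minus
    [dmul2 c a]. *)
Lemma derive1_Ad a c :
  derive1 (fun s : R => derive1 (fun t : R =>
     ch_map lg (lg_mul (lg_mul (E (s *: a)) (E (t *: c))) (lg_inv (E (s *: a))))) 0) 0
  = dmul2 a c - dmul2 c a.
Proof.
pose K x := 'D_(row_mx (dr c x) 0) mu (row_mx x (iota x)).
have dE : differentiable (exp_curve E a) (0 : R).
  by have [_ _ [dE _]] := EP a; exact/derivable1_diffP.
have nx : \forall s \near (0 : R), idom (exp_curve E a s).
  have nz : \forall z \near exp_curve E a 0, idom z.
    by rewrite (exp_curve0 EP); exact: open_near.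
  exact: (differentiable_continuous dE nz).
have nE : \forall s \near (0 : R), derive1 (fun t : R =>
     ch_map lg (lg_mul (lg_mul (E (s *: a)) (E (t *: c))) (lg_inv (E (s *: a))))) 0
   = (K \o exp_curve E a) s.
  apply: filterS2 (near_lie_exp EP a) nx => s lEs ix.
  by rewrite /K /= -(AdE c ix) /exp_curve (ch_mapK lEs).
apply: etrans (near_eq_derive1 nE) _.
have ddr : differentiable (dr c) e.
  exact: (differentiable_partial_l (F := 'D_(row_mx 0 c) mu) (differentiable_dmul _ oee)).
have Ddr : 'D_a (dr c) e = dmul2 a c.
  apply: etrans (derive_partial_l (F := 'D_(row_mx 0 c) mu) (differentiable_dmul _ oee) a) _.
  by rewrite dmul2_sym.
have d0 : differentiable (fun=> (0 : 'rV[R]_d)) e by exact: differentiable_cst.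
have oei : gdom (row_mx e (iota e)) by rewrite inv_origin.
have so := open_chart2_dom (i := lg) (j := lg) (k := lg) gs.
have sm := @smooth_chart2 _ _ _ _ _ _ _ _ lg lg lg gs.
have dw := differentiable_row_mx ddr d0.
have dK : differentiable K e.
  exact: (differentiable_along so sm (g := fun x => row_mx x (iota x))
    (w := fun x => row_mx (dr c x) 0) oei dpair dw).
apply: etrans (derive1_exp_curve EP a dK) _.
apply: etrans (derive_along so sm (g := fun x => row_mx x (iota x))
  (w := fun x => row_mx (dr c x) 0) oei dpair dw a) _.
rewrite (derive_row_mx ddr d0) Ddr derive_cst Dpair derive_inv inv_origin.
have -> : dr c e = c by exact: (derive_act_r g1 gs).
apply: (congr2 +%R (derive_mul_l (dmul2 a c) lge)).
have rowE : row_mx a (- a) = row_mx a 0 - row_mx 0 a.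
  by rewrite opp_row_mx add_row_mx oppr0 addr0 add0r.
rewrite rowE; apply: etrans (deriveBdir _ _ (differentiable_dmul _ oee)) _.
by rewrite derive2_mul_l sub0r dmul2E.
Qed.

End AdjointAction.

Local Notation brk a c := (dmul2 a c - dmul2 c a).

(** Third-order term of the product: one derivative in the left factor and two in the right, hence
    symmetric in c and h. *)
Let d3 a c h : 'rV[R]_d :=
  'D_(row_mx 0 h) ('D_(row_mx 0 c) ('D_(row_mx a 0) mu)) (row_mx e e).

Let d3_sym a c h : d3 a c h = d3 a h c.
Proof.
have so := open_chart2_dom (i := lg) (j := lg) (k := lg) gs.
have sm := smooth_derive so (@smooth_chart2 _ _ _ _ _ _ _ _ lg lg lg gs) (row_mx a 0).
exact: (smooth_derive_sym so sm _ _ oee).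
Qed.

Let derive_nabla a c h :
  differentiable (fun z => 'D_(gfield c z) (gfield a) z) e /\
  'D_h (fun z => 'D_(gfield c z) (gfield a) z) e =
    dmul2 a (dmul2 c h) + d3 a c h.
Proof.
have so := open_chart2_dom (i := lg) (j := lg) (k := lg) gs.
have sm := smooth_derive so (@smooth_chart2 _ _ _ _ _ _ _ _ lg lg lg gs) (row_mx a 0).
have nE : \forall z \near e, 'D_(row_mx 0 (gfield c z)) ('D_(row_mx a 0) mu) (row_mx e z)
    = 'D_(gfield c z) (gfield a) z.
  apply: filterS (open_near (open_ch_img lg) lge) => z lz.
  exact: (esym (derive_act_field g1 gs _ _ lz)).
have dc := differentiable_act_field g1 gs c lge.
have d0 : differentiable (fun=> (0 : 'rV[R]_d)) e by exact: differentiable_cst.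
have de : differentiable (fun=> e) e by exact: differentiable_cst.
have did : differentiable (id : 'rV[R]_d -> _) e by [].
have dg := differentiable_row_mx de did.
have dw := differentiable_row_mx d0 dc.
have dF := differentiable_along so sm oee dg dw.
split; first exact: near_eq_differentiable nE dF.
apply: etrans (esym (near_eq_derive h nE)) _.
apply: etrans (derive_along so sm oee dg dw h) _.
rewrite (derive_row_mx de did) (derive_row_mx d0 dc) !derive_cst derive_id.
rewrite (gfield_origin c).
exact: (congr1 (fun v => v + d3 a c h) (esym (dmul2E a (dmul2 c h)))).
Qed.

(** The group acts on itself by left multiplication; the commutator formula for its fields is
    differentiated once more at the unit. *)
Lemma dmul2_brk a c h : dmul2 (brk a c) h =
  dmul2 a (dmul2 c h) + d3 a c h - (dmul2 c (dmul2 a h) + d3 c a h).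
Proof.
have [dac Dac] := derive_nabla a c h; have [dca Dca] := derive_nabla c a h.
have nE : \forall z \near e, 'D_(gfield c z) (gfield a) z - 'D_(gfield a z) (gfield c) z =
    gfield (brk a c) z.
  apply: filterS (open_near (open_ch_img lg) lge) => z lz.
  have gA x y v : lg_mul (lg_mul x y) v = lg_mul x (lg_mul y v) :> G by rewrite lg_mulA.
  exact: (act_field_lie g1 gA gs _ _ lz).
apply: etrans (esym (near_eq_derive h nE)) _.
apply: etrans (deriveB (diff_derivable dac) (diff_derivable dca)) _.
exact: (congr2 (fun u v => u - v) Dac Dca).
Qed.

(** After expansion by [dmul2_brk], the third-order terms cancel in the cyclic sum by [d3_sym], and
    the nested [dmul2] terms cancel in pairs. *)
Lemma brk_jacobi a b c :
  brk (brk a b) c + brk (brk b c) a + brk (brk c a) b = 0.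
Proof.
have dBr x y z : dmul2 x (y - z) = dmul2 x y - dmul2 x z.
  by rewrite dmul2Dr -scaleN1r dmul2Zr scaleN1r.
have alg (abc bac cab cba bca acb ta tb tc ta' tb' tc' p q r p' q' r' : 'rV[R]_d) :
    p = abc + ta - (bac + tb) -> q = bca + tb' - (cba + tc) ->
    r = cab + tc' - (acb + ta') ->
    p' = cab - cba -> q' = abc - acb -> r' = bca - bac ->
    ta = ta' -> tb = tb' -> tc = tc' -> p - p' + (q - q') + (r - r') = 0.
  by move=> -> -> -> -> -> -> <- <- <-; apply/rowP => i; rewrite !mxE; ring.
exact: (alg _ _ _ _ _ _ _ _ _ _ _ _ _ _ _ _ _ _
  (dmul2_brk a b c) (dmul2_brk b c a) (dmul2_brk c a b)
  (dBr c _ _) (dBr a _ _) (dBr b _ _)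
  (d3_sym a b c) (d3_sym b a c) (d3_sym c b a)).
Qed.

(** Left and right invariance, differentiated along a, contain the same derivative of the metric.
    Their difference leaves only the brackets. *)
Lemma gram_brk (g : metric G) a b c :
  (forall i, smooth_on (ch_img i) (g i)) ->
  (forall a, isometric g (lg_mul a)) ->
  (forall a, isometric g (fun b => lg_mul b a)) ->
  ip (g lg e) (brk a b) c + ip (g lg e) b (brk a c) = 0.
Proof.
have alg (P x y z t : R) : P + x + y = 0 -> P + z + t = 0 ->
    (z - x) + (t - y) = 0 by lra.
move=> gsm gl gr.
have dm := differentiable_mul oee.
have dg : differentiable (g lg) e := smooth_differentiable (open_ch_img lg) (gsm lg) lge.
have dD u : differentiable (fun x => 'D_(row_mx u 0) mu (row_mx e x)) e.
  exact: (differentiable_partial_r (F := 'D_(row_mx u 0) mu) (differentiable_dmul _ oee)).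
have DD u : 'D_a (fun x => 'D_(row_mx u 0) mu (row_mx e x)) e = dmul2 u a.
  apply: etrans (derive_partial_r (F := 'D_(row_mx u 0) mu) (differentiable_dmul _ oee) a) _.
  by rewrite dmul2E.
have dD' u : differentiable (fun x => 'D_(row_mx 0 u) mu (row_mx x e)) e.
  exact: (differentiable_partial_l (F := 'D_(row_mx 0 u) mu) (differentiable_dmul _ oee)).
have DD' u : 'D_a (fun x => 'D_(row_mx 0 u) mu (row_mx x e)) e = dmul2 a u.
  apply: etrans (derive_partial_l (F := 'D_(row_mx 0 u) mu) (differentiable_dmul _ oee) a) _.
  by rewrite dmul2_sym.
have right_iso : \forall x \near e, ip (g lg x) ('D_(row_mx b 0) mu (row_mx e x))
    ('D_(row_mx c 0) mu (row_mx e x)) = cst (ip (g lg e) b c) x.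
  apply: filterS (open_near (open_ch_img lg) lge) => x lx.
  have ox : gdom (row_mx e x) := act_dom1 g1 lx.
  have := gr (ch_inv lg x) lg lg (lg_one G) (lg_chart1 G) _ b c.
  rewrite lg_mul1 => /(_ (ch_dom_inv lx)).
  have -> : in_charts (fun b => lg_mul b (ch_inv lg x)) lg lg = fun y => mu (row_mx y x).
    by apply/funext => y; rewrite chart2E.
  rewrite (ch_invK lx).
  by rewrite (derive_partial_l (differentiable_mul ox) b) (derive_partial_l (differentiable_mul ox) c).
have left_iso : \forall x \near e, ip (g lg x) ('D_(row_mx 0 b) mu (row_mx x e))
    ('D_(row_mx 0 c) mu (row_mx x e)) = cst (ip (g lg e) b c) x.
  apply: filterS (open_near (open_ch_img lg) lge) => x lx.
  have := act_isometry gs b c gl (gdom_r lx).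
  by rewrite (mul_chart1r lx).
have El u : 'D_(row_mx u 0) mu (row_mx e e) = u by exact: (derive_mul_l u lge).
have Er u : 'D_(row_mx 0 u) mu (row_mx e e) = u by exact: (derive_act_r g1 gs).
have HR := etrans (esym (derive_ip_eq dg (dD b) (dD c) erefl (El b) (El c)
  erefl (DD b) (DD c))) (etrans (near_eq_derive a right_iso) (derive_cst _ _ _)).
have HL := etrans (esym (derive_ip_eq dg (dD' b) (dD' c) erefl (Er b) (Er c)
  erefl (DD' b) (DD' c))) (etrans (near_eq_derive a left_iso) (derive_cst _ _ _)).
apply: etrans (congr2 +%R (ipBl _ _ _ _) (ipBr _ _ _ _)) _.
exact: (alg _ _ _ _ _ HR HL).
Qed.

End SecondDerivativeOfProduct.

(** * The infinitesimal action *)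

#[local] Opaque ip riesz.

Section Christoffel.
Context {R : realType} {m : nat} {M : manifold R m} {g : metric M}.
Hypothesis gR : riemannian g.
Variables (p : ch_idx M) (y : 'rV[R]_m).
Hypothesis py : ch_img p y.

Let gpos : posdef (g p y). Proof. by case: gR => + _ _; exact. Qed.

Lemma differentiable_metric : differentiable (g p) y.
Proof.
by case: gR => _ gs _; exact: (smooth_differentiable (open_ch_img p) (gs p) py).
Qed.

Lemma ip_derive_metricC z v w : ip ('D_z (g p) y) v w = ip ('D_z (g p) y) w v.
Proof.
rewrite [LHS]ip_tr -(derive_trmx _ differentiable_metric).
apply: (congr1 (fun N => ip N w v)); apply: near_eq_derive.
apply: filterS (open_near (open_ch_img p) py) => y' py'.
by case: gR => gp _ _; have [] := gp p _ py'.
Qed.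

Lemma ip_christoffel v w z : ip (g p y) (christoffel g p y v w) z =
  (ip ('D_v (g p) y) w z + ip ('D_w (g p) y) v z - ip ('D_z (g p) y) v w) / 2.
Proof.
have alg (k q1 q2 q3 s1 t1 s2 t2 s3 t3 : R) : q1 = k * s1 + t1 ->
    q2 = k * s2 + t2 -> q3 = k * s3 + t3 ->
    (q1 + q2 - q3) / 2 = k * ((s1 + s2 - s3) / 2) + (t1 + t2 - t3) / 2.
  by move=> -> -> ->; ring.
have D a b k : 'D_(k *: a + b) (g p) y = k *: 'D_a (g p) y + 'D_b (g p) y.
  apply: etrans (deriveDdir _ _ differentiable_metric) _.
  by apply: (congr1 (fun N => N + _)); exact: (deriveZdir _ _ differentiable_metric).
apply: (riesz_linear (l := fun z => (ip ('D_v (g p) y) w z + ip ('D_w (g p) y) v z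
  - ip ('D_z (g p) y) v w) / 2)) => // k a b.
exact: (alg _ _ _ _ _ _ _ _ _ _ (ip_linr _ _ _ _ _) (ip_linr _ _ _ _ _)
  (etrans (congr1 (fun N => ip N v w) (D a b k)) (ip_linm _ _ _ _ _))).
Qed.

(** Vanishing torsion: the Koszul expression inherits symmetry in v and w from the metric. *)
Lemma christoffelC v w : christoffel g p y v w = christoffel g p y w v.
Proof.
rewrite /christoffel; congr riesz; apply/funext => z.
have alg (a b c c' : R) : c = c' -> (a + b - c) / 2 = (b + a - c') / 2.
  by move=> ->; rewrite (addrC a).
exact: (alg _ _ _ _ (ip_derive_metricC z v w)).
Qed.

Lemma christoffelDr v w w' :
  christoffel g p y v (w + w') = christoffel g p y v w + christoffel g p y v w'.
Proof.
rewrite /christoffel -rieszD; congr riesz; apply/funext => z.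
have alg (q1 q2 q3 s1 t1 s2 t2 s3 t3 : R) :
    q1 = s1 + t1 -> q2 = s2 + t2 -> q3 = s3 + t3 ->
    (q1 + q2 - q3) / 2 = (s1 + s2 - s3) / 2 + (t1 + t2 - t3) / 2.
  by move=> -> -> ->; ring.
exact: (alg _ _ _ _ _ _ _ _ _ (ipDl _ _ _ _)
  (etrans (congr1 (fun N => ip N v z) (deriveDdir _ _ differentiable_metric)) (ipDg _ _ _ _))
  (ipDr _ _ _ _)).
Qed.

End Christoffel.

Section BilinearDerivative.
Context {R : realType} {V : normedModType R} {d q : nat}.
Variable f : 'rV[R]_d -> 'rV[R]_d -> 'rV[R]_q.
Hypotheses (fDl : forall a b c, f (a + b) c = f a c + f b c)
  (fDr : forall a b c, f c (a + b) = f c a + f c b)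
  (fZl : forall k a c, f (k *: a) c = k *: f a c)
  (fZr : forall k a c, f c (k *: a) = k *: f c a).

Let f0l c : f 0 c = 0.
Proof. by rewrite -(scale0r (0 : 'rV[R]_d)) fZl scale0r. Qed.

Let f0r c : f c 0 = 0.
Proof. by rewrite -(scale0r (0 : 'rV[R]_d)) fZr scale0r. Qed.

(** In coordinates a bilinear map is built from a scaling and a matrix product, for which Leibniz
    rules are known. The Lie bracket is the intended instance. *)
Let fE a b : f a b = \sum_k a 0 k *: (b *m \matrix_l f (delta_mx 0 k) (delta_mx 0 l)).
Proof.
rewrite [in LHS](row_sum_delta a).
rewrite (big_morph (f^~ b) (fun u v => fDl u v b) (f0l b)).
apply: eq_bigr => k _; rewrite fZl; congr (_ *: _).
rewrite [in LHS](row_sum_delta b).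
rewrite (big_morph (f (delta_mx 0 k)) (fun u v => fDr u v _) (f0r _)).
rewrite mulmx_sum_row; apply: eq_bigr => l _; rewrite fZr; congr (_ *: _).
by apply/rowP => j; rewrite !mxE.
Qed.

Variables (a b : V -> 'rV[R]_d) (x : V).
Hypotheses (da : differentiable a x) (db : differentiable b x).

Let dbm k : differentiable (fun y => b y *m \matrix_l f (delta_mx 0 k) (delta_mx 0 l)) x.
Proof. by apply: differentiable_mulmx => //; exact: differentiable_cst. Qed.

Let fabE : (fun y => f (a y) (b y)) = fun y =>
  \sum_k a y 0 k *: (b y *m \matrix_l f (delta_mx 0 k) (delta_mx 0 l)).
Proof. by apply/funext => y; exact: fE. Qed.

Lemma differentiable_bilinear : differentiable (fun y => f (a y) (b y)) x.
Proof.
rewrite fabE; apply: differentiable_bigsum => k.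
exact: (differentiable_scale (differentiable_entry 0 k da) (dbm k)).
Qed.

Lemma derive_bilinear v : 'D_v (fun y => f (a y) (b y)) x =
  f ('D_v a x) (b x) + f (a x) ('D_v b x).
Proof.
rewrite fabE derive_bigsum => [|k]; last first.
  exact: (differentiable_scale (differentiable_entry 0 k da) (dbm k)).
rewrite !fE -big_split; apply: eq_bigr => k _ /=.
apply: etrans (derive_scale v (differentiable_entry 0 k da) (dbm k)) _.
rewrite -(derive_entry 0 k (diff_derivable (v := v) da)); congr (_ + _ *: _).
apply: etrans (derive_mulmx v db (differentiable_cst _ _)) _.
by rewrite derive_cst mulmx0 addr0.
Qed.

End BilinearDerivative.

Section FixedData.
Context {R : realType} {d m : nat}.
Variable S : ymh_data R d m.

Local Notation lg := (lg_chart (ymh_G S)).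
Local Notation act := (ymh_act S).
Local Notation phi p := (chart2 act lg p p).
Local Notation h := (ymh_h S).

Lemma bracketE a c : bracket S a c = @dmul2 R d (ymh_G S) a c - @dmul2 R d (ymh_G S) c a.
Proof. exact: (derive1_Ad (@ymh_expP _ _ _ S) a c). Qed.

#[local] Opaque bracket dmul2.

Let bracket_fun : bracket S = fun a c => @dmul2 R d (ymh_G S) a c - @dmul2 R d (ymh_G S) c a.
Proof. by apply/funext => a; apply/funext => c; exact: bracketE. Qed.

Lemma bracketDl a b c : bracket S (a + b) c = bracket S a c + bracket S b c.
Proof. by rewrite !bracketE dmul2Dl dmul2Dr opprD addrACA. Qed.

Lemma bracketZl k a c : bracket S (k *: a) c = k *: bracket S a c.
Proof. by rewrite !bracketE dmul2Zl dmul2Zr scalerBr. Qed.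

Lemma bracketC a b : bracket S a b = - bracket S b a.
Proof. by rewrite !bracketE opprB. Qed.

Lemma bracketDr a b c : bracket S c (a + b) = bracket S c a + bracket S c b.
Proof. by rewrite !bracketE dmul2Dl dmul2Dr opprD addrACA. Qed.

Lemma bracketZr k a c : bracket S c (k *: a) = k *: bracket S c a.
Proof. by rewrite !bracketE dmul2Zl dmul2Zr scalerBr. Qed.

Lemma bracket_jacobi a b c : bracket S (bracket S a b) c +
  bracket S (bracket S b c) a + bracket S (bracket S c a) b = 0.
Proof.
by rewrite bracket_fun; exact: (@brk_jacobi R d (ymh_G S) a b c).
Qed.

Lemma gram_posdef : posdef (gram S).
Proof.
by have [gp _ _] := ymh_gG_riemannian S; apply: gp; exact: lg_origin_img.
Qed.

Lemma gram_bracket a b c :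
  ip (gram S) (bracket S a b) c + ip (gram S) b (bracket S a c) = 0.
Proof.
have [_ gs _] := ymh_gG_riemannian S.
rewrite bracket_fun.
exact: (gram_brk a b c gs (@ymh_gG_left _ _ _ S) (@ymh_gG_right _ _ _ S)).
Qed.

Section InChart.
Variable p : ch_idx (ymh_N S).

Lemma infactE c y : ch_img p y -> infact p c y = act_field act p c y.
Proof.
move=> py; exact: (derive1_exp_act (@ymh_act1 _ _ _ S) (@ymh_act_smooth _ _ _ S) c (@ymh_expP _ _ _ S) py).
Qed.

Let near_infact c y : ch_img p y ->
  \forall y' \near y, act_field act p c y' = infact p c y'.
Proof.
move=> py; apply: filterS (open_near (open_ch_img p) py) => y' py'.
by rewrite infactE.
Qed.

Lemma differentiable_infact c y : ch_img p y -> differentiable (infact p c) y.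
Proof.
move=> py; apply: near_eq_differentiable (near_infact c py) _.
exact: (differentiable_act_field (@ymh_act1 _ _ _ S) (@ymh_act_smooth _ _ _ S)).
Qed.

Let derive_infactE c y v : ch_img p y ->
  'D_v (infact p c) y = 'D_v (act_field act p c) y.
Proof. by move=> py; apply: esym; exact: (near_eq_derive _ (near_infact c py)). Qed.

Lemma infactD a b y : ch_img p y -> infact p (a + b) y = infact p a y + infact p b y.
Proof.
move=> py; rewrite !infactE //; exact: (act_fieldD (@ymh_act1 _ _ _ S) (@ymh_act_smooth _ _ _ S)).
Qed.

Lemma infactZ k a y : ch_img p y -> infact p (k *: a) y = k *: infact p a y.
Proof.
move=> py; rewrite !infactE //; exact: (act_fieldZ (@ymh_act1 _ _ _ S) (@ymh_act_smooth _ _ _ S)).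
Qed.

Lemma infactB a b y : ch_img p y -> infact p (a - b) y = infact p a y - infact p b y.
Proof. by move=> py; rewrite infactD // -scaleN1r infactZ // scaleN1r. Qed.

Lemma infact_lie a c y : ch_img p y ->
  'D_(infact p c y) (infact p a) y - 'D_(infact p a y) (infact p c) y =
  infact p (bracket S a c) y.
Proof.
move=> py.
apply: etrans (congr2 (fun u v => u - v) (derive_infactE a (infact p c y) py)
  (derive_infactE c (infact p a y) py)) _.
rewrite (infactE c py) (infactE a py) (infactE _ py) bracketE.
exact: (act_field_lie (@ymh_act1 _ _ _ S) (@ymh_actM _ _ _ S) (@ymh_act_smooth _ _ _ S)).
Qed.

Lemma infact_killing c y v w : ch_img p y ->
  ip ('D_(infact p c y) (h p) y) v w
  + ip (h p y) ('D_v (infact p c) y) w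
  + ip (h p y) v ('D_w (infact p c) y) = 0.
Proof.
move=> py; have [_ hs _] := ymh_h_riemannian S.
rewrite (derive_infactE c v py) (derive_infactE c w py) (infactE c py).
exact: (derive_isometry (@ymh_act1 _ _ _ S) (@ymh_act_smooth _ _ _ S) v w c hs (@ymh_act_isometric _ _ _ S) py).
Qed.

Section Along.
Context {V : normedModType R}.
Variables (A : V -> 'rV[R]_d) (u : V -> 'rV[R]_m) (x : V).
Hypotheses (dA : differentiable A x) (du : differentiable u x) (pu : ch_img p (u x)).

Let near_along : \forall x' \near x,
  'D_(row_mx (A x') 0) (phi p) (row_mx (lg_origin (ymh_G S)) (u x')) =
  infact p (A x') (u x').
Proof.
have nu : \forall x' \near x, ch_img p (u x').
  exact: (differentiable_continuous du (open_near (open_ch_img p) pu)).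
by apply: filterS nu => x' pux'; rewrite infactE.
Qed.

Let d0 : differentiable (fun=> 0 : 'rV[R]_m) x.
Proof. exact: differentiable_cst. Qed.

Let de : differentiable (fun=> lg_origin (ymh_G S)) x.
Proof. exact: differentiable_cst. Qed.

Let oeu := act_dom1 (@ymh_act1 _ _ _ S) pu.
Let so := open_chart2_dom (i := lg) (j := p) (k := p) (@ymh_act_smooth _ _ _ S).
Let sm := @smooth_chart2 _ _ _ _ _ _ _ _ lg p p (@ymh_act_smooth _ _ _ S).

Lemma differentiable_infact_along : differentiable (fun x' => infact p (A x') (u x')) x.
Proof.
apply: near_eq_differentiable near_along _.
exact: (differentiable_along so sm (g := fun x' => row_mx (lg_origin (ymh_G S)) (u x'))
  (w := fun x' => row_mx (A x') 0) oeu (differentiable_row_mx de du)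
  (differentiable_row_mx dA d0)).
Qed.

(** Near x, A . u is the derivative of the action at (e, u) in direction (A, 0), so [derive_along]
    handles the motion of both A and u. *)
Lemma derive_infact_along v : 'D_v (fun x' => infact p (A x') (u x')) x =
  infact p ('D_v A x) (u x) + 'D_('D_v u x) (infact p (A x)) (u x).
Proof.
apply: etrans (esym (near_eq_derive _ near_along)) _.
apply: etrans (derive_along so sm (g := fun x' => row_mx (lg_origin (ymh_G S)) (u x'))
  (w := fun x' => row_mx (A x') 0) oeu (differentiable_row_mx de du)
  (differentiable_row_mx dA d0) v) _.
rewrite (derive_row_mx de du) (derive_row_mx dA d0) !derive_cst.
rewrite (infactE _ pu) (derive_infactE _ _ pu).
exact: (congr1 (fun w => act_field act p ('D_v A x) (u x) + w)
  (esym (derive_act_field (@ymh_act1 _ _ _ S) (@ymh_act_smooth _ _ _ S) (A x) ('D_v u x) pu))).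
Qed.

End Along.
End InChart.
End FixedData.

(** * The connection and its curvature *)

#[local] Opaque bracket infact christoffel.

Section Curvature.
Context {R : realType} {d m n : nat}.
Variables (S : ymh_data R d m) (U : set 'rV[R]_n) (A : form1 R n d).
Hypotheses (Uo : open U) (As : forall i, smooth_on U (A i)).
Implicit Types i j k : 'I_n.

Let dA i x : U x -> differentiable (A i) x.
Proof. by move=> Ux; exact: (smooth_differentiable Uo (As i) Ux). Qed.

Let ddA i v x : U x -> differentiable ('D_v (A i)) x.
Proof. by move=> Ux; exact: (smooth_differentiable Uo (smooth_derive Uo (As i) v) Ux). Qed.

Lemma curvC i j x : curv S A i j x = - curv S A j i x.
Proof.
by rewrite /curv (bracketC S (A i x)) opprD opprB.
Qed.

Let dbr i j x : U x -> differentiable (fun y => bracket S (A i y) (A j y)) x.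
Proof.
move=> Ux; exact: (differentiable_bilinear (bracketDl S) (bracketDr S)
  (bracketZl S) (bracketZr S) (dA i Ux) (dA j Ux)).
Qed.

Lemma differentiable_curv i j x : U x -> differentiable (curv S A i j) x.
Proof.
move=> Ux.
exact: (differentiableD (differentiableB (ddA j _ Ux) (ddA i _ Ux)) (dbr i j Ux)).
Qed.

Lemma derive_curv i j x v : U x -> 'D_v (curv S A i j) x =
  'D_v (pderiv i (A j)) x - 'D_v (pderiv j (A i)) x
  + (bracket S ('D_v (A i) x) (A j x) + bracket S (A i x) ('D_v (A j) x)).
Proof.
move=> Ux.
have d1 : derivable (pderiv i (A j)) x v := diff_derivable (ddA j _ Ux).
have d2 : derivable (pderiv j (A i)) x v := diff_derivable (ddA i _ Ux).
apply: etrans (deriveD (derivableB d1 d2) (diff_derivable (dbr i j Ux))) _.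
apply: (congr2 +%R (deriveB d1 d2)).
exact: (derive_bilinear (bracketDl S) (bracketDr S)
  (bracketZl S) (bracketZr S) (dA i Ux) (dA j Ux) v).
Qed.

Lemma dcurvC k i j x : U x -> dcurv S A k i j x = - dcurv S A k j i x.
Proof.
move=> Ux; have bN u v : bracket S u (- v) = - bracket S u v.
  by rewrite -scaleN1r bracketZr scaleN1r.
have E : curv S A i j = - curv S A j i by apply/funext => y; exact: curvC.
rewrite /dcurv (curvC i j x) bN opprD E; apply: (congr1 (fun w => w + _)).
exact: (deriveN (diff_derivable (differentiable_curv j i Ux))).
Qed.

(** The cancellation in isolation: second derivatives [q] cancel in pairs by symmetry, brackets of A
    with its first derivatives by antisymmetry, and triple brackets by the Jacobi identity. *)
Let bianchi_algebra (B : 'rV[R]_d -> 'rV[R]_d -> 'rV[R]_d)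
    (a b c ab ac ba bc ca cb q1 q2 q3 q1' q2' q3' x1 x2 x3 : 'rV[R]_d) :
  (forall u v, B u v = - B v u) -> (forall u v w, B (u + v) w = B u w + B v w) ->
  (forall (r : R) u v, B (r *: u) v = r *: B u v) ->
  B (B a b) c + B (B b c) a + B (B c a) b = 0 ->
  q1 = q1' -> q2 = q2' -> q3 = q3' ->
  x1 = q1 - q2 + (B ab c + B b ac) + B a (bc - cb + B b c) ->
  x2 = q3 - q1' + (B bc a + B c ba) + B b (ca - ac + B c a) ->
  x3 = q2' - q3' + (B ca b + B a cb) + B c (ab - ba + B a b) ->
  x1 + x2 + x3 = 0.
Proof.
move=> BC BD BZ J <- <- <- -> -> ->.
have BN u v : B (- u) v = - B u v by rewrite -[- u]scaleN1r BZ scaleN1r.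
have Br u v w z : B u (v - w + z) = - B v u + B w u - B z u.
  by rewrite BC !BD BN !opprD opprK.
have {}J : B (B c a) b = - (B (B a b) c + B (B b c) a).
  by apply/eqP; rewrite -addr_eq0 addrC J.
rewrite !Br J (BC b ac) (BC c ba) (BC a cb).
by apply/rowP => l; rewrite !mxE; ring.
Qed.

Lemma bianchi k i j x : U x ->
  dcurv S A k i j x + dcurv S A i j k x + dcurv S A j k i x = 0.
Proof.
move=> Ux.
have s a b c : 'D_(basis_vec R a) (pderiv b (A c)) x = 'D_(basis_vec R b) (pderiv a (A c)) x.
  exact: (smooth_derive_sym Uo (As c) _ _ Ux).
have E a b c : dcurv S A a b c x =
    'D_(basis_vec R a) (pderiv b (A c)) x - 'D_(basis_vec R a) (pderiv c (A b)) x
    + (bracket S (pderiv a (A b) x) (A c x) + bracket S (A b x) (pderiv a (A c) x))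
    + bracket S (A a x) (pderiv b (A c) x - pderiv c (A b) x + bracket S (A b x) (A c x)).
  exact: (congr1 (fun w => w + _) (derive_curv b c _ Ux)).
exact: (bianchi_algebra (bracketC S) (bracketDl S) (bracketZl S)
  (bracket_jacobi S (A k x) (A i x) (A j x)) (s k i j) (s k j i) (s i j k)
  (E k i j) (E i j k) (E j k i)).
Qed.

(** The bracket term of the covariant derivative may be added freely: by [gram_bracket] it is
    orthogonal to F_ij. *)
Lemma derive_curv_ip k i j x : U x ->
  pderiv k (fun y => ip (gram S) (curv S A i j y) (curv S A i j y)) x =
  2 * ip (gram S) (dcurv S A k i j x) (curv S A i j x).
Proof.
move=> Ux; have dF := differentiable_curv i j Ux.
have dg : differentiable (fun=> gram S) x by exact: differentiable_cst.
have gp := gram_posdef S.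
have alg (t a a' c e w : R) : t = 0 -> a' = a -> w = a + c -> c + e = 0 ->
    e = c -> t + a + a' = 2 * w.
  by move=> -> -> -> h1 h2; rewrite h2 in h1; lra.
have K := gram_bracket S (A k x) (curv S A i j x) (curv S A i j x).
have D0 : ip (0 : 'M[R]_d) (curv S A i j x) (curv S A i j x) = 0.
  by rewrite -(scale0r (0 : 'M[R]_d)) ipZg mul0r.
have E : ip (gram S) (dcurv S A k i j x) (curv S A i j x) =
    ip (gram S) ('D_(basis_vec R k) (curv S A i j) x) (curv S A i j x) +
    ip (gram S) (bracket S (A k x) (curv S A i j x)) (curv S A i j x).
  exact: ipDl.
apply: etrans (derive_ip_eq dg dF dF erefl erefl erefl (derive_cst _ _ _) erefl erefl) _.
exact: (alg _ _ _ _ _ _ D0 (ipC _ _ gp) E K (ipC _ _ gp)).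
Qed.

End Curvature.

(** * Covariant derivatives along a section *)

Section AlongSection.
Context {R : realType} {d m n : nat}.
Variables (S : ymh_data R d m) (U : set 'rV[R]_n) (A : form1 R n d)
  (u : 'rV[R]_n -> ymh_N S) (p : ch_idx (ymh_N S)).
Hypotheses (Uo : open U) (As : forall i, smooth_on U (A i)) (us : smooth_section U u).
Implicit Types i j k : 'I_n.

Local Notation h := (ymh_h S p).
Local Notation v := (usec p u).

Definition chart_dom : set 'rV[R]_n := U `&` u @^-1` ch_dom p.

Lemma open_chart_dom : open chart_dom.
Proof.
rewrite openE => x [Ux px].
have H := near_ch_dom (us.1 x Ux) px.
by apply: filterS2 (open_near Uo Ux) H => y Uy py; split.
Qed.

Let Wo := open_chart_dom.

Let vs : smooth_on chart_dom v. Proof. exact: us.2. Qed.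

Lemma usec_img x : chart_dom x -> ch_img p (v x).
Proof. by move=> [_ px]; exact: ch_img_map. Qed.

Let dA i x : chart_dom x -> differentiable (A i) x.
Proof. by move=> [Ux _]; exact: (smooth_differentiable Uo (As i) Ux). Qed.

Lemma differentiable_usec x : chart_dom x -> differentiable v x.
Proof. by move=> Wx; exact: (smooth_differentiable Wo vs Wx). Qed.

Let ddv w x : chart_dom x -> differentiable ('D_w v) x.
Proof. by move=> Wx; exact: (smooth_differentiable Wo (smooth_derive Wo vs w) Wx). Qed.

Let dinf i x : chart_dom x -> differentiable (fun y => infact p (A i y) (v y)) x.
Proof.
move=> Wx.
exact: (differentiable_infact_along (dA i Wx) (differentiable_usec Wx) (usec_img Wx)).
Qed.

Lemma differentiable_du j x : chart_dom x -> differentiable (du p A u j) x.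
Proof. by move=> Wx; exact: (differentiableD (ddv _ Wx) (dinf j Wx)). Qed.

Lemma derive_du j x w : chart_dom x -> 'D_w (du p A u j) x =
  'D_w (pderiv j v) x + (infact p ('D_w (A j) x) (v x)
  + 'D_('D_w v x) (infact p (A j x)) (v x)).
Proof.
move=> Wx.
have d1 : derivable (pderiv j v) x w := diff_derivable (ddv _ Wx).
apply: etrans (deriveD d1 (diff_derivable (dinf j Wx))) _.
apply: (congr1 (fun z => _ + z)).
exact: (derive_infact_along (dA j Wx) (differentiable_usec Wx) (usec_img Wx)).
Qed.

(** Second derivatives of [v] and Christoffel terms cancel by symmetry. The derivatives of A supply
    dA in the curvature, and the commutator of the fields of A_i and A_j supplies the bracket. *)
Lemma dduC i j x : chart_dom x ->
  ddu p A u i j x - ddu p A u j i x = infact p (curv S A i j x) (v x).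
Proof.
move=> Wx; have px := usec_img Wx.
have hR := ymh_h_riemannian S.
have s : 'D_(basis_vec R i) (pderiv j v) x = 'D_(basis_vec R j) (pderiv i v) x.
  exact: (smooth_derive_sym Wo vs _ _ Wx).
have dX a := differentiable_infact a px.
have duE k : du p A u k x = pderiv k v x + infact p (A k x) (v x) by [].
rewrite /ddu /cov /infact_vec.
set Ga := christoffel _ _ _.
have GC a b : Ga a b = Ga b a by exact: (christoffelC hR px).
have GD a b c : Ga a (b + c) = Ga a b + Ga a c by exact: (christoffelDr hR px).
have DD k a b : 'D_(a + b) (infact p (A k x)) (v x) =
    'D_a (infact p (A k x)) (v x) + 'D_b (infact p (A k x)) (v x).
  exact: (deriveDdir _ _ (dX (A k x))).
have L := infact_lie (A i x) (A j x) px.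
have cE : infact p (curv S A i j x) (v x) =
   infact p (pderiv i (A j) x) (v x) - infact p (pderiv j (A i) x) (v x)
   + infact p (bracket S (A i x) (A j x)) (v x).
  apply: etrans (infactD _ _ px) _; apply: (congr1 (fun w => w + _)).
  exact: (infactB _ _ px).
have Di := derive_du j (basis_vec R i) Wx.
have Dj := derive_du i (basis_vec R j) Wx.
have alg (G : 'rV[R]_m -> 'rV[R]_m -> 'rV[R]_m) (D D' : 'rV[R]_m -> 'rV[R]_m)
    (t1 t2 q r1 r2 vi vj Xi Xj dj di c cb : 'rV[R]_m) :
    (forall a b, G a b = G b a) -> (forall a b e, G a (b + e) = G a b + G a e) ->
    (forall a b, D (a + b) = D a + D b) -> (forall a b, D' (a + b) = D' a + D' b) ->
    dj = vj + Xj -> di = vi + Xi ->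
    t1 = q + (r1 + D' vi) -> t2 = q + (r2 + D vj) ->
    c = r1 - r2 + cb -> D Xj - D' Xi = cb ->
    t1 + G vi dj + (D dj + G dj Xi) - (t2 + G vj di + (D' di + G di Xj)) = c.
  move=> CG DG D1 D2 -> -> -> -> -> <-.
  rewrite !DG ![G (_ + _) _]CG !DG D1 D2 (CG vj vi) (CG Xi vj) (CG Xi Xj) (CG Xj vi).
  by apply/rowP => l; rewrite !mxE; ring.
apply: (alg Ga (fun w => 'D_w (infact p (A i x)) (v x))
  (fun w => 'D_w (infact p (A j x)) (v x)) _ _ _ _ _ _ _ _ _ _ _ _ _ GC GD
  (DD i) (DD j) (duE j) (duE i) Di _ cE L).
by rewrite s; exact: Dj.
Qed.

(** Metric compatibility, needed only on the diagonal. The derivative of the metric along d_k [v] is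
    twice the Christoffel term paired with Y; the term A_k . Y is orthogonal to Y by the Killing
    equation. *)
Lemma derive_du_ip k i x : chart_dom x ->
  pderiv k (fun y => ip (h (v y)) (du p A u i y) (du p A u i y)) x =
  2 * ip (h (v x)) (ddu p A u k i x) (du p A u i x).
Proof.
have alg (a1 a2 a3 b c1 c2 e1 e2 k1 k2 k3 w : R) :
    w = b + c1 + (k2 + c2) -> c1 = (a1 + a2 - a2) / 2 -> c2 = (e1 + k1 - e2) / 2 ->
    k1 + k2 + k3 = 0 -> k3 = k2 -> e1 = e2 -> a3 = b -> a1 + b + a3 = 2 * w.
  by move=> -> -> -> H1 H2 -> ->; rewrite H2 in H1; lra.
move=> Wx; have px := usec_img Wx.
have hR := ymh_h_riemannian S.
have hp : posdef (h (v x)) by case: hR => + _ _; exact.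
have dv := differentiable_usec Wx; have dh := differentiable_metric hR px.
have ddui := differentiable_du i Wx.
have dhv := differentiable_comp dv dh.
have Dh : 'D_(basis_vec R k) (fun y => h (v y)) x = 'D_(pderiv k v x) h (v x).
  exact: (derive_chain _ dv dh).
apply: etrans (derive_ip_eq dhv ddui ddui erefl erefl erefl Dh erefl erefl) _.
set Y := du p A u i x; set DY := 'D_(basis_vec R k) (du p A u i) x.
have K := infact_killing (A k x) Y Y px.
have C1 := ip_christoffel hR px (pderiv k v x) Y Y.
have C2 := ip_christoffel hR px Y (infact p (A k x) (v x)) Y.
have E : ip (h (v x)) (ddu p A u k i x) Y = ip (h (v x)) DY Y
    + ip (h (v x)) (christoffel (ymh_h S) p (v x) (pderiv k v x) Y) Y
    + (ip (h (v x)) ('D_Y (infact p (A k x)) (v x)) Y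
      + ip (h (v x)) (christoffel (ymh_h S) p (v x) Y (infact p (A k x) (v x))) Y).
  exact: (etrans (ipDl _ _ _ _) (congr2 +%R (ipDl _ _ _ _) (ipDl _ _ _ _))).
exact: (alg _ _ _ _ _ _ _ _ _ _ _ _ E C1 C2 K (ipC _ _ hp)
  (ip_derive_metricC hR px _ _ _) (ipC _ _ hp)).
Qed.

End AlongSection.

(** * Uniform bounds on the compact target *)

(** By monotonicity a local bound K works for all larger K, that is, along the filter at +oo; the
    near-covering form of compactness makes it uniform. *)
Lemma compact_locally_bounded (R : realType) (X : topologicalType) (P : R -> X -> Prop) :
  compact [set: X] -> (forall K K' y, K <= K' -> P K y -> P K' y) ->
  (forall y : X, exists K, \forall y' \near y, P K y') ->
  exists K, 0 < K /\ forall y, P K y.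
Proof.
move=> Xc Pmono Ploc.
have H : \forall K \near +oo, [set: X] `<=` P K.
  have FF : Filter (pinfty_nbhs R) by exact: filter_filter.
  apply: ((compact_near_coveringP _).1 Xc R (pinfty_nbhs R) P FF) => y _.
  have [K PK] := Ploc y.
  exists ([set y' | P K y'], [set K' | K <= K']).
    by split; [exact: PK|exact: nbhs_pinfty_ge (num_real K)].
  move=> [y' K'] H; have [PKy' KK'] : P K y' /\ K <= K' := H.
  exact: (Pmono _ _ _ KK' PKy').
have [K [K0 HK]] := filter_ex (filterI (nbhs_pinfty_gt (num_real (0 : R))) H).
by exists K; split=> // y; exact: HK.
Qed.

Section InnerProductBounds.
Context {R : realType} {m : nat}.
Implicit Types (g : 'M[R]_m) (u v w : 'rV[R]_m).

(** Evaluates the right side when 2 a_i a_j <= a_i^2 + a_j^2 is summed over all pairs. *)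
Lemma sum_pair_mean (I : finType) (a : I -> R) :
  \sum_i \sum_j (a i + a j) / 2 = #|I|%:R * \sum_i a i.
Proof.
have E i : \sum_j (a i + a j) / 2 = (a i *+ #|I| + \sum_j a j) / 2.
  by rewrite -mulr_suml big_split /= sumr_const.
rewrite (eq_bigr _ (fun i _ => E i)) -mulr_suml big_split /= sumr_const sumrMnl.
by rewrite -mulr_natl; field.
Qed.

Lemma sqr_sum_le (I : finType) (a : I -> R) :
  (\sum_i a i) ^+ 2 <= #|I|%:R * \sum_i a i ^+ 2.
Proof.
have -> : (\sum_i a i) ^+ 2 = \sum_i \sum_j a i * a j.
  by rewrite expr2 mulr_suml; apply: eq_bigr => i _; rewrite mulr_sumr.
rewrite -sum_pair_mean.
apply: ler_sum => i _; apply: ler_sum => j _.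
by have := sqr_ge0 (a i - a j); nra.
Qed.

Lemma ip_cauchy_schwarz g u v : posdef g ->
  ip g u v ^+ 2 <= ip g u u * ip g v v.
Proof.
move=> gp; have [->|v0] := eqVneq v 0; first by rewrite !ip0r expr0n mulr0.
have vv : 0 < ip g v v by case: gp => _; exact.
have := ip_ge0 (ip g v v *: u - ip g u v *: v) gp.
rewrite ipBl !ipBr !ipZl !ipZr (ipC v u gp) => H.
have alg (b q p : R) : 0 < b -> 0 <= b * (b * q) - p * (b * p) -
    (b * (p * p) - p * (p * b)) -> p ^+ 2 <= q * b.
  by move=> b0 K; rewrite -(ler_pM2l b0); nra.
apply: alg vv _; move: H; rewrite mulrCA; set b := ip g v v.
by set q := ip g u u; set q' := ip g u v => H; apply: le_trans H _; rewrite le_eqVlt;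
  apply/orP; left; apply/eqP; ring.
Qed.

Lemma ip_sum_le g (I : finType) (F : I -> 'rV[R]_m) : posdef g ->
  ip g (\sum_i F i) (\sum_i F i) <= #|I|%:R * \sum_i ip g (F i) (F i).
Proof.
move=> gp; rewrite ip_suml; under eq_bigr do rewrite ip_sumr.
rewrite -sum_pair_mean.
apply: ler_sum => i _; apply: ler_sum => j _.
have := ip_ge0 (F i - F j) gp; rewrite ipBl !ipBr (ipC (F j) (F i) gp).
lra.
Qed.

(** Each coordinate functional is represented by a vector, so Cauchy-Schwarz gives the constant
    directly, without eigenvalues. *)
Lemma posdef_coercive g : posdef g ->
  exists K, 0 < K /\ forall w k, w 0 k ^+ 2 <= K * ip g w w.
Proof.
move=> gp.
pose r (k : 'I_m) := riesz g (fun w => w 0 k).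
have rE k w : ip g (r k) w = w 0 k.
  by apply: riesz_linear => // c u v; rewrite !mxE.
exists (1 + \sum_k ip g (r k) (r k)); split.
  by rewrite ltr_wpDr // sumr_ge0 // => k _; exact: ip_ge0.
move=> w k; rewrite -{1}rE (le_trans (ip_cauchy_schwarz _ _ gp)) //.
rewrite ler_wpM2r ?ip_ge0 // (bigD1 k) //= addrCA lerDl addr_ge0 //.
by rewrite sumr_ge0 // => i _; exact: ip_ge0.
Qed.

Lemma ip_perturb g : posdef g -> exists e, 0 < e /\ forall g', `|g - g'| <= e ->
  forall w, ip g w w <= 2 * ip g' w w.
Proof.
move=> gp; have [K [K0 HK]] := posdef_coercive gp.
(* The inverse of this number is the radius e. Each of the m^2 entries of g - g' contributes at most
   e K |w|^2, so the total stays below |w|^2 / 2; the 1 keeps the number positive when m = 0. *)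
have D0 : 0 < 2 * (1 + m%:R ^+ 2 * K).
  by rewrite mulr_gt0 // ltr_wpDr // mulr_ge0 ?exprn_ge0 // ltW.
exists (2 * (1 + m%:R ^+ 2 * K))^-1; split; first by rewrite invr_gt0.
move=> g' gg' w.
have E := ip_coordE (g - g') w w.
set e := (_)^-1 in gg'.
have e0 : 0 <= e by rewrite invr_ge0 ltW.
have B : ip (g - g') w w <= e * (m%:R ^+ 2 * (K * ip g w w)).
  rewrite E; apply: (@le_trans _ _ (\sum_(i < m) \sum_(j < m) (e * (K * ip g w w)))).
    apply: ler_sum => i _; apply: ler_sum => j _.
    rewrite (le_trans (ler_norm _)) // normrM mulrC ler_pM //.
      exact: le_trans (mx_entry_le_norm _ _ _) gg'.
    rewrite normrM -(ler_sqr (x := `|_| * _)) ?nnegrE ?mulr_ge0 ?ip_ge0 ?(ltW K0) //.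
    rewrite exprMn !real_normK ?num_real // [leRHS]expr2.
    exact: (ler_pM (sqr_ge0 _) (sqr_ge0 _) (HK w i) (HK w j)).
  rewrite !sumr_const !card_ord -mulrnA -[leLHS]mulr_natr natrM.
  by rewrite le_eqVlt; apply/orP; left; apply/eqP; ring.
have G : ip g w w = ip (g - g') w w + ip g' w w.
  by rewrite -ipDg subrK.
have ge0 := ip_ge0 w gp.
have L : e * (m%:R ^+ 2 * (K * ip g w w)) <= ip g w w / 2.
  rewrite /e ler_pdivrMl // mulrA; set q := m%:R ^+ 2 * K.
  have q0 : 0 <= q by rewrite mulr_ge0 ?exprn_ge0 // ltW.
  have alg (a b : R) : 0 <= a -> 0 <= b -> a * b <= 2 * (1 + a) * (b / 2) by nra.
  by rewrite alg.
lra.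
Qed.

End InnerProductBounds.

(** * Independence of the chart *)

Section ChartChange.
Context {R : realType} {d m : nat}.
Variables (S : ymh_data R d m) (p q : ch_idx (ymh_N S)) (y : ymh_N S).
Hypotheses (py : ch_dom p y) (qy : ch_dom q y).

Local Notation lg := (lg_chart (ymh_G S)).
Local Notation act := (ymh_act S).
Local Notation phi := (chart2 act lg p p).
Local Notation h := (ymh_h S).
Local Notation psi := (in_charts (fun z : ymh_N S => z) p q).
Local Notation V i := (fun x => ymh_V S (ch_inv i x)).
Local Notation x := (ch_map p y).

Let odom := open_ch_map (i := p) (@ch_dom_open _ _ _ q).

Let xdom : (ch_map p @` (ch_dom p `&` ch_dom q)) x.
Proof. by exists y. Qed.

Lemma differentiable_transition : differentiable psi x.
Proof. exact: (smooth_differentiable odom (@ch_transition _ _ _ p q) xdom). Qed.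

Lemma transitionE : psi x = ch_map q y.
Proof. by rewrite /in_charts ch_mapK. Qed.

Lemma transition_isometry v w :
  ip (h q (ch_map q y)) ('D_v psi x) ('D_w psi x) = ip (h p x) v w.
Proof. by have [_ _ hi] := ymh_h_riemannian S; exact: hi. Qed.

(** For small s the orbit of y stays in the domain of [p], so its expression in [q] is the image
    under [psi] of its expression in [p]. *)
Lemma infact_transition c : infact q c (ch_map q y) = 'D_(infact p c x) psi x.
Proof.
have px : ch_img p x := ch_img_map py.
pose H x' := phi (row_mx x' x).
have oex := act_dom1 (@ymh_act1 _ _ _ S) px.
have dphi := differentiable_act (@ymh_act_smooth _ _ _ S) oex.
have dH : differentiable H (lg_origin (ymh_G S)) := differentiable_partial_l dphi.
have H0 : H (lg_origin (ymh_G S)) = x := act_chart1 (@ymh_act1 _ _ _ S) px.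
have dpsi : differentiable psi (H (lg_origin (ymh_G S))).
  by rewrite H0; exact: differentiable_transition.
have dE : differentiable (exp_curve (ymh_exp S) c) (0 : R).
  by have [_ _ [dE _]] := @ymh_expP _ _ _ S c; exact/derivable1_diffP.
have nz : \forall z \near exp_curve (ymh_exp S) c 0, chart2_dom act lg p p (row_mx z x).
  rewrite (exp_curve0 (@ymh_expP _ _ _ S)).
  exact: (near_row_mx_l (open_chart2_dom (@ymh_act_smooth _ _ _ S)) oex).
have ns : \forall s \near (0 : R),
    chart2_dom act lg p p (row_mx (exp_curve (ymh_exp S) c s) x).
  exact: (differentiable_continuous dE nz).
have nE : \forall s \near (0 : R),
   ch_map q (act (ymh_exp S (s *: c)) (ch_inv q (ch_map q y))) =
   ((psi \o H) \o exp_curve (ymh_exp S) c) s.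
  apply: filterS2 (near_lie_exp (@ymh_expP _ _ _ S) c) ns => s lEs /chart2_dom_row_mx[_ _].
  rewrite /H /= chart2E /exp_curve /in_charts (ch_mapK lEs) (ch_mapK py) => pE.
  by rewrite (ch_mapK pE) (ch_mapK qy).
apply: etrans (near_eq_derive1 nE) _.
apply: etrans (derive1_exp_curve (@ymh_expP _ _ _ S) c (differentiable_comp dH dpsi)) _.
apply: etrans (derive_chain c dH dpsi) _.
rewrite H0 [X in 'D_X _ _](derive_partial_l dphi c).
by rewrite (infactE c px).
Qed.

Lemma differentiable_potential i z : ch_img i z -> differentiable (V i) z.
Proof.
by move=> iz; exact: (C1_on_differentiable (open_ch_img i) iz (@ymh_V_smooth _ _ _ S i 1)).
Qed.

Lemma derive_potential_transition w :
  'D_w (V p) x = 'D_('D_w psi x) (V q) (ch_map q y).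
Proof.
have nE : \forall x' \near x, V p x' = (V q \o psi) x'.
  apply: filterS (open_near odom xdom) => _ [z [pz qz] <-].
  by rewrite /in_charts /= (ch_mapK pz) (ch_mapK qz).
have dV : differentiable (V q) (psi x).
  by rewrite transitionE; exact/differentiable_potential/ch_img_map.
apply: etrans (near_eq_derive w nE) _.
apply: etrans (derive_chain w differentiable_transition dV) _.
by rewrite transitionE.
Qed.

End ChartChange.

Section UniformBounds.
Context {R : realType} {d m : nat}.
Variable S : ymh_data R d m.
Local Notation h := (ymh_h S).
Local Notation V i := (fun x => ymh_V S (ch_inv i x)).

Lemma near_chart (y : ymh_N S) (p : ch_idx (ymh_N S)) (Q : set 'rV[R]_m) :
  ch_dom p y -> nbhs (ch_map p y) Q -> \forall z \near y, Q (ch_map p z).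
Proof. by move=> py; exact: (ch_map_cont py). Qed.

Lemma near_le_value (f : 'rV[R]_m -> R) x :
  {for x, continuous f} -> \forall z \near x, f z <= f x + 1.
Proof.
move=> fc; have H : \forall z \near x, `|f x - f z| <= 1.
  exact: ((cvgrPdist_le _ _).1 fc 1 ltr01).
apply: filterS H => z; rewrite distrC => /(le_trans (ler_norm _)).
by rewrite lerBlDl addrC.
Qed.

Lemma infact_sum p (I : Type) (r : seq I) (a : I -> 'rV[R]_d) x : ch_img p x ->
  infact (S := S) p (\sum_(i <- r) a i) x = \sum_(i <- r) infact p (a i) x.
Proof.
move=> px; elim: r => [|i r IH].
  by rewrite !big_nil -(scale0r (0 : 'rV[R]_d)) infactZ // scale0r.
by rewrite !big_cons infactD // IH.
Qed.

Let infact_bounded K (y : ymh_N S) := forall p, ch_dom p y -> forall c,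
  ip (h p (ch_map p y)) (infact p c (ch_map p y)) (infact p c (ch_map p y))
  <= K * ip (gram S) c c.

Lemma infact_uniformly_bounded : exists K, 0 < K /\ forall y, infact_bounded K y.
Proof.
have gp := gram_posdef S.
apply: (@compact_locally_bounded R (ymh_N S) infact_bounded (@ymh_N_compact _ _ _ S)).
  move=> K K' y KK' PK p py c; apply: le_trans (PK p py c) _.
  by rewrite ler_wpM2r // ip_ge0.
move=> y0; have [p0 py0] := ch_cover y0.
have [kap [kap0 Hkap]] := posdef_coercive gp.
set x0 := ch_map p0 y0; have px0 : ch_img p0 x0 := ch_img_map py0.
pose B (k : 'I_d) x := ip (h p0 x) (infact p0 (delta_mx 0 k) x) (infact p0 (delta_mx 0 k) x).
have Bc k : {for x0, continuous (B k)}.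
  apply: differentiable_continuous; apply: differentiable_ip.
  - exact: (differentiable_metric (ymh_h_riemannian S) px0).
  - exact: differentiable_infact.
  - exact: differentiable_infact.
have nB : \forall z \near x0, forall k, B k z <= B k x0 + 1.
  by apply: (filter_forall _ (fun k => near_le_value (Bc k))).
exists (d%:R * \sum_k (kap * (B k x0 + 1))).
have n1 := near_chart py0 nB.
have n2 : \forall z \near y0, ch_dom p0 z by apply: open_nbhs_nbhs; split => //; exact: ch_dom_open.
apply: filterS2 n1 n2 => y By py0y p py c.
set x := ch_map p0 y; have px : ch_img p0 x := ch_img_map py0y.
have hp : posdef (h p0 x) by have [+ _ _] := ymh_h_riemannian S; exact.
rewrite -(transition_isometry py py0y) -(infact_transition py py0y c) -/x.
have cE : infact p0 c x = \sum_k c 0 k *: infact p0 (delta_mx 0 k) x.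
  rewrite [in LHS](row_sum_delta c) infact_sum //.
  by apply: eq_bigr => k _; rewrite infactZ.
rewrite cE (le_trans (ip_sum_le _ hp)) // card_ord -mulrA ler_wpM2l //.
rewrite mulr_suml; apply: ler_sum => k _.
rewrite ipZl ipZr; have alg (a b k' t g : R) : 0 <= b -> a ^+ 2 <= k' * g -> b <= t ->
    a * (a * b) <= k' * t * g.
  by move=> b0 ag bt; rewrite mulrA -expr2 [leRHS]mulrAC ler_pM ?sqr_ge0.
exact: (alg _ _ _ _ _ (ip_ge0 _ hp) (Hkap c k) (By k)).
Qed.

Let potential_bounded K (y : ymh_N S) := forall p, ch_dom p y -> forall w,
  ('D_w (V p) (ch_map p y)) ^+ 2 <= K * ip (h p (ch_map p y)) w w.

Let potential_uniformly_bounded : exists K, 0 < K /\ forall y, potential_bounded K y.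
Proof.
have hpos i x : ch_img i x -> posdef (h i x).
  by move=> ix; have [+ _ _] := ymh_h_riemannian S; exact.
apply: (@compact_locally_bounded R (ymh_N S) potential_bounded (@ymh_N_compact _ _ _ S)).
  move=> K K' y KK' PK p py c; apply: le_trans (PK p py c) _.
  by rewrite ler_wpM2r // ip_ge0 //; exact/hpos/ch_img_map.
move=> y0; have [p0 py0] := ch_cover y0.
set x0 := ch_map p0 y0; have px0 : ch_img p0 x0 := ch_img_map py0.
have [kap [kap0 Hkap]] := posdef_coercive (hpos _ _ px0).
have [e [e0 He]] := ip_perturb (hpos _ _ px0).
have Vc k : {for x0, continuous (fun x => (pderiv k (V p0) x) ^+ 2)}.
  have Vk : {for x0, continuous (pderiv k (V p0))}.
    exact: (((@ymh_V_smooth _ _ _ S p0 1).2 k).2.1 x0 px0).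
  by apply: continuousM.
have nV : \forall z \near x0, forall k,
    (pderiv k (V p0) z) ^+ 2 <= (pderiv k (V p0) x0) ^+ 2 + 1.
  by apply: (filter_forall _ (fun k => near_le_value (Vc k))).
have nh : \forall z \near x0, `|h p0 x0 - h p0 z| <= e.
  have hc := differentiable_continuous (differentiable_metric (ymh_h_riemannian S) px0).
  exact: ((cvgrPdist_le _ _).1 hc e e0).
(* Here [kap] belongs to the metric at [x0]; the 2 compares that metric with the one at the nearby
   point. *)
exists (m%:R * \sum_k (2 * kap * ((pderiv k (V p0) x0) ^+ 2 + 1))).
have n1 := near_chart py0 nV; have n1' := near_chart py0 nh.
have n2 : \forall z \near y0, ch_dom p0 z by apply: open_nbhs_nbhs; split => //; exact: ch_dom_open.
apply: filterS3 n1 n1' n2 => y Vy hy py0y p py w0.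
set x := ch_map p0 y; have px : ch_img p0 x := ch_img_map py0y.
rewrite (derive_potential_transition py py0y) -(transition_isometry py py0y) -/x.
set w := 'D_w0 _ _.
have dV := differentiable_potential px.
have wE : 'D_w (V p0) x = \sum_k w 0 k * pderiv k (V p0) x.
  rewrite [in LHS](row_sum_delta w) (derive_sumdir _ _ dV).
  by apply: eq_bigr => k _; exact: (deriveZdir _ _ dV).
rewrite wE (le_trans (sqr_sum_le _)) // card_ord -mulrA ler_wpM2l //.
rewrite mulr_suml; apply: ler_sum => k _.
have alg (a b t g g0 : R) : b ^+ 2 <= t -> a ^+ 2 <= kap * g0 -> g0 <= 2 * g ->
    (a * b) ^+ 2 <= 2 * kap * t * g.
  move=> bt ag gg; rewrite exprMn [leRHS]mulrAC ler_pM ?sqr_ge0 //.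
  by rewrite (le_trans ag) // (mulrC 2) -mulrA ler_wpM2l // ltW.
exact: (alg _ _ _ _ _ (Vy k) (Hkap w k) (He _ hy w)).
Qed.

(** The bound on dV is evaluated at the gradient itself: s = |grad V|^2 satisfies s^2 <= K s. *)
Lemma grad_uniformly_bounded : exists K, 0 < K /\
  forall (y : ymh_N S) p, ch_dom p y ->
  ip (h p (ch_map p y)) (grad h (ymh_V S) p (ch_map p y))
    (grad h (ymh_V S) p (ch_map p y)) <= K.
Proof.
have [K [K0 HK]] := potential_uniformly_bounded.
exists K; split=> // y p py; have px := ch_img_map py.
have hp : posdef (h p (ch_map p y)) by have [+ _ _] := ymh_h_riemannian S; exact.
set w := grad _ _ _ _; have dV := differentiable_potential px.
have E : ip (h p (ch_map p y)) w w = 'D_w (V p) (ch_map p y).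
  apply: (riesz_linear (l := fun z => 'D_z (V p) (ch_map p y))) => // k a b.
  by apply: etrans (deriveDdir _ _ dV) _; rewrite (deriveZdir _ _ dV).
have := HK y p py w; rewrite -E; set s := ip _ _ _ => H.
have s0 : 0 <= s by exact: ip_ge0.
have alg (a b : R) : 0 < b -> 0 <= a -> a ^+ 2 <= b * a -> a <= b by move=> *; nra.
exact: alg K0 s0 H.
Qed.

End UniformBounds.

(** * Kato inequalities for tensors *)

(** The scalar part of [hessian_kato]: [F] = |f|^2, [s] = |sigma|^2, [x] pairs the antisymmetric
    part of W with f (x) w, [c] pairs the trace with sigma; [a], [q], [ww] are the squared norms of
    antisymmetric part, trace and W. *)
Lemma hessian_kato_algebra (R : realFieldType) (N eta F s x c a q ww : R) :
  2 <= N -> 0 < eta -> 0 <= s -> s <= F -> 0 <= a -> 0 <= q ->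
  0 <= a - eta * x - eta * (x - eta * F) ->
  0 <= q - eta * c - (eta * c - eta * (eta * s)) ->
  (let t := N / (N - 1) in
   0 <= ww - t * (2 * F - x) + 2 * (t / N) * c + t ^+ 2 * ((F + s) / 2 - s / N)) ->
  N / (N - 1) * (1 - eta) * F - N / (N - 1) / eta * (a + q) <= ww.
Proof.
move=> N2 eta0 s0 sF a0 q0 H1 H2 /=.
set t := N / (N - 1).
have t0 : 0 < t by rewrite divr_gt0 //; lra.
have N0 : 0 < N by lra.
have tN : t * (1 - N^-1) = 1.
  by rewrite /t; field; rewrite ?subr_eq0 ?gt_eqF //; lra.
have iN0 : 0 < N^-1 by rewrite invr_gt0.
have iN2 : N^-1 <= 1 / 2 by rewrite div1r lef_pV2 ?posrE.
have ie0 : 0 < eta^-1 by rewrite invr_gt0.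
have S1 : 2 * x <= a / eta + eta * F.
  by rewrite -(ler_pM2l eta0) [leRHS]mulrDr [eta * (_ / eta)]mulrC divfK ?gt_eqF //; lra.
have S2 : 2 * c <= q / eta + eta * s.
  by rewrite -(ler_pM2l eta0) [leRHS]mulrDr [eta * (_ / eta)]mulrC divfK ?gt_eqF //; lra.
(* The worst case is s = F, because N >= 2. The choice of t, i.e. t (1 - 1/N) = 1, then turns the
   quadratic term into at most t F. *)
have S3 : (F + s) / 2 - s / N <= F * (1 - N^-1).
  have : 0 <= (1 / 2 - N^-1) * (F - s) by rewrite mulr_ge0 // subr_ge0.
  by lra.
have S4 : t ^+ 2 * ((F + s) / 2 - s / N) <= t * F.
  rewrite expr2 -mulrA ler_pM2l //.
  by apply: le_trans (ler_wpM2l (ltW t0) S3) _; rewrite mulrCA tN mulr1.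
have ae0 : 0 <= a / eta by rewrite mulr_ge0 // ltW.
have qe0 : 0 <= q / eta by rewrite mulr_ge0 // ltW.
have es : eta * s <= eta * F by rewrite ler_pM2l.
have S5 : 2 * (N^-1 * c) <= (q / eta + eta * F) / 2.
  have : N^-1 * (2 * c) <= N^-1 * (q / eta + eta * F).
    by rewrite ler_pM2l //; lra.
  have : N^-1 * (q / eta + eta * F) <= 1 / 2 * (q / eta + eta * F).
    by rewrite ler_wpM2r // addr_ge0 // mulr_ge0 ?(ltW eta0) // (le_trans s0).
  by lra.
have K : 0 <= t * (eta * F + a / eta + q / eta - x - 2 * (N^-1 * c)).
  by rewrite mulr_ge0 ?(ltW t0) //; lra.
move: S4; set u := t ^+ 2 * _ => S4 H3.
have E : t / eta * (a + q) = t * (a / eta + q / eta) by ring.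
have E' : 2 * (t / N) * c = t * (2 * (N^-1 * c)) by ring.
rewrite E; rewrite E' in H3; lra.
Qed.

Section HessianKato.
Context {R : realType} {m n : nat}.
Variable g : 'M[R]_m.
Hypotheses (gp : posdef g) (n2 : (2 <= n)%N).
Local Notation family := ('I_n -> 'I_n -> 'rV[R]_m).
Implicit Types S T U : family.

Let P S T := \sum_i \sum_j ip g (S i j) (T i j).

Let PC S T : P S T = P T S.
Proof. by apply: eq_bigr => i _; apply: eq_bigr => j _; exact: ipC. Qed.

Let PL S T U (c : R) : P (fun i j => S i j - c *: T i j) U = P S U - c * P T U.
Proof.
rewrite /P mulr_sumr -sumrB; apply: eq_bigr => i _.
by rewrite mulr_sumr -sumrB; apply: eq_bigr => j _; rewrite ipBl ipZl.
Qed.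

Let PR S T U (c : R) : P U (fun i j => S i j - c *: T i j) = P U S - c * P U T.
Proof. by rewrite PC PL (PC S) (PC T). Qed.

Let P_ge0 S : 0 <= P S S.
Proof. by apply: sumr_ge0 => i _; apply: sumr_ge0 => j _; exact: ip_ge0. Qed.

Variables (W : family) (w : 'I_n -> 'rV[R]_m) (f : 'I_n -> R).
Hypotheses (w1 : \sum_i ip g (w i) (w i) = 1)
  (fE : forall k, f k = \sum_i ip g (W k i) (w i)).

Let F := \sum_k f k ^+ 2.
(** The common trace of f (x) w and its transpose; its squared norm [s] is also the inner product of
    these two families. *)
Let sigma := \sum_k f k *: w k.
Let s := ip g sigma sigma.
Let tau := \sum_i W i i.
Let X : family := fun k i => f k *: w i.
Let X' : family := fun k i => f i *: w k.
Let D : family := fun k i => (k == i)%:R *: sigma.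

Let PXX : P X X = F.
Proof.
apply: eq_bigr => k _; rewrite /X; under eq_bigr do rewrite ipZl ipZr mulrA -expr2.
by rewrite -mulr_sumr w1 mulr1.
Qed.

Let PX'X' : P X' X' = F.
Proof. by rewrite -PXX /P exchange_big. Qed.

Let PXX' : P X X' = s.
Proof.
rewrite /s ip_suml /P exchange_big; apply: eq_bigr => k _ /=.
rewrite ip_sumr; apply: eq_bigr => i _; rewrite !(ipZl, ipZr); ring.
Qed.

Let PD S : P S D = ip g (\sum_i S i i) sigma.
Proof.
rewrite ip_suml; apply: eq_bigr => k _; rewrite (bigD1 k) //= big1 => [|i ik].
  by rewrite addr0 /D eqxx scale1r.
by rewrite /D eq_sym (negbTE ik) scale0r ip0r.
Qed.

Let PDD : P D D = n%:R * s.
Proof.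
rewrite PD; have -> : \sum_i D i i = n%:R *: sigma.
  by rewrite /D; under eq_bigr do rewrite eqxx scale1r; rewrite sumr_const card_ord scaler_nat.
by rewrite ipZl.
Qed.

Let PWX : P W X = F.
Proof.
apply: eq_bigr => k _; rewrite /X; under eq_bigr do rewrite ipZr.
by rewrite -mulr_sumr -fE expr2.
Qed.

Let A : family := fun k i => W k i - W i k.

(** Transposing both families moves the transpose onto W, whose transpose is W - A. *)
Let PWX' : P W X' = F - P A X.
Proof.
have -> : P A X = P W X - P (fun k i => W i k) X.
  rewrite /P -sumrB; apply: eq_bigr => k _; rewrite -sumrB.
  by apply: eq_bigr => i _; rewrite ipBl.
rewrite PWX opprB addrC subrK /P exchange_big //.
Qed.

Let s_le_F : s <= F.
Proof.
have := P_ge0 (fun k i => X k i - 1 *: X' k i).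
rewrite !PL !PR PXX PX'X' PXX' (PC X' X) PXX'; lra.
Qed.

Lemma hessian_kato (eta : R) : 0 < eta ->
  n%:R / (n%:R - 1) * (1 - eta) * F
  - n%:R / (n%:R - 1) / eta * (\sum_k \sum_i ip g (A k i) (A k i) + ip g tau tau)
  <= \sum_k \sum_i ip g (W k i) (W k i).
Proof.
move=> eta0.
have n0 : 2 <= n%:R :> R by rewrite (ler_nat R 2 n).
have s0 : 0 <= s by exact: ip_ge0.
have PXD : P X D = s by rewrite PD.
have PX'D : P X' D = s by rewrite PD.
have PWD : P W D = ip g tau sigma by rewrite PD.
have H1 := P_ge0 (fun k i => A k i - eta *: X k i).
have H2 := ip_ge0 (tau - eta *: sigma) gp.
pose t : R := n%:R / (n%:R - 1).
(* t times the symmetric traceless part of f_k w_i *)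
have H3 := P_ge0 (fun k i => W k i - (t / 2) *: X k i - (t / 2) *: X' k i - (- (t / n%:R)) *: D k i).
rewrite !PL !PR (PC X A) PXX in H1.
rewrite ipBl !ipBr !ipZl !ipZr (ipC sigma tau gp) in H2.
apply: (hessian_kato_algebra n0 eta0 s0 s_le_F (P_ge0 A) (ip_ge0 tau gp) H1 H2).
rewrite /= -/t.
rewrite !PL !PR (PC X W) (PC X' W) (PC D W) (PC X' X) (PC D X) (PC D X') in H3.
rewrite PXX PX'X' PXX' PDD PXD PX'D PWD PWX PWX' in H3.
apply: le_trans H3 _; rewrite le_eqVlt; apply/orP; left; apply/eqP.
by rewrite -/(P W W); field; rewrite gt_eqF //; lra.
Qed.

End HessianKato.

Lemma sum_cycle (V : nmodType) n (E : 'I_n -> 'I_n -> 'I_n -> V) :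
  \sum_k \sum_i \sum_j E k i j = \sum_k \sum_i \sum_j E i j k.
Proof.
rewrite [RHS]exchange_big; apply: eq_bigr => k _ /=.
by rewrite exchange_big.
Qed.

Lemma eq_opp_eq0 (R : realFieldType) q (v : 'rV[R]_q) : v = - v -> v = 0.
Proof.
by move=> vN; apply/rowP => l; have := congr1 (fun u : 'rV[R]_q => u 0 l) vN; rewrite !mxE; lra.
Qed.

Section CurvatureKato.
Context {R : realType} {m n : nat}.
Variable g : 'M[R]_m.
Hypothesis gp : posdef g.
Local Notation family := ('I_n -> 'I_n -> 'I_n -> 'rV[R]_m).
Implicit Types S T U : family.

Let P S T := \sum_k \sum_i \sum_j ip g (S k i j) (T k i j).

Let PC S T : P S T = P T S.
Proof.
by apply: eq_bigr => k _; apply: eq_bigr => i _; apply: eq_bigr => j _; exact: ipC.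
Qed.

Let PL S T U (c : R) : P (fun k i j => S k i j - c *: T k i j) U = P S U - c * P T U.
Proof.
rewrite /P mulr_sumr -sumrB; apply: eq_bigr => k _.
rewrite mulr_sumr -sumrB; apply: eq_bigr => i _.
by rewrite mulr_sumr -sumrB; apply: eq_bigr => j _; rewrite ipBl ipZl.
Qed.

Let PR S T U (c : R) : P U (fun k i j => S k i j - c *: T k i j) = P U S - c * P U T.
Proof. by rewrite PC PL (PC S) (PC T). Qed.

Let P_ge0 S : 0 <= P S S.
Proof.
apply: sumr_ge0 => k _; apply: sumr_ge0 => i _; apply: sumr_ge0 => j _; exact: ip_ge0.
Qed.

Let antisym S := forall k i j, S k i j = - S k j i.
Let contr S j := \sum_i S i i j.

(** Sums run over ordered pairs i, j and count each component of a 2-form twice: hence the 2 in [w1]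
    and [fE], and the halving of [P T T] at the end. *)
Variables (T : family) (w : 'I_n -> 'I_n -> 'rV[R]_m) (f : 'I_n -> R).
Hypotheses (wC : forall i j, w i j = - w j i)
  (w1 : \sum_i \sum_j ip g (w i j) (w i j) = 2)
  (fE : forall k, 2 * f k = \sum_i \sum_j ip g (T k i j) (w i j))
  (TC : forall k i j, T k i j = - T k j i)
  (T_bianchi : forall k i j, T k i j + T i j k + T j k i = 0).

Let F := \sum_k f k ^+ 2.
Let X : family := fun k i j => f k *: w i j.
Let C : family := fun k i j => f k *: w i j + f i *: w j k + f j *: w k i.
Let sigma j := \sum_i f i *: w i j.
Let rho := contr T.
(** The pure trace family with contraction (n - 1) nu. Paired with a family antisymmetric in its
    last two indices, it sees only the contraction. *)
Let N (nu : 'I_n -> 'rV[R]_m) : family :=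
  fun k i j => (k == i)%:R *: nu j - (k == j)%:R *: nu i.
Let b := \sum_j ip g (sigma j) (sigma j).
Let q := \sum_j ip g (rho j) (rho j).
Let c := \sum_j ip g (rho j) (sigma j).

(** Cyclic summation is self-adjoint. Thus the Bianchi identity makes T orthogonal to [C], and C,
    being invariant, is its own cyclic sum up to the factor 3. *)
Let PSC S : P S C = P (fun k i j => S k i j + S i j k + S j k i) X.
Proof.
have -> : P S C = \sum_k \sum_i \sum_j ip g (S k i j) (f k *: w i j)
   + \sum_k \sum_i \sum_j ip g (S k i j) (f i *: w j k)
   + \sum_k \sum_i \sum_j ip g (S k i j) (f j *: w k i).
  rewrite -!big_split; apply: eq_bigr => k _ /=.
  rewrite -!big_split; apply: eq_bigr => i _ /=.
  by rewrite -!big_split; apply: eq_bigr => j _ /=; rewrite !ipDr.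
rewrite [X in _ + X + _]sum_cycle [X in _ + X + _]sum_cycle.
rewrite [X in _ + _ + X]sum_cycle.
rewrite /P -!big_split; apply: eq_bigr => k _ /=.
rewrite -!big_split; apply: eq_bigr => i _ /=.
by rewrite -!big_split; apply: eq_bigr => j _ /=; rewrite !ipDl addrAC.
Qed.

Let PTX : P T X = 2 * F.
Proof.
rewrite /F mulr_sumr; apply: eq_bigr => k _.
rewrite expr2 mulrCA mulrC fE mulr_suml; apply: eq_bigr => i _.
by rewrite mulr_suml; apply: eq_bigr => j _; rewrite ipZr mulrC.
Qed.

Let PXX : P X X = 2 * F.
Proof.
rewrite /F mulr_sumr; apply: eq_bigr => k _.
rewrite -w1 mulr_suml; apply: eq_bigr => i _.
rewrite mulr_suml; apply: eq_bigr => j _; rewrite ipZl ipZr; ring.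
Qed.

Let PTC : P T C = 0.
Proof.
rewrite PSC /P; apply: big1 => k _; apply: big1 => i _; apply: big1 => j _.
by rewrite T_bianchi ip0l.
Qed.

Let bE : b = \sum_k \sum_i \sum_j f k * f i * ip g (w k j) (w i j).
Proof.
rewrite /b [RHS]sum_cycle; apply: eq_bigr => j _.
rewrite ip_suml; apply: eq_bigr => k _; rewrite ip_sumr; apply: eq_bigr => i _.
by rewrite ipZl ipZr; ring.
Qed.

Let PXC : P X C = 2 * (F - b).
Proof.
have Eb2 : \sum_k \sum_i \sum_j ip g (X k i j) (f i *: w j k) = - b.
  rewrite bE -sumrN; apply: eq_bigr => k _; rewrite -sumrN; apply: eq_bigr => i _.
  rewrite -sumrN; apply: eq_bigr => j _.
  by rewrite /X (wC j k) ipZl ipZr ipNr (ipC (w i j) (w k j) gp); ring.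
have Eb3 : \sum_k \sum_i \sum_j ip g (X k i j) (f j *: w k i) = - b.
  rewrite bE -sumrN; apply: eq_bigr => k _; rewrite exchange_big -sumrN.
  apply: eq_bigr => i _; rewrite -sumrN; apply: eq_bigr => j _.
  by rewrite /X (wC j i) ipZl ipZr ipNl (ipC (w i j) (w k j) gp); ring.
have -> : P X C = P X X + \sum_k \sum_i \sum_j ip g (X k i j) (f i *: w j k)
   + \sum_k \sum_i \sum_j ip g (X k i j) (f j *: w k i).
  rewrite /P -!big_split; apply: eq_bigr => k _ /=.
  rewrite -!big_split; apply: eq_bigr => i _ /=.
  by rewrite -!big_split; apply: eq_bigr => j _ /=; rewrite !ipDr.
by rewrite PXX Eb2 Eb3; ring.
Qed.

Let PCC : P C C = 6 * (F - b).
Proof.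
have -> : P C C = 3 * P X C.
  rewrite PSC (PC X C) /P mulr_sumr; apply: eq_bigr => k _.
  rewrite mulr_sumr; apply: eq_bigr => i _.
  rewrite mulr_sumr; apply: eq_bigr => j _.
  rewrite -ipZl; congr (ip g _ _).
  by apply/rowP => l; rewrite !mxE; ring.
by rewrite PXC; ring.
Qed.

Let PSN S nu : antisym S -> P S (N nu) = 2 * \sum_j ip g (contr S j) (nu j).
Proof.
move=> SC.
have E1 : \sum_k \sum_i \sum_j ip g (S k i j) ((k == i)%:R *: nu j) =
    \sum_j ip g (contr S j) (nu j).
  rewrite [RHS](eq_bigr (fun j => \sum_k ip g (S k k j) (nu j))); last first.
    by move=> j _; rewrite ip_suml.
  rewrite [RHS]exchange_big; apply: eq_bigr => k _ /=.
  rewrite (bigD1 k) //= [X in _ + X]big1 => [|i ik].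
    by rewrite addr0; apply: eq_bigr => j _; rewrite eqxx scale1r.
  by apply: big1 => j _; rewrite eq_sym (negbTE ik) scale0r ip0r.
have E2 : \sum_k \sum_i \sum_j ip g (S k i j) ((k == j)%:R *: nu i) =
    - \sum_j ip g (contr S j) (nu j).
  rewrite -E1 -sumrN; apply: eq_bigr => k _; rewrite exchange_big -sumrN.
  apply: eq_bigr => j _; rewrite -sumrN; apply: eq_bigr => i _.
  by rewrite SC ipNl.
have -> : P S (N nu) = \sum_k \sum_i \sum_j ip g (S k i j) ((k == i)%:R *: nu j)
   - \sum_k \sum_i \sum_j ip g (S k i j) ((k == j)%:R *: nu i).
  rewrite /P -!sumrB; apply: eq_bigr => k _.
  rewrite -!sumrB; apply: eq_bigr => i _.
  by rewrite -!sumrB; apply: eq_bigr => j _; rewrite ipBr.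
by rewrite E1 E2; ring.
Qed.

Let PXN nu : P X (N nu) = 2 * \sum_j ip g (sigma j) (nu j).
Proof. by apply: PSN => k i j; rewrite /X wC scalerN. Qed.

(** The contraction of [C] vanishes by antisymmetry of w, so cyclic and trace parts are
    orthogonal. *)
Let PCN nu : P C (N nu) = 0.
Proof.
rewrite PSN => [|k i j].
  rewrite big1 ?mulr0 // => j _; rewrite /contr big1 ?ip0l // => i _.
  have wii : w i i = 0.
    exact: eq_opp_eq0.
  by rewrite /C wii scaler0 addr0 (wC j i) scalerN subrr.
by rewrite /C (wC i j) (wC j k) (wC k i) !scalerN !opprD addrAC.
Qed.

Let PNN nu : P (N nu) (N nu) = 2 * ((n%:R - 1) * \sum_j ip g (nu j) (nu j)).
Proof.
rewrite PSN => [|k i j]; last by rewrite /N opprB.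
congr (2 * _); rewrite mulr_sumr; apply: eq_bigr => j _; rewrite -ipZl.
congr (ip g _ _); rewrite /contr /N sumrB.
under eq_bigr do rewrite eqxx scale1r.
rewrite sumr_const card_ord (bigD1 j) //= eqxx scale1r big1 => [|i ij].
  by rewrite addr0 scalerBl scale1r scaler_nat.
by rewrite (negbTE ij) scale0r.
Qed.

Lemma contraction_le : b <= F.
Proof. by have := P_ge0 C; rewrite PCC pmulr_rge0 // subr_ge0. Qed.

(** The value of t is left open because the best one depends on the dimension: 3/2 for n = 3, (n -
    1) / (n - 2) for n >= 4. *)
Lemma curvature_kato_expand (t : R) : 1 < n%:R :> R ->
  2 * t * F - t ^+ 2 * (F - (F - b) / 3 - b / (n%:R - 1))
  + q / (n%:R - 1) - 2 * t * c / (n%:R - 1) <= P T T / 2.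
Proof.
move=> n1.
have n0 : n%:R - 1 != 0 :> R by rewrite subr_eq0 gt_eqF.
pose nu j := (n%:R - 1)^-1 *: (rho j - t *: sigma j).
have Crho : \sum_j ip g (rho j) (nu j) = (q - t * c) / (n%:R - 1).
  rewrite mulrC mulr_sumr -sumrB mulr_sumr.
  by apply: eq_bigr => j _; rewrite ipZr ipBr ipZr.
have Csig : \sum_j ip g (sigma j) (nu j) = (c - t * b) / (n%:R - 1).
  rewrite mulrC mulr_sumr -sumrB mulr_sumr.
  by apply: eq_bigr => j _; rewrite ipZr ipBr ipZr (ipC (sigma j) (rho j) gp).
have Cnu : \sum_j ip g (nu j) (nu j) = (q - 2 * t * c + t ^+ 2 * b) / (n%:R - 1) ^+ 2.
  rewrite mulrC !mulr_sumr -sumrB -big_split mulr_sumr.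
  apply: eq_bigr => j _; rewrite ipZl ipZr ipBl !ipBr !ipZl !ipZr.
  by rewrite (ipC (sigma j) (rho j) gp) /=; field.
(* C is 3 times the cyclic part of X, and nu makes the contraction vanish. *)
have H := P_ge0 (fun k i j => T k i j - t *: X k i j - (- (t / 3)) *: C k i j - 1 *: N nu k i j).
rewrite !PL !PR (PC X T) (PC C T) (PC (N nu) T) (PC C X) (PC (N nu) X) (PC (N nu) C) in H.
rewrite PTX PXX PTC PXC PCC PXN PCN PNN (PSN nu TC) Crho Csig Cnu in H.
rewrite -subr_ge0; apply: le_trans (mulr_ge0 H (_ : 0 <= 2^-1)) _ => //.
by rewrite le_eqVlt; apply/orP; left; apply/eqP; field.
Qed.

Lemma contraction_young (eta : R) :
  2 * eta * \sum_j ip g (rho j) (sigma j) <=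
  \sum_j ip g (rho j) (rho j) + eta ^+ 2 * b.
Proof.
rewrite /b !mulr_sumr -big_split; apply: ler_sum => j _ /=.
have := ip_ge0 (rho j - eta *: sigma j) gp.
rewrite ipBl !ipBr !ipZl !ipZr (ipC (sigma j) (rho j) gp); lra.
Qed.

End CurvatureKato.

(** * The theorem *)

(** The first-order expansions at x + s v and x - s v, with f nonnegative at both points, bound D_v
    f from both sides. *)
Lemma derive_at_zero_min (R : realType) (V : normedModType R) (f : V -> R) x v :
  differentiable f x -> (forall y, 0 <= f y) -> f x = 0 -> 'D_v f x = 0.
Proof.
move=> df f0 fx0; apply/eqP; rewrite -normr_le0; apply/ler_addgt0Pl => e e0.
rewrite addr0.
have v1 : 0 < `|v| + 1 by rewrite ltr_wpDl.
have H := littleo_diff df (divr_gt0 e0 v1).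
have [d /= d0 dP] := (nbhs_ballP _ _).1 H.
pose s : R := d / 2 / (`|v| + 1).
have s0 : 0 < s by rewrite !divr_gt0.
have sN : s * (`|v| + 1) = d / 2 by rewrite /s divfK // gt_eqF.
have svN : `|s *: v| <= s * (`|v| + 1).
  by rewrite normrZ gtr0_norm // ler_pM2l // lerDl.
have sv : `|s *: v| < d.
  by apply: (le_lt_trans svN); rewrite sN ltr_pdivrMr // ltr_pMr // ltr1n.
have bnd : e / (`|v| + 1) * `|s *: v| <= e * s.
  apply: le_trans (ler_wpM2l _ svN) _; first by rewrite divr_ge0 // ltW.
  by rewrite mulrCA divfK ?gt_eqF // mulrC.
have B1 : ball 0 d (s *: v) by rewrite -ball_normE /= sub0r normrN.
have B2 : ball 0 d (- (s *: v)) by rewrite -ball_normE /= sub0r opprK.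
have alg (a D : R) : 0 <= a -> `|a - 0 - D| <= e * s -> - D <= e * s.
  by move=> a0; rewrite subr0 ler_norml => /andP[_ K]; lra.
have K1 := dP _ B1; have K2 := dP _ B2; move: K1 K2.
rewrite fx0 normrN (deriveNdir _ df) (deriveZdir _ _ df) => K1 K2.
have {}K1 := alg _ _ (f0 _) (le_trans K1 bnd).
have {K2}K2 := alg _ _ (f0 _) (le_trans K2 bnd).
rewrite opprK in K2.
have fin (D : R) : - (s * D) <= e * s -> s * D <= e * s -> `|D| <= e.
  move=> k1 k2; rewrite ler_norml lerNl; apply/andP.
  by split; rewrite -(ler_pM2l s0) ?mulrN (mulrC s e).
exact: fin.
Qed.

(** Differentiability of the norm is assumed, so the product rule on its square suffices; the square
    root is never differentiated and zeros of Q are allowed. *)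
Lemma derive_sqrt (R : realType) (V : normedModType R) (Q : V -> R) x v :
  differentiable (fun y => Num.sqrt (Q y)) x ->
  (\forall y \near x, 0 <= Q y) ->
  2 * Num.sqrt (Q x) * 'D_v (fun y => Num.sqrt (Q y)) x = 'D_v Q x.
Proof.
move=> dN Q0; set N := fun y => Num.sqrt (Q y).
have nE : \forall y \near x, (N * N) y = Q y.
  by apply: filterS Q0 => y; rewrite /N => Qy; rewrite -[RHS](sqr_sqrtr Qy) expr2.
apply: etrans _ (near_eq_derive _ nE).
have dv := diff_derivable (v := v) dN.
apply: etrans _ (esym (deriveM dv dv)).
have alg (a D : R) : 2 * a * D = a * D + a * D by ring.
exact: alg.
Qed.

Lemma open_punctured_ball (R : realType) n (r : R) : open (@punctured_ball R n r).
Proof.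
rewrite openE => x /= /andP[x0 xr].
have Ec : {for x, continuous (@enorm R n)}.
  have d2 : differentiable (fun y : 'rV[R]_n => \sum_i y 0 i ^+ 2) x.
    apply: (@differentiable_bigsum _ _ R) => i.
    have dx := differentiable_coord x 0 i.
    have nE : \forall y \near x,
        ((fun z : 'rV[R]_n => z 0 i) * (fun z : 'rV[R]_n => z 0 i)) y = y 0 i ^+ 2.
      by apply: filterE => y; rewrite expr2.
    exact: near_eq_differentiable nE (differentiableM dx dx).
  apply: (continuous_comp (differentiable_continuous d2)).
  exact: sqrt_continuous.
have H1 : \forall y \near x, 0 < enorm y by exact: (cvgr_gt _ Ec _ x0).
have H2 : \forall y \near x, enorm y < r by exact: (cvgr_lt _ Ec _ xr).
by apply: filterS2 H1 H2 => y y0 yr; rewrite /punctured_ball /= y0.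
Qed.

Lemma sum_lt_half (R : numFieldType) n (E : 'I_n -> 'I_n -> R) :
  (forall i j, E i j = E j i) -> (forall i, E i i = 0) ->
  \sum_(i < n) \sum_(j < n) E i j = 2 * \sum_(i < n) \sum_(j < n | (i < j)%N) E i j.
Proof.
move=> ES E0.
have split i : \sum_(j < n) E i j =
    \sum_(j < n | (i < j)%N) E i j + \sum_(j < n | (j < i)%N) E i j.
  rewrite (bigID (fun j : 'I_n => (i < j)%N)) /=; congr (_ + _).
  rewrite (bigD1 i) /= ?ltnn // E0 add0r; apply: eq_bigl => j.
  by rewrite -leqNgt ltn_neqAle andbC.
rewrite (eq_bigr _ (fun i _ => split i)) big_split /= mulr2n mulrDl mul1r; congr (_ + _).
rewrite [LHS](exchange_big_dep predT) //=; apply: eq_bigr => i _.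
by apply: eq_bigr => j _; exact: ES.
Qed.

(** * The inequality for the section *)

Section HessianInequality.
Context {R : realType} {d m n : nat}.
Variables (S : ymh_data R d m) (U : set 'rV[R]_n) (A : form1 R n d)
  (u : 'rV[R]_n -> ymh_N S) (p : ch_idx (ymh_N S)).
Hypotheses (Uo : open U) (As : forall i, smooth_on U (A i)) (us : smooth_section U u).

Local Notation h := (ymh_h S p).
Local Notation v := (usec p u).

Lemma usec_posdef x : chart_dom U u p x -> posdef (h (v x)).
Proof.
by move=> Wx; have [+ _ _] := ymh_h_riemannian S; apply; exact: usec_img Wx.
Qed.

Lemma du_normsq_ge0 x : chart_dom U u p x -> 0 <= du_normsq p A u x.
Proof.
by move=> Wx; apply: sumr_ge0 => i _; apply: ip_ge0; exact: usec_posdef.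
Qed.

Lemma derive_du_norm k x : chart_dom U u p x -> differentiable (du_norm p A u) x ->
  du_norm p A u x * pderiv k (du_norm p A u) x =
  \sum_i ip (h (v x)) (ddu p A u k i x) (du p A u i x).
Proof.
move=> Wx dN.
have Q0 : \forall y \near x, 0 <= du_normsq p A u y.
  apply: filterS (open_near (open_chart_dom (p := p) Uo us) Wx) => y; exact: du_normsq_ge0.
have H := derive_sqrt (basis_vec R k) dN Q0.
have dh := differentiable_metric (ymh_h_riemannian S) (usec_img Wx).
have dhv := differentiable_comp (differentiable_usec Uo us Wx) dh.
have dt i : differentiable (fun y => ip (h (v y)) (du p A u i y) (du p A u i y)) x.
  have ddui := differentiable_du Uo As us i Wx.
  exact: (differentiable_ip dhv ddui ddui).
have E : 'D_(basis_vec R k) (du_normsq p A u) x =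
    \sum_i 2 * ip (h (v x)) (ddu p A u k i x) (du p A u i x).
  apply: etrans (derive_bigsum (W := R) _ _ dt) _.
  by apply: eq_bigr => i _; exact: (derive_du_ip Uo As us).
rewrite -mulr_sumr in E.
have alg (a D s : R) : 2 * a * D = 2 * s -> a * D = s by lra.
exact: (alg _ _ _ (etrans H E)).
Qed.

Lemma hessian_inequality (delta K1 K2 : R) x : (2 <= n)%N -> 0 < delta ->
  0 < K1 -> 0 < K2 ->
  (forall y q, ch_dom q y -> forall c,
    ip (ymh_h S q (ch_map q y)) (infact q c (ch_map q y)) (infact q c (ch_map q y))
    <= K1 * ip (gram S) c c) ->
  (forall y q, ch_dom q y ->
    ip (ymh_h S q (ch_map q y)) (grad (ymh_h S) (ymh_V S) q (ch_map q y))
      (grad (ymh_h S) (ymh_V S) q (ch_map q y)) <= K2) ->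
  chart_dom U u p x -> differentiable (du_norm p A u) x ->
  rough_lap p A u x = - grad (ymh_h S) (ymh_V S) p (v x) ->
  (n%:R / (n%:R - 1) - delta) * grad_normsq (du_norm p A u) x
  - (n%:R / (n%:R - 1)) ^+ 2 / delta * (2 * K1 + K2) * (1 + curv_normsq S A x)
  <= ddu_normsq p A u x.
Proof.
move=> n2 d0 K10 K20 HK1 HK2 Wx dN lap.
have hp := usec_posdef Wx; have [Ux px] := Wx.
have n0 : 2 <= n%:R :> R by rewrite (ler_nat R 2 n).
set t : R := n%:R / (n%:R - 1).
have t0 : 0 < t by rewrite divr_gt0 ?subr_gt0; lra.
have Q0 : 0 <= curv_normsq S A x.
  apply: sumr_ge0 => i _; apply: sumr_ge0 => j _; apply: ip_ge0; exact: gram_posdef.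
have W0 : 0 <= ddu_normsq p A u x.
  by apply: sumr_ge0 => i _; apply: sumr_ge0 => j _; exact: ip_ge0.
have C0 : 0 <= t ^+ 2 / delta * (2 * K1 + K2) * (1 + curv_normsq S A x).
  rewrite !mulr_ge0 ?exprn_ge0 ?invr_ge0 ?(ltW t0) ?(ltW d0) //; lra.
have [N0|N0] := eqVneq (du_norm p A u x) 0.
  have -> : grad_normsq (du_norm p A u) x = 0.
    apply: big1 => k _; rewrite /pderiv (derive_at_zero_min _ dN) ?expr0n //.
    by move=> y; exact: sqrtr_ge0.
  rewrite mulr0 sub0r; lra.
set r := du_norm p A u x in N0.
have rr : \sum_i ip (h (v x)) (du p A u i x) (du p A u i x) = r ^+ 2.
  by rewrite sqr_sqrtr // du_normsq_ge0.
pose w i := r^-1 *: du p A u i x.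
have w1 : \sum_i ip (h (v x)) (w i) (w i) = 1.
  under eq_bigr do rewrite ipZl ipZr.
  by rewrite -!mulr_sumr rr; field.
have fE k : pderiv k (du_norm p A u) x = \sum_i ip (h (v x)) (ddu p A u k i x) (w i).
  under eq_bigr do rewrite ipZr.
  by rewrite -mulr_sumr -(derive_du_norm k Wx dN) mulKf.
(* With this eta, t (1 - eta) = t - delta and the error constant t / eta is t^2 / delta. *)
have eta0 : 0 < delta / t by rewrite divr_gt0.
have H := hessian_kato hp n2 w1 fE eta0.
apply: le_trans _ H; rewrite -/t.
(* The factor 2 arises because |F_A|^2 sums only over i < j. *)
have B1 : \sum_k \sum_i ip (h (v x)) (ddu p A u k i x - ddu p A u i k x)
    (ddu p A u k i x - ddu p A u i k x) <= 2 * K1 * curv_normsq S A x.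
  have -> : 2 * K1 * curv_normsq S A x = K1 * \sum_k \sum_i
      ip (gram S) (curv S A k i x) (curv S A k i x).
    have HS := sum_lt_half (E := fun i j => ip (gram S) (curv S A i j x) (curv S A i j x)).
    have alg (s : R) : 2 * K1 * s = K1 * (2 * s) by ring.
    apply: etrans (alg _) (congr1 ( *%R K1) (esym (HS _ _))) => [i j|i].
      by rewrite (curvC S A i j) ipNl ipNr opprK.
    by rewrite (eq_opp_eq0 (curvC S A i i x)) ip0l.
  rewrite mulr_sumr; apply: ler_sum => k _; rewrite mulr_sumr; apply: ler_sum => i _.
  by rewrite (dduC Uo As us k i Wx); exact: HK1.
have B2 : ip (h (v x)) (\sum_i ddu p A u i i x) (\sum_i ddu p A u i i x) <= K2.
  have -> : \sum_i ddu p A u i i x = grad (ymh_h S) (ymh_V S) p (v x).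
    exact: oppr_inj lap.
  exact: HK2.
have E1 : t * (1 - delta / t) = t - delta by field; rewrite gt_eqF.
have E2 : t / (delta / t) = t ^+ 2 / delta by field; rewrite !gt_eqF.
rewrite E1 E2; apply: lerB => //.
have alg (c : R) : 0 <= c -> 2 * K1 * c + K2 <= (2 * K1 + K2) * (1 + c).
  by move=> c0; have := mulr_ge0 (ltW K20) c0; lra.
have cd : 0 <= t ^+ 2 / delta by rewrite divr_ge0 ?exprn_ge0 ?ltW.
apply: le_trans (ler_wpM2l cd (le_trans (lerD B1 B2) (alg _ Q0))) _.
by rewrite mulrA.
Qed.

End HessianInequality.

(** Here [b] = |sigma|^2 for the contraction sigma of f (x) w, [q] = |rho|^2 for that of T, and [c]
    = <rho, sigma>. The cross term is absorbed by Young's inequality with parameter delta (N -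
    2). *)
Lemma curvature_kato_algebra (R : realFieldType) (N F b c q T delta : R) :
  4 <= N -> 0 < delta -> b <= F -> 0 <= q ->
  (let t := (N - 1) / (N - 2) in
   2 * t * F - t ^+ 2 * (F - (F - b) / 3 - b / (N - 1)) + q / (N - 1)
   - 2 * t * c / (N - 1) <= T) ->
  2 * (delta * (N - 2)) * c <= q + (delta * (N - 2)) ^+ 2 * b ->
  ((N - 1) / (N - 2) - delta) * F - (N - 2) ^- 2 / delta * q <= T.
Proof.
move=> N4 d0 bF q0 /=; set M := N - 2 => H Y.
have M2 : 2 <= M by rewrite /M; lra.
have NE : N - 1 = M + 1 by rewrite /M; ring.
rewrite NE in H *; set t := (M + 1) / M in H *.
have M0 : M != 0 by rewrite gt_eqF //; lra.
have M1 : M + 1 != 0 by rewrite gt_eqF //; lra.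
have iM : 0 < M^-1 by rewrite invr_gt0; lra.
have iM2 : M^-1 <= 1 / 2 by rewrite div1r lef_pV2 ?posrE //; lra.
have tE : t = 1 + M^-1 by rewrite /t; field.
have t0 : 0 < t by rewrite tE; lra.
have tM : t * (b / (M + 1)) = b / M by rewrite /t; field; rewrite M0 M1.
(* The slack is (2/3) (1/2 - 1/M) (F - b), nonnegative exactly because n >= 4 gives M >= 2. Equality
   at b = F is what leaves no room for the cross term. *)
have S1 : t * (F - (F - b) / 3 - b / (M + 1)) <= F.
  have K : 0 <= (1 / 2 - M^-1) * (F - b) by rewrite mulr_ge0 // subr_ge0.
  rewrite mulrBr tM tE; lra.
have S2 : t ^+ 2 * (F - (F - b) / 3 - b / (M + 1)) <= t * F.
  by rewrite expr2 -mulrA ler_pM2l.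
have S3 : 2 * t * c / (M + 1) = 2 * c / M by rewrite /t; field; rewrite M0 M1.
have D0 : delta != 0 by rewrite gt_eqF.
have dM : 0 < delta * M ^+ 2 by rewrite mulr_gt0 // exprn_gt0 //; lra.
have S4 : 2 * c / M <= M ^- 2 / delta * q + delta * b.
  rewrite -(ler_pM2l dM).
  have -> : delta * M ^+ 2 * (2 * c / M) = 2 * (delta * M) * c by field.
  have -> : delta * M ^+ 2 * (M ^- 2 / delta * q + delta * b) = q + (delta * M) ^+ 2 * b.
    by field; rewrite D0 M0.
  exact: Y.
have S5 : delta * b <= delta * F by rewrite ler_pM2l.
have q1 : 0 <= q / (M + 1) by rewrite mulr_ge0 // invr_ge0; lra.
rewrite S3 in H; move: S2 H S4; set e1 := t ^+ 2 * _; set e2 := M ^- 2 / delta * q => S2 H S4.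
rewrite mulrBl; lra.
Qed.

(** * The inequality for the curvature *)

Section CurvatureInequality.
Context {R : realType} {d m n : nat}.
Variables (S : ymh_data R d m) (U : set 'rV[R]_n) (A : form1 R n d).
Hypotheses (Uo : open U) (As : forall i, smooth_on U (A i)).
Variable x : 'rV[R]_n.
Hypothesis Ux : U x.

Let gp := gram_posdef S.
Local Notation T := (fun k i j => dcurv S A k i j x).
Local Notation rho := (fun j => \sum_i dcurv S A i i j x).
Local Notation F := (grad_normsq (curv_norm S A) x).
Local Notation q := (\sum_j ip (gram S) (rho j) (rho j)).

Lemma curv_normsq_ge0 y : 0 <= curv_normsq S A y.
Proof. by apply: sumr_ge0 => i _; apply: sumr_ge0 => j _; exact: ip_ge0. Qed.

Let half_sum (B : 'I_n -> 'I_n -> 'rV[R]_d) (B' : 'I_n -> 'I_n -> 'rV[R]_d) :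
  (forall i j, B i j = - B j i) -> (forall i j, B' i j = - B' j i) ->
  \sum_i \sum_j ip (gram S) (B i j) (B' i j) =
  2 * \sum_(i < n) \sum_(j < n | (i < j)%N) ip (gram S) (B i j) (B' i j).
Proof.
move=> BC B'C; apply: (sum_lt_half (E := fun i j => ip (gram S) (B i j) (B' i j))) => [i j|i].
  by rewrite (BC i j) (B'C i j) ipNl ipNr opprK.
by rewrite (eq_opp_eq0 (BC i i)) ip0l.
Qed.

Lemma derive_curv_norm k : differentiable (curv_norm S A) x ->
  2 * (curv_norm S A x * pderiv k (curv_norm S A) x) =
  \sum_i \sum_j ip (gram S) (dcurv S A k i j x) (curv S A i j x).
Proof.
move=> dN.
have Q0 : \forall y \near x, 0 <= curv_normsq S A y.
  by apply: filterE => y; exact: curv_normsq_ge0.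
have H := derive_sqrt (basis_vec R k) dN Q0.
have dt i j : differentiable (fun y => ip (gram S) (curv S A i j y) (curv S A i j y)) x.
  have dF := differentiable_curv S Uo As i j Ux.
  exact: (differentiable_ip (differentiable_cst _ _) dF dF).
have nE : \forall y \near x, \sum_i \sum_j
    ip (gram S) (curv S A i j y) (curv S A i j y) = (2 \*o curv_normsq S A) y.
  by apply: filterE => y; apply: half_sum => i j; exact: curvC.
have dQ : differentiable (curv_normsq S A) x.
  apply: (@differentiable_bigsum _ _ R) => i.
  rewrite (_ : (fun _ => _) = fun y => \sum_(j < n)
     (if (i < j)%N then ip (gram S) (curv S A i j y) (curv S A i j y) else 0)); last first.
    by apply/funext => y; rewrite big_mkcond.
  apply: (@differentiable_bigsum _ _ R) => j; case: (i < j)%N; first exact: dt.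
  exact: differentiable_cst.
have E2 : 'D_(basis_vec R k) (2 \*o curv_normsq S A) x =
    2 * 'D_(basis_vec R k) (curv_normsq S A) x.
  exact: (deriveMl _ (diff_derivable dQ)).
have E1 : 'D_(basis_vec R k) (2 \*o curv_normsq S A) x =
    \sum_i \sum_j 2 * ip (gram S) (dcurv S A k i j x) (curv S A i j x).
  apply: etrans (esym (near_eq_derive _ nE)) _.
  have dt' i : differentiable (fun y => \sum_j ip (gram S) (curv S A i j y) (curv S A i j y)) x.
    by apply: (@differentiable_bigsum _ _ R) => j; exact: dt.
  apply: etrans (derive_bigsum (W := R) _ _ dt') _; apply: eq_bigr => i _.
  apply: etrans (derive_bigsum (W := R) _ _ (dt i)) _; apply: eq_bigr => j _.
  exact: (derive_curv_ip S Uo As).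
have E3 : \sum_i \sum_j 2 * ip (gram S) (dcurv S A k i j x) (curv S A i j x) =
    2 * \sum_i \sum_j ip (gram S) (dcurv S A k i j x) (curv S A i j x).
  by rewrite mulr_sumr; apply: eq_bigr => i _; rewrite mulr_sumr.
have alg (a D e s : R) : 2 * a * D = e -> 2 * e = 2 * s -> 2 * (a * D) = s by lra.
exact: (alg _ _ _ _ H (etrans (esym E2) (etrans E1 E3))).
Qed.

Lemma curvature_inequality_expand (t : R) : (2 < n)%N ->
  differentiable (curv_norm S A) x -> curv_norm S A x != 0 -> exists b c,
  [/\ 2 * t * F - t ^+ 2 * (F - (F - b) / 3 - b / (n%:R - 1))
      + q / (n%:R - 1) - 2 * t * c / (n%:R - 1) <= dcurv_normsq S A x,
      b <= F & forall eta, 2 * eta * c <= q + eta ^+ 2 * b].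
Proof.
move=> n2 dN; set r := curv_norm S A x => r0.
have n1 : 1 < n%:R :> R by rewrite (ltr_nat R 1 n) ltnW.
have rr : r ^+ 2 = curv_normsq S A x by rewrite sqr_sqrtr // curv_normsq_ge0.
pose w i j := r^-1 *: curv S A i j x.
have wC i j : w i j = - w j i by rewrite /w curvC scalerN.
have w1 : \sum_i \sum_j ip (gram S) (w i j) (w i j) = 2.
  apply: etrans (half_sum wC wC) _.
  have -> : \sum_(i < n) \sum_(j < n | (i < j)%N) ip (gram S) (w i j) (w i j) =
      r^-1 * (r^-1 * curv_normsq S A x).
    rewrite /curv_normsq !mulr_sumr; apply: eq_bigr => i _.
    by rewrite !mulr_sumr; apply: eq_bigr => j _; rewrite ipZl ipZr.
  by rewrite -rr; field.
have fE k : 2 * pderiv k (curv_norm S A) x = \sum_i \sum_j ip (gram S) (T k i j) (w i j).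
  have -> : \sum_i \sum_j ip (gram S) (T k i j) (w i j) =
      r^-1 * \sum_i \sum_j ip (gram S) (T k i j) (curv S A i j x).
    rewrite mulr_sumr; apply: eq_bigr => i _.
    by rewrite mulr_sumr; apply: eq_bigr => j _; rewrite ipZr.
  by rewrite -(derive_curv_norm k dN) -/r; field.
have TC k i j : T k i j = - T k j i by exact: (dcurvC S Uo As k i j Ux).
have TB k i j : T k i j + T i j k + T j k i = 0 by exact: (bianchi S Uo As k i j Ux).
have PTT : (\sum_k \sum_i \sum_j ip (gram S) (T k i j) (T k i j)) / 2 = dcurv_normsq S A x.
  rewrite mulr_suml; apply: eq_bigr => k _.
  have HS := half_sum (B := fun i j => dcurv S A k i j x)
    (B' := fun i j => dcurv S A k i j x) (TC k) (TC k).
  have alg (s : R) : 2 * s / 2 = s by field.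
  exact: (etrans (congr1 (fun s => s / 2) HS) (alg _)).
have H := curvature_kato_expand gp wC w1 fE TC TB t n1.
have H2 := contraction_le gp (fun k => pderiv k (curv_norm S A) x) wC w1.
have H3 := contraction_young gp T w (fun k => pderiv k (curv_norm S A) x).
rewrite PTT in H.
eexists; eexists; split; [exact: H|exact: H2|exact: H3].
Qed.

Let norm_eq0 : differentiable (curv_norm S A) x -> curv_norm S A x = 0 -> F = 0.
Proof.
move=> dN N0; apply: big1 => k _.
rewrite /pderiv (derive_at_zero_min _ dN) ?expr0n //.
by move=> y; exact: sqrtr_ge0.
Qed.

Let dcurv_normsq_ge0 : 0 <= dcurv_normsq S A x.
Proof.
by apply: sumr_ge0 => k _; apply: sumr_ge0 => i _; apply: sumr_ge0 => j _; exact: ip_ge0.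
Qed.

Let q_ge0 : 0 <= q.
Proof. by apply: sumr_ge0 => j _; exact: ip_ge0. Qed.

Lemma curvature_inequality3 : n = 3%N -> differentiable (curv_norm S A) x ->
  3 / 2 * F - q <= dcurv_normsq S A x.
Proof.
move=> n3 dN; have n2 : (2 < n)%N by rewrite n3.
(* At t = 3/2, the maximum of 2 t - (2/3) t^2, the main term is 3/2 F with a surplus 3 b / 8 + q /
   2. Young's inequality with eta = 1/2 bounds the cross term 3 c / 2 by 3 q / 2 + 3 b / 8, so
   exactly q is lost. *)
have alg (f b' c' q' D : R) :
    2 * (3 / 2) * f - (3 / 2) ^+ 2 * (f - (f - b') / 3 - b' / 2) + q' / 2
      - 2 * (3 / 2) * c' / 2 <= D ->
    2 * (1 / 2) * c' <= q' + (1 / 2) ^+ 2 * b' -> 3 / 2 * f - q' <= D by lra.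
have [N0|N0] := eqVneq (curv_norm S A x) 0.
  rewrite (norm_eq0 dN N0) mulr0 sub0r.
  by apply: le_trans dcurv_normsq_ge0; rewrite oppr_le0.
have [b [c [H _ Y]]] := curvature_inequality_expand (3 / 2) n2 dN N0.
have {Y} := Y (1 / 2); move: H.
have -> : n%:R - 1 = 2 :> R by rewrite n3; ring.
exact: alg.
Qed.

Lemma curvature_inequality4 (delta : R) : (4 <= n)%N -> 0 < delta ->
  differentiable (curv_norm S A) x ->
  ((n%:R - 1) / (n%:R - 2) - delta) * F - (n%:R - 2) ^- 2 / delta * q
  <= dcurv_normsq S A x.
Proof.
move=> n4 d0 dN; have n2 : (2 < n)%N by apply: leq_trans n4.
have N4 : 4 <= n%:R :> R by rewrite (ler_nat R 4 n).
have iq0 : 0 <= (n%:R - 2) ^- 2 / delta * q.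
  by rewrite mulr_ge0 // divr_ge0 ?invr_ge0 ?exprn_ge0 ?(ltW d0) //; lra.
have [N0|N0] := eqVneq (curv_norm S A x) 0.
  rewrite (norm_eq0 dN N0) mulr0 sub0r.
  by apply: le_trans dcurv_normsq_ge0; rewrite oppr_le0.
set t := (n%:R - 1) / (n%:R - 2).
have [b [c [H bF Y]]] := curvature_inequality_expand t n2 dN N0.
exact: (curvature_kato_algebra N4 d0 bF q_ge0 H (Y _)).
Qed.

End CurvatureInequality.

Theorem theorem3p6 (R : realType) (d m : nat) (S : ymh_data R d m)
    (n : nat) (hn : (2 <= n)%N) (delta : R) (hdelta : 0 < delta) :
  exists C : R, 0 < C /\
  forall (R0 : R) (A : form1 R n d) (u : 'rV[R]_n -> ymh_N S),
    0 < R0 ->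
    ymh_field (punctured_ball (2 * R0)) A u ->
    forall (x : 'rV[R]_n) (p : ch_idx (ymh_N S)),
      punctured_ball (2 * R0) x -> ch_dom p (u x) ->
      (differentiable (du_norm p A u) x ->
         ddu_normsq p A u x >=
           (n%:R / (n%:R - 1) - delta) * grad_normsq (du_norm p A u) x
           - C * (1 + curv_normsq S A x)) /\
      (differentiable (curv_norm S A) x ->
         (n = 3%N ->
            dcurv_normsq S A x >=
              3 / 2 * grad_normsq (curv_norm S A) x - upull_normsq p A u x) /\
         ((4 <= n)%N ->
            dcurv_normsq S A x >=
              ((n%:R - 1) / (n%:R - 2) - delta) * grad_normsq (curv_norm S A) x
              - C * upull_normsq p A u x)).
Proof.
have [K1 [K10 HK1]] := infact_uniformly_bounded S.
have [K2 [K20 HK2]] := grad_uniformly_bounded S.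
set C1 := (n%:R / (n%:R - 1)) ^+ 2 / delta * (2 * K1 + K2).
(* For n = 2 this is 0, the inverse of 0 being 0; it is used only when n >= 4. The sum 1 + C1 + C2
   is positive and serves both parts. *)
set C2 := (n%:R - 2) ^- 2 / delta.
have C10 : 0 <= C1.
  have K0 : 0 <= 2 * K1 + K2 by rewrite addr_ge0 ?mulr_ge0 // ltW.
  by rewrite mulr_ge0 // divr_ge0 ?sqr_ge0 // ltW.
have C20 : 0 <= C2 by rewrite divr_ge0 ?invr_ge0 ?sqr_ge0 // ltW.
exists (1 + C1 + C2); split; first by rewrite -addrA ltr_pwDl // addr_ge0.
move=> R0 A u _ [As us YM lap] x p Ux px.
have Uo := @open_punctured_ball R n (2 * R0).
have leC (a b q w : R) : a - b * q <= w -> 0 <= q -> b <= 1 + C1 + C2 ->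
    a - (1 + C1 + C2) * q <= w.
  move=> H q0 bC; apply: le_trans H.
  by rewrite lerD2l lerN2 ler_wpM2r.
have curv0 : 0 <= 1 + curv_normsq S A x by rewrite addr_ge0 // curv_normsq_ge0.
have upull0 : 0 <= upull_normsq p A u x.
  by apply: sumr_ge0 => j _; apply: ip_ge0; exact: gram_posdef.
(* The Yang-Mills equation identifies the contraction of the covariant derivative of F_A; the two
   minus signs cancel. *)
have qE : \sum_j ip (gram S) (\sum_i dcurv S A i i j x) (\sum_i dcurv S A i i j x)
    = upull_normsq p A u x.
  by apply: eq_bigr => j _; rewrite (oppr_inj (YM x p Ux px j)).
split=> [dN|dN].
  have H := hessian_inequality Uo As us hn hdelta K10 K20 HK1 HK2 (conj Ux px) dN
    (lap x p Ux px).
  by apply: (leC _ _ _ _ H curv0); rewrite addrAC lerDr addr_ge0.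
split=> [n3|n4].
  by rewrite -qE; exact: (curvature_inequality3 Uo As Ux n3 dN).
have H := curvature_inequality4 Uo As Ux n4 hdelta dN.
by rewrite qE in H; apply: (leC _ _ _ _ H upull0); rewrite lerDr addr_ge0.
Qed.
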